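(* There exist absolute constants $c\in(0,1/6)$, $c'>0$, $c_1\in(0,1)$ and absolute constants $K_1,K_2,K_3,K_4>0$ (the latter entering the definitions of $F_1,F_2,F_3$ below) such that the following holds in the setup of the context. Let $\delta\in(0,c_1)$, $v\ge 1$, $r>0$ and $\mathcal S\subseteq[|\mathcal E|d^2]$. Define $$\zeta_1=K_1\Big(\sum_{l=1}^m\sum_{t=0}^{T-1}\mathrm{Tr}(\Gamma_t(A_l^* ))\Big)\log(1/\delta),\qquad F_1=\sqrt2\Big(\frac{\zeta_1}{m}+1\Big)^{1/2}\Big(\log(1/\delta)+\frac{d^2}{2}\log\Big(\frac{\zeta_1}{m}+1\Big)\Big)^{1/2},$$ $$\zeta_2=K_2\,\mu^2\Big[\max_{l\in[m],i\in[d]}e_i^\top\Big(\sum_{t=1}^T\Gamma_{t-1}(A_l^* )\Big)e_i\Big]\log^2\Big(\frac{d^2|\mathcal E|}{\delta}\Big),\qquad F_2=K_3\,\zeta_2^{1/2},$$ $$F_3=K_4\beta^2\Big[(\mu')^2\Psi^2\log(d^2|\mathcal E|)+\mu'\sqrt T\,\Psi\sqrt{\log(d^2|\mathcal E|)}+\sqrt T\Big],\qquad \Psi=4\frac{\sqrt{|\mathcal S|}}{\kappa_{\mathcal S}}+\frac4r\|(\widetilde Da^* )_{\mathcal S^c}\|_1+1 .$$ Suppose $\lambda\ge\frac2m\max\{F_1,F_2\}$ and that 1. $F_3\sqrt v\le cT$; 2. $\frac{\beta^2}{m}(\sqrt{mT}+d)(d+v)\le cT$; 3. $\frac{\mu}{\sqrt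 m}\Big(1+\frac{\sqrt{|\mathcal S|}}{\kappa_{\mathcal S}}+\frac1r\|(\widetilde Da^* )_{\mathcal S^c}\|_1\Big)\Big[d\,\Delta_G+\beta^2d\sqrt T\log\Big(\frac{|\mathcal E|d}{\delta}\Big)\Big]\le cT$. Then with probability at least $1-4\exp(-c'\sqrt v)-\delta$, the estimator $\widehat a$ satisfies $$\|\widehat a-a^*\|_2\le\frac{2m\lambda}{T}\Big(1+3\frac{\sqrt{|\mathcal S|}}{\kappa_{\mathcal S}}\Big)+\sqrt{8\frac{\lambda m}{T}\|(\widetilde Da^* )_{\mathcal S^c}\|_1}+r.$$
   Context: Setup. Let $d,T\ge1$, $m\ge2$ be integers and $G=([m],\mathcal E)$ an undirected connected graph. Let $A_1^*,\dots,A_m^*\in\mathbb R^{d\times d}$ be deterministic matrices. For each $l\in[m]$, $x_{l,0}=0$ and $x_{l,t+1}=A_l^*x_{l,t}+\eta_{l,t+1}$ for $t=0,\dots,T$, where the $\eta_{l,t}$ are i.i.d. $\mathcal N(0,I_d)$ over all $l,t$. Vectorized model. $\mathrm{vec}$ stacks columns. $X_l=[x_{l,1}\cdots x_{l,T}]$, $\widetilde X_l=[x_{l,2}\cdots x_{l,T+1}]$, $E_l=[\eta_{l,2}\cdots\eta_{l,T+1}]$, all in $\mathbb R^{d\times T}$. $Q=\mathrm{blkdiag}(X_l^\top\otimes I_d)_{l=1}^m$; $a^*\in\mathbb R^{md^2}$, $\widetilde x\in\mathbb R^{mdT}$, $\eta\in\mathbb R^{mdT}$ are obtained by stacking over $l$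 the vectors $\mathrm{vec}(A_l^* )$, $\mathrm{vec}(\widetilde X_l)$, $\mathrm{vec}(E_l)$, so $\widetilde x=Qa^*+\eta$. Graph quantities. $D\in\{-1,0,1\}^{|\mathcal E|\times m}$ is the incidence matrix of an arbitrary orientation of $G$ (each row has one $+1$ and one $-1$, at the endpoints of the edge), $\widetilde D=D\otimes I_{d^2}$, and $D^\dagger$ is the Moore–Penrose pseudoinverse. $\mu$ is the maximum Euclidean norm of a column of $D^\dagger\in\mathbb R^{m\times|\mathcal E|}$, and $\mu'$ the maximum Euclidean norm of a row of $D^\dagger$. For $\mathcal T\subseteq[d^2|\mathcal E|]$ the compatibility factor is $\kappa_\emptyset=1$ and $\kappa_{\mathcal T}=\inf_{\theta\in\mathbb R^{md^2}}\frac{\sqrt{|\mathcal T|}\,\|\theta\|_2}{\|(\widetilde D\theta)_{\mathcal T}\|_1}$ for $\mathcal T\ne\emptyset$ (infimum over $\theta$ with nonzero denominator). $(x)_{\mathcal T}$ denotes restriction of $x$ to coordinates in $\mathcal T$; $\mathcal S^c$ is the complement in $[|\mathcal E|d^2]$. System quantities. $\Gamma_t(A)=\sum_{k=0}^tA^k(A^k)^\top$. $\widetilde A_l^*\in\mathbb R^{dT\times dT}$ is the block lower triangular matrix with $(i,j)$ block $(A_l^* )^{i-j}$ for $1\le j\le i\le T$ and $0$ for $j>i$; $\beta=\max_l\|\widetilde A_l^*\|_2$ (spectral norm). $G_l=\sum_{t=1}^T\Gamma_{t-1}(A_l^* )$, $\overline G=\frac1m\sum_{l=1}^mG_l$, and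 $\Delta_G=\max_{a,b\in[d]}\big(\sum_{l=1}^m[(G_l)_{b,a}-(\overline G)_{b,a}]^2\big)^{1/2}$. $e_i$ are canonical basis vectors. Estimator. For $\lambda\ge0$, $\widehat a\in\arg\min_{a\in\mathbb R^{md^2}}\big\{\frac1{2m}\|\widetilde x-Qa\|_2^2+\lambda\|\widetilde Da\|_1\big\}$ (any minimizer). *)

(* Defs.v *)
From HB Require Import structures.
From mathcomp Require Import all_boot all_order all_algebra.
From mathcomp.real_closed Require Import mxtens.
From mathcomp Require Import all_classical all_reals all_analysis.

Set Implicit Arguments.
Unset Strict Implicit.
Unset Printing Implicit Defensive.

Import Order.TTheory GRing.Theory Num.Theory.
Import numFieldNormedType.Exports.

Local Open Scope classical_set_scope.
Local Open Scope ring_scope.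

Section LinearAlgebra.
Context {R : realType}.

Definition norm2 {n} (x : 'cV[R]_n) : R := Num.sqrt (\sum_i x i 0 ^+ 2).

Definition norm1 {n} (x : 'cV[R]_n) : R := \sum_i `|x i 0|.

Definition norm1_on {n} (S : {set 'I_n}) (x : 'cV[R]_n) : R :=
  \sum_(i in S) `|x i 0|.

Definition spectral_norm {p q} (A : 'M[R]_(p, q)) : R :=
  sup [set norm2 (A *m x) | x in [set x : 'cV[R]_q | norm2 x <= 1]].

(* A pair (i, j) is encoded in ['I_(p * q)] with [j] varying fastest, by
   [mxtens_index]: the same convention as the Kronecker product [*t]. *)

(* Column stacking: entry (i, j) sits at position j * p + i. *)
Definition vec {p q} (A : 'M[R]_(p, q)) : 'cV[R]_(q * p) :=
  \col_k A (mxtens_unindex k).2 (mxtens_unindex k).1.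

Definition stack {m p} (u : 'I_m -> 'cV[R]_p) : 'cV[R]_(m * p) :=
  \col_k u (mxtens_unindex k).1 (mxtens_unindex k).2 0.

Definition blkdiag {m p q} (B : 'I_m -> 'M[R]_(p, q)) :
    'M[R]_(m * p, m * q) :=
  \matrix_(i, j)
    (if (mxtens_unindex i).1 == (mxtens_unindex j).1
     then B (mxtens_unindex i).1 (mxtens_unindex i).2 (mxtens_unindex j).2
     else 0).

Definition moore_penrose {p q} (A : 'M[R]_(p, q)) (B : 'M[R]_(q, p)) : Prop :=
  [/\ A *m B *m A = A, B *m A *m B = B,
      (A *m B)^T = A *m B & (B *m A)^T = B *m A].

Definition pseudoinv {p q} (A : 'M[R]_(p, q)) : 'M[R]_(q, p) :=
  xget 0 [set B | moore_penrose A B].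

Lemma gram_unit p q (A : 'M[R]_(p, q)) : row_free A -> A *m A^T \in unitmx.
Proof.
move=> fA; rewrite -row_free_unit -kermx_eq0; apply/eqP/row_matrixP => i.
rewrite row0; set u := row i _.
have uAA : u *m (A *m A^T) = 0 by apply/sub_kermxP/row_sub.
have : u *m A = 0.
  have : (u *m A *m (u *m A)^T) 0 0 = 0.
    by rewrite trmx_mul !mulmxA -(mulmxA u) uAA mul0mx mxE.
  move: (u *m A) => w; rewrite mxE => /eqP; rewrite psumr_eq0; last first.
    by move=> k _; rewrite mxE -expr2 sqr_ge0.
  move=> /allP w0; apply/rowP => j; move: (w0 j (mem_index_enum _)).
  by rewrite implyTb mxE mulf_eq0 orbb mxE => /eqP.
by move/eqP; rewrite mulmx_free_eq0 // => /eqP.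
Qed.

Lemma moore_penrose_exists p q (A : 'M[R]_(p, q)) :
  exists B, moore_penrose A B.
Proof.
have [r [C [F [AE fC fF]]]] : exists (r : nat) (C : 'M[R]_(p, r)) (F : 'M[R]_(r, q)),
    [/\ A = C *m F, row_free C^T & row_free F].
  exists (\rank A), (col_base A), (row_base A); split.
  - by rewrite mulmx_base.
  - by rewrite /row_free mxrank_tr; exact: col_base_full.
  - exact: row_base_free.
have uF := gram_unit fF; have := gram_unit fC; rewrite trmxK => uC.
pose B := F^T *m invmx (F *m F^T) *m (invmx (C^T *m C) *m C^T).
have AB : A *m B = C *m invmx (C^T *m C) *m C^T.
  rewrite AE /B !mulmxA -(mulmxA C F) -(mulmxA C (F *m F^T)).
  by rewrite mulmxV // mulmx1.
have BA : B *m A = F^T *m invmx (F *m F^T) *m F.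
  rewrite AE /B !mulmxA -(mulmxA _ C^T C) -(mulmxA _ (invmx (C^T *m C))).
  by rewrite mulVmx // mulmx1.
exists B; split.
- by rewrite AB AE !mulmxA -(mulmxA _ C^T C) -(mulmxA C) mulVmx // mulmx1.
- rewrite BA /B !mulmxA -(mulmxA _ F F^T) -(mulmxA F^T (invmx _) (F *m F^T)).
  by rewrite mulVmx // mulmx1.
- by rewrite AB !trmx_mul trmxK trmx_inv trmx_mul trmxK mulmxA.
- by rewrite BA !trmx_mul trmxK trmx_inv trmx_mul trmxK mulmxA.
Qed.

Lemma pseudoinvP p q (A : 'M[R]_(p, q)) : moore_penrose A (pseudoinv A).
Proof.
have [B AB] := moore_penrose_exists A.
exact: (xgetI 0 AB).
Qed.

End LinearAlgebra.

Section Graph.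
Context {m : nat}.

Definition connected_graph (g : rel 'I_m) : Prop :=
  [/\ symmetric g, irreflexive g & forall u v, connect g u v].

Definition edges (g : rel 'I_m) : {set {set 'I_m}} :=
  [set [set uv.1; uv.2]%SET | uv in [pred uv : 'I_m * 'I_m | g uv.1 uv.2]]%SET.

(* The k-th row belongs to the k-th edge of [g] (in the order of [enum_val]),
   with an arbitrary choice of head and tail. *)
Definition incidence_matrix (R : realType) (g : rel 'I_m)
    (D : 'M[R]_(#|edges g|, m)) : Prop :=
  forall k : 'I_#|edges g|, exists u v : 'I_m,
    [/\ u != v, enum_val k = [set u; v]%SET &
        forall j, D k j = (j == u)%:R - (j == v)%:R].

End Graph.

Section GraphQuantities.
Context {R : realType} {m e : nat}.

Definition max_col_norm (B : 'M[R]_(m, e)) : R :=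
  \big[Num.max/0]_(j < e) norm2 (col j B).

Definition max_row_norm (B : 'M[R]_(m, e)) : R :=
  \big[Num.max/0]_(i < m) norm2 (row i B)^T.

Definition mu (D : 'M[R]_(e, m)) : R := max_col_norm (pseudoinv D).

Definition mu' (D : 'M[R]_(e, m)) : R := max_row_norm (pseudoinv D).

Definition Dtilde (d : nat) (D : 'M[R]_(e, m)) :
    'M[R]_(e * (d * d), m * (d * d)) := D *t 1%:M.

End GraphQuantities.

Definition kappa {R : realType} {p q : nat} (D : 'M[R]_(p, q))
    (S : {set 'I_p}) : R :=
  if #|S| == 0%N then 1 else
  inf [set Num.sqrt #|S|%:R * norm2 theta / norm1_on S (D *m theta)
      | theta in [set theta : 'cV[R]_q | norm1_on S (D *m theta) != 0]].

Section System.
Context {R : realType} {d : nat}.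

Definition Gamma (t : nat) (A : 'M[R]_d) : 'M[R]_d :=
  \sum_(k < t.+1) A ^+ k *m (A ^+ k)^T.

Definition Gsum (T : nat) (A : 'M[R]_d) : 'M[R]_d :=
  \sum_(1 <= t < T.+1) Gamma t.-1 A.

Definition Atilde (T : nat) (A : 'M[R]_d) : 'M[R]_(T * d) :=
  \matrix_(a, b)
    (let i := (mxtens_unindex a).1 in let j := (mxtens_unindex b).1 in
     if (j <= i)%N
     then (A ^+ (i - j)) (mxtens_unindex a).2 (mxtens_unindex b).2 else 0).

Context {m : nat}.
Implicit Type A : 'I_m -> 'M[R]_d.

Definition beta (T : nat) A : R :=
  \big[Num.max/0]_(l < m) spectral_norm (Atilde T (A l)).

Definition Gbar (T : nat) A : 'M[R]_d := m%:R^-1 *: \sum_(l < m) Gsum T (A l).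

Definition DeltaG (T : nat) A : R :=
  \big[Num.max/0]_(a < d) \big[Num.max/0]_(b < d)
    Num.sqrt (\sum_(l < m) (Gsum T (A l) b a - Gbar T A b a) ^+ 2).

Definition max_diagG (T : nat) A : R :=
  \big[Num.max/0]_(l < m) \big[Num.max/0]_(i < d) Gsum T (A l) i i.

Definition astar A : 'cV[R]_(m * (d * d)) := stack (fun l => vec (A l)).

End System.

(* The noise at time [t] drives the transition from time [t.-1] to [t]; its
   value at time [0] is unused. *)
Fixpoint state {R : realType} {d : nat} (A : 'M[R]_d) (eta : nat -> 'cV[R]_d)
    (t : nat) : 'cV[R]_d :=
  if t is s.+1 then A *m state A eta s + eta s.+1 else 0.

Section VectorizedModel.
Context {R : realType} {m d : nat} (T : nat).
Implicit Types (x eta : 'I_m -> nat -> 'cV[R]_d).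

(* The columns of [window s z] are z_(s+1), ..., z_(s+T). *)
Definition window (s : nat) (z : nat -> 'cV[R]_d) : 'M[R]_(d, T) :=
  \matrix_(i < d, t < T) z (s + t.+1)%N i 0.

Definition design x : 'M[R]_(m * (T * d), m * (d * d)) :=
  blkdiag (fun l => (window 0 (x l))^T *t (1%:M : 'M[R]_d)).

Definition response x : 'cV[R]_(m * (T * d)) :=
  stack (fun l => vec (window 1 (x l))).

Lemma sum_mxtens_index p q (F : 'I_(p * q) -> R) :
  \sum_k F k = \sum_i \sum_j F (mxtens_index (i, j)).
Proof.
rewrite pair_bigA /= (reindex (@mxtens_index p q)); last first.
  exists (@mxtens_unindex p q) => k _; first exact: mxtens_indexK.
  exact: mxtens_unindexK.
by apply: eq_bigr => -[i j].
Qed.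

Lemma vectorized_model (A : 'I_m -> 'M[R]_d) eta :
  let x l := state (A l) (eta l) in
  response x = design x *m astar A + stack (fun l => vec (window 1 (eta l))).
Proof.
move=> x; apply/colP => k; case: (mxtens_indexP k) => l k'.
case: (mxtens_indexP k') => t i.
have -> : response x (mxtens_index (l, mxtens_index (t, i))) 0
        = (A l *m x l t.+1) i 0 + eta l t.+2 i 0.
  rewrite mxE mxtens_indexK mxE mxtens_indexK mxE add1n.
  by rewrite [x l _]/= mxE.
rewrite [RHS]mxE; congr (_ + _); last first.
  by rewrite mxE mxtens_indexK mxE mxtens_indexK mxE add1n.
rewrite mxE.
clearbody x.
apply/esym; rewrite mxE sum_mxtens_index (bigD1 l) //= [X in _ + X]big1 ?addr0;
  last first.
  move=> l' l'l; rewrite big1 // => j _; rewrite !mxE !mxtens_indexK /=.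
  by rewrite eq_sym (negbTE l'l) mul0r.
rewrite sum_mxtens_index; apply: eq_bigr => j _.
rewrite (bigD1 i) //= [X in _ + X]big1 ?addr0.
  by rewrite !mxE !mxtens_indexK /= !eqxx mulr1 mulrC.
move=> i' i'i; rewrite !mxE !mxtens_indexK /= eqxx.
by rewrite eq_sym (negbTE i'i) mulr0 mul0r.
Qed.

Definition objective {e : nat} (D : 'M[R]_(e, m)) x (lambda : R)
    (a : 'cV[R]_(m * (d * d))) : R :=
  (2 * m%:R)^-1 * norm2 (response x - design x *m a) ^+ 2
  + lambda * norm1 (Dtilde d D *m a).

Definition estimator {e : nat} (D : 'M[R]_(e, m)) x (lambda : R)
    (a : 'cV[R]_(m * (d * d))) : Prop :=
  forall b, objective D x lambda a <= objective D x lambda b.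

End VectorizedModel.

Section Probability.
Context {disp : measure_display} {Omega : measurableType disp} {R : realType}.
Variable P : probability Omega R.

Definition mutually_independent {I : finType} (X : I -> {RV P >-> R}) : Prop :=
  forall (J : {set I}) (B : I -> set R), (forall i, measurable (B i)) ->
    P (\bigcap_(i in [set i | i \in J]) (X i @^-1` B i))
    = (\prod_(i in J) P (X i @^-1` B i))%E.

Definition standard_normal (X : {RV P >-> R}) : Prop :=
  forall B : set R, measurable B -> distribution P X B = normal_prob 0 1 B.

(* [eta l t i] is the i-th coordinate of the noise vector of system [l] at time
   [t].  A vector is N(0, I_d) when its coordinates are independent N(0, 1), so
   that i.i.d. N(0, I_d) vectors at times 1, ..., T+1 amount to a mutually
   independent family of N(0, 1) coordinates. *)
Definition iid_standard_gaussian {m d : nat} (T : nat)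
    (eta : 'I_m -> nat -> 'I_d -> {RV P >-> R}) : Prop :=
  mutually_independent
    (fun k : 'I_m * 'I_T.+1 * 'I_d => eta k.1.1 k.1.2.+1 k.2)
  /\ forall (l : 'I_m) (t : 'I_T.+1) (i : 'I_d), standard_normal (eta l t.+1 i).

Definition trajectory {m d : nat} (A : 'I_m -> 'M[R]_d)
    (eta : 'I_m -> nat -> 'I_d -> {RV P >-> R}) (w : Omega) :
    'I_m -> nat -> 'cV[R]_d :=
  fun l => state (A l) (fun t => \col_i eta l t i w).

End Probability.

Section Thresholds.
Context {R : realType} {m d e : nat} (T : nat).
Variables (A : 'I_m -> 'M[R]_d) (D : 'M[R]_(e, m)).

Definition zeta1 (K1 delta : R) : R :=
  K1 * (\sum_(l < m) \sum_(t < T) \tr (Gamma t (A l))) * ln (1 / delta).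

Definition F1 (K1 delta : R) : R :=
  let z := zeta1 K1 delta / m%:R + 1 in
  Num.sqrt 2 * Num.sqrt z
  * Num.sqrt (ln (1 / delta) + (d ^ 2)%:R / 2 * ln z).

Definition zeta2 (K2 delta : R) : R :=
  K2 * mu D ^+ 2 * max_diagG T A * ln ((d ^ 2 * e)%:R / delta) ^+ 2.

Definition F2 (K2 K3 delta : R) : R := K3 * Num.sqrt (zeta2 K2 delta).

Variable S : {set 'I_(e * (d * d))}.

Definition compat_ratio : R := Num.sqrt #|S|%:R / kappa (Dtilde d D) S.

Definition off_support : R := norm1_on (~: S)%SET (Dtilde d D *m astar A).

Definition Psi (r : R) : R := 4 * compat_ratio + 4 / r * off_support + 1.

Definition F3 (K4 r : R) : R :=
  let L := ln (d ^ 2 * e)%:R in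
  K4 * beta T A ^+ 2 *
  (mu' D ^+ 2 * Psi r ^+ 2 * L
   + mu' D * Num.sqrt T%:R * Psi r * Num.sqrt L
   + Num.sqrt T%:R).

End Thresholds.

(* Main.v *)
(* Write h for the estimation error, split into its average over the systems, which is
   orthogonal to the range of the pseudoinverse of D, and D^+ D h.  The basic inequality and
   a bound on the noise pairing put h in a cone where |D h|_1 is at most Psi |h|, and a
   restricted eigenvalue bound |Q h|^2 >= (T / 2) |h|^2 on this cone gives the conclusion.

   The noise pairing is a self-normalised Gaussian martingale: a quadratic form with a
   strictly lower triangular matrix L, for which exp(<x, L x> - |L x|^2 / 2) has mean one.
   It is bounded over a net of the unit ball for the averaged part (F1), and coordinate by
   coordinate for the other one (F2).

   In |Q h|^2 the expectation is at least T |h|^2.  The deviation is a Gaussian chaos: a net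
   handles the averaged part, entrywise bounds the cross terms, and for D^+ u with |u|_1 at
   most Psi a supremum bound is needed.  It is obtained by symmetrisation: by rotation
   invariance the difference of two independent copies of the chaos is a decoupled bilinear
   form, which is chained over the l1 ball with sparse quantised approximations at scale
   4^j. *)

From HB Require Import structures.
Require Import Defs.
From mathcomp Require Import all_boot all_order all_algebra.
From mathcomp.real_closed Require Import mxtens.
From mathcomp Require Import all_classical all_reals all_analysis.
From mathcomp Require Import measurable_realfun probability.
From mathcomp Require Import perm ring lra zify.

Set Implicit Arguments.
Unset Strict Implicit.
Unset Printing Implicit Defensive.

Import Order.TTheory GRing.Theory Num.Theory.
Import numFieldNormedType.Exports.
Local Open Scope classical_set_scope.
Local Open Scope ring_scope.

(** * The standard Gaussian measure on tuples *)

(** The design is built from the same noise sequence that it is paired with, so no bound may treat Q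
    as fixed. Only strict causality is used, and the energy of the states is part of the events.

    [F1] has the shape given by the method of mixtures, but a net of the ball in dimension d^2
    yields it too: K1 = 64 makes the logarithm of [F1] at least 3, so that d^2/2 times this
    logarithm pays for the 64^(d^2) points of the net.

    The obstacle is the part D^+ u of the error. Its energy is quadratic in u, and entrywise bounds
    would cost Psi^2 times sqrt T, where [F3] has sqrt T only against the first power of Psi. After
    decoupling, each copy enters linearly, but the conditional variance involves the very supremum
    to be bounded. The resulting inequality is closed by halving a bound repeatedly; the size of the
    initial bound only affects the number of rounds. This is why the supremum is first taken over
    finite families, and why the number of their members must not appear in the final estimate. *)

Section GaussianMeasure.
Context {R : realType}.

Definition tcons N (p : R * N.-tuple R) : N.+1.-tuple R := [tuple of p.1 :: p.2].

Lemma measurable_tcons N : measurable_fun setT (@tcons N).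
Proof. exact: measurable_cons. Qed.

(** [normal_prob] lives on the alias [measurableTypeR R]. Pushing it forward along this identity
    puts the law on [R] itself, the type of the entries of tuples. *)
Definition idR (x : measurableTypeR R) : R := x.

Lemma measurable_idR : measurable_fun setT idR.
Proof. exact: (@measurable_id _ (measurableTypeR R) setT). Qed.

HB.instance Definition _ := isMeasurableFun.Build _ _ _ _ idR measurable_idR.

Definition N01 : probability R R := distribution (normal_prob (0 : R) 1) idR.

HB.instance Definition _ N := isMeasurableFun.Build _ _ _ _ (@tcons N) (@measurable_tcons N).

(** Built one coordinate at a time rather than as a finite product, so that integrals are computed
    by induction on N with Tonelli ([gaussianSE]). *)
Fixpoint gaussian N : probability (N.-tuple R) R :=
  if N is N'.+1 then
    distribution (N01 \x gaussian N')%E (@tcons N')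
  else \d_[tuple].

Lemma gaussian0E (f : 0.-tuple R -> \bar R) :
  (forall x, 0 <= f x)%E -> measurable_fun [set: 0.-tuple R] f ->
  (\int[gaussian 0]_x f x = f [tuple])%E.
Proof. by move=> f0 mf; rewrite integral_dirac// diracT mul1e. Qed.

Lemma gaussianSE N (f : N.+1.-tuple R -> \bar R) :
  (forall x, 0 <= f x)%E -> measurable_fun [set: N.+1.-tuple R] f ->
  (\int[gaussian N.+1]_x f x
   = \int[N01]_x \int[gaussian N]_y f (tcons (x, y)))%E.
Proof.
move=> f0 mf.
rewrite [LHS]ge0_integral_distribution//.
rewrite fubini_tonelli1//; last by move=> x; exact: f0.
by apply: measurableT_comp => //; exact: measurable_tcons.
Qed.

Import HBNNSimple.

(** [normal_prob] is given by its values on sets, so the density is introduced on indicators, then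
    on simple functions, then in the monotone limit. *)
Lemma integral_normal_prob (f : R -> \bar R) :
  (forall x, 0 <= f x)%E -> measurable_fun setT f ->
  (\int[normal_prob (0 : R) 1]_x f x
   = \int[lebesgue_measure]_x (f x * (normal_pdf 0 1 x)%:E))%E.
Proof.
move=> f0 mf0; have mf : measurable_fun [set: measurableTypeR R] f by [].
pose f_ := nnsfun_approx measurableT mf.
have mp : measurable_fun [set: measurableTypeR R] (EFin \o normal_pdf (0 : R) 1).
  by apply/measurable_EFinP; exact: measurable_normal_pdf.
have p0 x : (0 <= (normal_pdf (0 : R) 1 x)%:E)%E by rewrite lee_fin normal_pdf_ge0.
transitivity (limn (fun n => \int[normal_prob (0 : R) 1]_x (f_ n x)%:E))%E.
  rewrite -monotone_convergence//.
  - by apply: eq_integral => x _; apply/esym/cvg_lim => //; exact: cvg_nnsfun_approx.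
  - by move=> n; exact/measurable_EFinP.
  - by move=> n x _; rewrite lee_fin; exact: fun_ge0.
  - by move=> x _ m n mn; rewrite lee_fin; exact/lefP/nd_nnsfun_approx.
transitivity (limn (fun n => \int[lebesgue_measure]_x
    ((f_ n x)%:E * (normal_pdf 0 1 x)%:E)))%E; last first.
  rewrite -monotone_convergence//.
  - apply: eq_integral => x _; apply/cvg_lim => //.
    apply: cvgeZr => //; exact: cvg_nnsfun_approx.
  - move=> n; apply: emeasurable_funM => //; exact/measurable_EFinP.
  - by move=> n x _; rewrite mule_ge0// lee_fin; exact: fun_ge0.
  - move=> x _ m n mn; rewrite lee_wpmul2r// lee_fin.
    exact/lefP/nd_nnsfun_approx.
congr (limn _); apply/funext => n.
under eq_integral do rewrite fimfunE// -fsumEFin//.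
rewrite ge0_integral_fsum//; last 2 first.
- by move=> r; exact/measurable_EFinP/measurableT_comp.
- by move=> r x _; rewrite nnfun_muleindic_ge0.
transitivity (\int[lebesgue_measure]_x (\sum_(r \in range (f_ n))
    (r%:E * ((\1_(f_ n @^-1` [set r]) x)%:E * (normal_pdf 0 1 x)%:E))))%E; last first.
  apply: eq_integral => x _; rewrite [in RHS]fimfunE -fsumEFin//.
  rewrite ge0_mule_fsuml//; last by move=> r; rewrite nnfun_muleindic_ge0.
  by apply: eq_fsbigr => r _; rewrite EFinM muleA.
rewrite ge0_integral_fsum//; last 2 first.
- move=> r; apply/measurable_funeM; apply: emeasurable_funM => //.
  exact/measurable_EFinP.
- by move=> r x _; rewrite muleA mule_ge0// nnfun_muleindic_ge0.
apply: eq_fsbigr => r; rewrite inE => -[z _ <-].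
rewrite integralZl_indic_nnsfun// integral_indic// setIT.
rewrite ge0_integralZl//; last 3 first.
- by apply: emeasurable_funM => //; exact/measurable_EFinP.
- by move=> x _; rewrite mule_ge0// lee_fin.
- by rewrite lee_fin.
congr (_ * _)%E.
transitivity (\int[lebesgue_measure]_(x in f_ n @^-1` [set f_ n z])
  (normal_pdf 0 1 x)%:E)%E; first by [].
rewrite [LHS]integral_mkcond; apply: eq_integral => x _; rewrite patchE indicE.
by case: ifP => _; rewrite ?mul1e ?mul0e.
Qed.

Lemma integral_N01 (f : R -> \bar R) :
  (forall x, 0 <= f x)%E -> measurable_fun setT f ->
  (\int[N01]_x f x
   = \int[lebesgue_measure]_x (f x * (normal_pdf 0 1 x)%:E))%E.
Proof.
by move=> f0 mf; rewrite [LHS]ge0_integral_distribution// integral_normal_prob.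
Qed.

End GaussianMeasure.

Lemma measurable_sum d (T : measurableType d) (R : realType) (D : set T)
    (I : Type) (s : seq I) (P : pred I) (h : I -> T -> R) :
  (forall i, measurable_fun D (h i)) ->
  measurable_fun D (fun x => \sum_(i <- s | P i) h i x).
Proof.
move=> mh; elim: s => [|i s IH].
  have -> : (fun x => \sum_(i <- [::] | P i) h i x) = cst 0.
    by apply/funext => x; rewrite big_nil.
  exact: measurable_cst.
have -> : (fun x => \sum_(i <- i :: s | P i) h i x) =
    (fun x => (if P i then h i x else 0) + \sum_(i <- s | P i) h i x).
  by apply/funext => x; rewrite big_cons; case: ifP; rewrite ?add0r.
by apply: measurable_funD => //; case: (P i).
Qed.

Section NormalExp.
Context {R : realType}.

(** Completing the square: exp(a x) times the standard density is exp(a^2/2) times the normal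
    density of mean a. *)
Lemma integral_N01_expR (a : R) :
  (\int[N01]_x (expR (a * x))%:E = (expR (a ^+ 2 / 2))%:E)%E.
Proof.
rewrite integral_N01; last 2 first.
- by move=> x; rewrite lee_fin expR_ge0.
- apply/measurable_EFinP/measurableT_comp => //; exact: measurable_funM.
transitivity (\int[lebesgue_measure]_x
    ((expR (a ^+ 2 / 2))%:E * (normal_pdf a 1 x)%:E))%E.
  apply: eq_integral => x _; rewrite -!EFinM; congr EFin.
  rewrite !normal_pdfE ?oner_eq0// /normal_fun.
  rewrite mulrCA [RHS]mulrCA -!expRD; congr (_ * expR _).
  by field.
rewrite ge0_integralZl//; last 2 first.
- by apply/measurable_EFinP; exact: measurable_normal_pdf.
- by move=> x _; rewrite lee_fin normal_pdf_ge0.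
by rewrite integral_normal_pdf mule1.
Qed.

(** With s^2 = 1 - 2 b, the integrand times the standard density is 1/s times the centred normal
    density of standard deviation 1/s. *)
Lemma integral_N01_expR_sqr (b : R) : b < 2^-1 ->
  (\int[N01]_x (expR (b * x ^+ 2))%:E = ((Num.sqrt (1 - 2 * b))^-1)%:E)%E.
Proof.
move=> b2; have c0 : 0 < 1 - 2 * b by lra.
rewrite integral_N01; last 2 first.
- by move=> x; rewrite lee_fin expR_ge0.
- apply/measurable_EFinP/measurableT_comp => //; exact: measurable_funM.
set s := Num.sqrt (1 - 2 * b); have s0 : 0 < s by rewrite sqrtr_gt0.
have s2 : s ^+ 2 = 1 - 2 * b by rewrite sqr_sqrtr// ltW.
have sn0 : s != 0 by rewrite gt_eqF.
transitivity (\int[lebesgue_measure]_x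
    ((s^-1)%:E * (normal_pdf 0 s^-1 x)%:E))%E.
  apply: eq_integral => x _; rewrite -!EFinM; congr EFin.
  rewrite !normal_pdfE ?oner_eq0 ?invr_eq0// /normal_fun /normal_peak.
  rewrite expr1n mul1r exprVn mulrCA -expRD [RHS]mulrA.
  have -> : s^-1 * (Num.sqrt ((s ^+ 2)^-1 * pi *+ 2))^-1 = (Num.sqrt (pi *+ 2))^-1.
    rewrite -mulrnAr sqrtrM ?invr_ge0 ?sqr_ge0// sqrtrV ?sqr_ge0// sqrtr_sqr gtr0_norm//.
    by rewrite invfM invrK mulKf.
  congr (_ * expR _); rewrite !subr0.
  have -> : b = (1 - s ^+ 2) / 2 by rewrite s2; field.
  by field.
rewrite ge0_integralZl//; last 3 first.
- by apply/measurable_EFinP; exact: measurable_normal_pdf.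
- by move=> x _; rewrite lee_fin normal_pdf_ge0.
- by rewrite lee_fin invr_ge0 ltW.
by rewrite integral_normal_pdf mule1.
Qed.

End NormalExp.

Section GaussianExp.
Context {R : realType}.

Lemma tnth_tcons0 N (x : R) (y : N.-tuple R) : tnth (tcons (x, y)) ord0 = x.
Proof. by rewrite tnth0. Qed.

Lemma tnth_tconsS N (x : R) (y : N.-tuple R) i :
  tnth (tcons (x, y)) (lift ord0 i) = tnth y i.
Proof. by rewrite tnthS. Qed.

Lemma measurable_affine N (b : R) (c : 'I_N -> R) :
  measurable_fun [set: N.-tuple R] (fun x => b + \sum_j c j * tnth x j).
Proof.
apply: measurable_funD => //; apply: measurable_sum => j.
by apply: measurable_funM => //; exact: measurable_tnth.
Qed.

(* The exponential martingale of the predictable sequence [a]. *)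
Lemma gaussian_exp_martingale N (b : 'I_N -> R) (L : 'I_N -> 'I_N -> R) :
  (forall k j : 'I_N, (k <= j)%N -> L k j = 0) ->
  let a x k := b k + \sum_j L k j * tnth x j in
  (\int[gaussian N]_x
     (expR (\sum_k (tnth x k * a x k - a x k ^+ 2 / 2)))%:E = 1)%E.
Proof.
move=> + a; have mE M (b' : 'I_M -> R) (L' : 'I_M -> 'I_M -> R) :
    measurable_fun [set: M.-tuple R] (fun x => (expR (\sum_k
     (tnth x k * (b' k + \sum_j L' k j * tnth x j)
      - (b' k + \sum_j L' k j * tnth x j) ^+ 2 / 2)))%:E).
  apply/measurable_EFinP/measurableT_comp => //; apply: measurable_sum => k.
  apply: measurable_funB; apply: measurable_funM => //.
  - exact: measurable_tnth.
  - exact: measurable_affine.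
  - by apply: measurable_funX; exact: measurable_affine.
rewrite {}/a; elim: N b L => [|N IH] b L L0.
  by rewrite gaussian0E ?big_ord0 ?expR0// => x; rewrite lee_fin expR_ge0.
have e0 M (f : M.-tuple R -> R) x : (0 <= (expR (f x))%:E)%E by rewrite lee_fin expR_ge0.
rewrite gaussianSE//.
transitivity (\int[N01]_x ((expR (- (b ord0 ^+ 2 / 2)))%:E
    * (expR (b ord0 * x))%:E))%E.
  apply: eq_integral => x _.
  (* The offset b is what the induction needs: by triangularity the first coefficient is the
     constant [b ord0], and once the first coordinate is fixed, its contribution to the later
     coefficients moves into their offsets. *)
  pose b' (k : 'I_N) := b (lift ord0 k) + L (lift ord0 k) ord0 * x.
  pose L' (k j : 'I_N) := L (lift ord0 k) (lift ord0 j).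
  rewrite -EFinM -expRD.
  transitivity (\int[gaussian N]_y ((expR (- (b ord0 ^+ 2 / 2) + b ord0 * x))%:E *
      (expR (\sum_k (tnth y k * (b' k + \sum_j L' k j * tnth y j)
      - (b' k + \sum_j L' k j * tnth y j) ^+ 2 / 2)))%:E))%E.
    apply: eq_integral => y _; rewrite -EFinM -expRD big_ord_recl tnth_tcons0.
    congr EFin; congr expR; congr (_ + _).
      rewrite big1 ?addr0; last by move=> j _; rewrite L0 ?mul0r.
      by rewrite [LHS]addrC [x * _]mulrC.
    apply: eq_bigr => k _; rewrite tnth_tconsS big_ord_recl tnth_tcons0.
    have -> : \sum_(i < N) L (lift ord0 k) (lift ord0 i) * tnth (tcons (x, y)) (lift ord0 i)
      = \sum_j L' k j * tnth y j.
      by apply: eq_bigr => j _; rewrite tnth_tconsS.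
    by rewrite addrA.
  rewrite ge0_integralZl//; last exact: mE.
  by rewrite IH ?mule1// => k j kj; apply: L0; rewrite !lift0.
rewrite ge0_integralZl//; last first.
- by apply/measurable_EFinP/measurableT_comp => //; exact: measurable_funM.
by rewrite integral_N01_expR -EFinM -expRD addNr expR0.
Qed.

End GaussianExp.

(** * Inner products, squared norms and the Frobenius norm *)

Section Dot.
Context {R : realType}.

Definition dot n (u v : 'cV[R]_n) : R := \sum_i u i 0 * v i 0.
Definition sqn n (u : 'cV[R]_n) : R := \sum_i u i 0 ^+ 2.
Definition fro2 p q (A : 'M[R]_(p, q)) : R := \sum_i \sum_j A i j ^+ 2.

Lemma sqn_ge0 n (u : 'cV[R]_n) : 0 <= sqn u.
Proof. by apply: sumr_ge0 => i _; exact: sqr_ge0. Qed.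

Lemma fro2_ge0 p q (A : 'M[R]_(p, q)) : 0 <= fro2 A.
Proof. by do 2!apply: sumr_ge0 => ? _; exact: sqr_ge0. Qed.

Lemma norm2_sqr n (u : 'cV[R]_n) : norm2 u ^+ 2 = sqn u.
Proof. by rewrite sqr_sqrtr// sqn_ge0. Qed.

Lemma norm2_ge0 n (u : 'cV[R]_n) : 0 <= norm2 u.
Proof. exact: sqrtr_ge0. Qed.

Lemma dotvv n (u : 'cV[R]_n) : dot u u = sqn u.
Proof. by apply: eq_bigr => i _; rewrite expr2. Qed.

Lemma dotC n (u v : 'cV[R]_n) : dot u v = dot v u.
Proof. by apply: eq_bigr => i _; rewrite mulrC. Qed.

Lemma dotDl n (u v w : 'cV[R]_n) : dot (u + v) w = dot u w + dot v w.
Proof. by rewrite -big_split; apply: eq_bigr => i _; rewrite mxE mulrDl. Qed.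

Lemma dotZl n a (u w : 'cV[R]_n) : dot (a *: u) w = a * dot u w.
Proof. by rewrite mulr_sumr; apply: eq_bigr => i _; rewrite mxE mulrA. Qed.

Lemma dotDr n (u v w : 'cV[R]_n) : dot w (u + v) = dot w u + dot w v.
Proof. by rewrite dotC dotDl !(dotC w). Qed.

Lemma dotZr n a (u w : 'cV[R]_n) : dot w (a *: u) = a * dot w u.
Proof. by rewrite dotC dotZl dotC. Qed.

Lemma dotNl n (u w : 'cV[R]_n) : dot (- u) w = - dot u w.
Proof. by rewrite -scaleN1r dotZl mulN1r. Qed.

Lemma dotNr n (u w : 'cV[R]_n) : dot w (- u) = - dot w u.
Proof. by rewrite dotC dotNl dotC. Qed.

Lemma dotBl n (u v w : 'cV[R]_n) : dot (u - v) w = dot u w - dot v w.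
Proof. by rewrite dotDl dotNl. Qed.

Lemma dotBr n (u v w : 'cV[R]_n) : dot w (u - v) = dot w u - dot w v.
Proof. by rewrite dotDr dotNr. Qed.

Lemma dot0l n (w : 'cV[R]_n) : dot 0 w = 0.
Proof. by rewrite /dot big1// => i _; rewrite mxE mul0r. Qed.

Lemma dot_mx n (u v : 'cV[R]_n) : dot u v = (u^T *m v) 0 0.
Proof. by rewrite mxE; apply: eq_bigr => i _; rewrite mxE. Qed.

Lemma dot_mulmx p q (A : 'M[R]_(p, q)) u v : dot u (A *m v) = dot (A^T *m u) v.
Proof. by rewrite !dot_mx trmx_mul trmxK mulmxA. Qed.

Lemma sqnD n (u v : 'cV[R]_n) : sqn (u + v) = sqn u + 2 * dot u v + sqn v.
Proof. by rewrite -!dotvv dotDl !dotDr (dotC v u); ring. Qed.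

Lemma sqnB n (u v : 'cV[R]_n) : sqn (u - v) = sqn u - 2 * dot u v + sqn v.
Proof. by rewrite -!dotvv dotBl !dotBr (dotC v u); ring. Qed.

Lemma sqnZ n a (u : 'cV[R]_n) : sqn (a *: u) = a ^+ 2 * sqn u.
Proof. by rewrite -!dotvv dotZl dotZr; ring. Qed.

Lemma sqn0 n : sqn (0 : 'cV[R]_n) = 0.
Proof. by rewrite -dotvv dot0l. Qed.

Lemma sqn_eq0 n (u : 'cV[R]_n) : sqn u = 0 -> u = 0.
Proof.
move=> /eqP; rewrite psumr_eq0; last by move=> i _; exact: sqr_ge0.
move=> /allP h; apply/colP => i; rewrite mxE; apply/eqP.
by have := h i (mem_index_enum _); rewrite sqrf_eq0.
Qed.

(** Cauchy-Schwarz, from the nonnegative squared norm of the component of v orthogonal to u. *)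
Lemma dot_sqr_le n (u v : 'cV[R]_n) : dot u v ^+ 2 <= sqn u * sqn v.
Proof.
have [u0|u0] := eqVneq (sqn u) 0.
  by rewrite (sqn_eq0 u0) dot0l expr0n sqn0 mul0r.
have u1 : 0 < sqn u by rewrite lt_neqAle eq_sym u0 sqn_ge0.
have := sqn_ge0 (v - (dot u v / sqn u) *: u).
rewrite sqnB sqnZ dotZr (dotC v) => h.
rewrite mulrC -ler_pdivrMr//; move: h.
rewrite -(ler_pM2r u1) mul0r => h; rewrite -(ler_pM2r u1) divfK//.
have -> : dot u v ^+ 2 = (sqn v * sqn u) - ((sqn v - 2 * (dot u v / sqn u * dot u v) +
    (dot u v / sqn u) ^+ 2 * sqn u) * sqn u); last by move: h; lra.
by field.
Qed.

Lemma dot_le n (u v : 'cV[R]_n) : `|dot u v| <= norm2 u * norm2 v.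
Proof.
rewrite -ler_sqr ?nnegrE ?mulr_ge0 ?norm2_ge0// exprMn !norm2_sqr.
by rewrite -normrX ger0_norm ?sqr_ge0// dot_sqr_le.
Qed.

Lemma norm2D n (u v : 'cV[R]_n) : norm2 (u + v) <= norm2 u + norm2 v.
Proof.
rewrite -ler_sqr ?nnegrE ?addr_ge0 ?norm2_ge0// norm2_sqr sqnD sqrrD !norm2_sqr.
by have := le_trans (ler_norm _) (dot_le u v); lra.
Qed.

Lemma norm2Z n a (u : 'cV[R]_n) : norm2 (a *: u) = `|a| * norm2 u.
Proof. by rewrite /norm2 -!/(sqn _) sqnZ sqrtrM ?sqr_ge0// sqrtr_sqr. Qed.

Lemma norm2N n (u : 'cV[R]_n) : norm2 (- u) = norm2 u.
Proof. by rewrite -scaleN1r norm2Z normrN1 mul1r. Qed.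

Lemma norm2B n (u v : 'cV[R]_n) : norm2 (u - v) <= norm2 u + norm2 v.
Proof. by rewrite -(norm2N v) norm2D. Qed.

Lemma norm2_0 n : norm2 (0 : 'cV[R]_n) = 0.
Proof. by rewrite /norm2 -/(sqn _) sqn0 sqrtr0. Qed.

Lemma norm2_eq0 n (u : 'cV[R]_n) : norm2 u = 0 -> u = 0.
Proof. by move=> u0; apply: sqn_eq0; rewrite -norm2_sqr u0 expr0n. Qed.

Lemma sqn_row p q (A : 'M[R]_(p, q)) : fro2 A = \sum_i sqn (row i A)^T.
Proof. by apply: eq_bigr => i _; apply: eq_bigr => j _; rewrite !mxE. Qed.

Lemma fro2_tr p q (A : 'M[R]_(p, q)) : fro2 A^T = fro2 A.
Proof.
rewrite /fro2 exchange_big; apply: eq_bigr => i _; apply: eq_bigr => j _.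
by rewrite mxE.
Qed.

Lemma sqn_mulmx_le p q (A : 'M[R]_(p, q)) v : sqn (A *m v) <= fro2 A * sqn v.
Proof.
rewrite sqn_row mulr_suml; apply: ler_sum => i _.
have -> : (A *m v) i 0 = dot (row i A)^T v by rewrite dot_mx trmxK -row_mul [RHS]mxE.
exact: dot_sqr_le.
Qed.

Lemma mxtrace_fro2 p q (A : 'M[R]_(p, q)) : \tr (A^T *m A) = fro2 A.
Proof.
rewrite -fro2_tr; apply: eq_bigr => i _; rewrite mxE; apply: eq_bigr => j _.
by rewrite !mxE expr2.
Qed.

End Dot.

(** * Gaussian tail bounds *)

Section ExpBounds.
Context {R : realType}.

Definition tv N (x : N.-tuple R) : 'cV[R]_N := \col_i tnth x i.

Lemma measurable_mulmx_tv N p (B : 'M[R]_(p, N)) i :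
  measurable_fun [set: N.-tuple R] (fun x => (B *m tv x) i 0).
Proof.
have -> : (fun x : N.-tuple R => (B *m tv x) i 0) =
    fun x => \sum_j B i j * tnth x j.
  by apply/funext => x; rewrite mxE; apply: eq_bigr => j _; rewrite mxE.
apply: measurable_sum => j; apply: measurable_funM => //; exact: measurable_tnth.
Qed.

Lemma measurable_tv N i : measurable_fun [set: N.-tuple R] (fun x => tv x i 0).
Proof.
have -> : (fun x : N.-tuple R => tv x i 0) = (fun x => (1%:M *m tv x) i 0).
  by apply/funext => x; rewrite mul1mx.
exact: measurable_mulmx_tv.
Qed.

Lemma measurable_dot N p (u v : N.-tuple R -> 'cV[R]_p) :
  (forall i, measurable_fun setT (fun x => u x i 0)) ->
  (forall i, measurable_fun setT (fun x => v x i 0)) ->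
  measurable_fun [set: N.-tuple R] (fun x => dot (u x) (v x)).
Proof. by move=> mu mv; apply: measurable_sum => i; exact: measurable_funM. Qed.

Lemma measurable_sqn N p (u : N.-tuple R -> 'cV[R]_p) :
  (forall i, measurable_fun setT (fun x => u x i 0)) ->
  measurable_fun [set: N.-tuple R] (fun x => sqn (u x)).
Proof. by move=> mu; apply: measurable_sum => i; exact: measurable_funX. Qed.

(** Markov's inequality for exp(g). Only the inclusion of A in the level set is required, so that A
    may carry further constraints, such as the energy bound of [gaussian_selfnorm_tail]. *)
Lemma chernoff d (T : measurableType d) (P : probability T R) (A : set T)
    (g : T -> R) (C s : R) :
  measurable A -> measurable_fun setT g ->
  (\int[P]_x (expR (g x))%:E <= C%:E)%E -> (forall x, A x -> s <= g x) ->
  (P A <= (C * expR (- s))%:E)%E.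
Proof.
move=> mA mg gC sg; have e0 (h : T -> R) x : (0 <= (expR (h x))%:E)%E.
  by rewrite lee_fin expR_ge0.
have me : measurable_fun [set: T] (fun x => (expR (g x))%:E).
  exact/measurable_EFinP/measurableT_comp.
apply: (@le_trans _ _ (\int[P]_x ((expR (- s))%:E * (expR (g x))%:E))%E).
  rewrite -[X in (P X <= _)%E](setIT A) -integral_indic//.
  apply: ge0_le_integral => //.
  - exact/measurable_EFinP.
  - exact: emeasurable_funM.
  - move=> x _; rewrite indicE; case: (boolP (x \in A)) => [/set_mem/sg sx|_].
      by rewrite -EFinM -expRD lee_fin -[leLHS]expR0 ler_expR addrC subr_ge0.
    by rewrite mule_ge0.
rewrite ge0_integralZl// EFinM muleC; apply: lee_wpmul2r => //.
Qed.

Lemma gaussian_selfnorm N (L : 'M[R]_N) (b : 'cV[R]_N) :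
  (forall k j : 'I_N, (k <= j)%N -> L k j = 0) ->
  (\int[gaussian N]_x
     (expR (dot (tv x) (b + L *m tv x) - sqn (b + L *m tv x) / 2))%:E = 1)%E.
Proof.
move=> L0.
rewrite -[RHS](@gaussian_exp_martingale R N (fun k => b k 0) (fun k j => L k j) L0).
apply: eq_integral => x _; congr EFin; congr expR.
rewrite /dot /sqn mulr_suml -sumrB; apply: eq_bigr => k _.
have -> : (b + L *m tv x) k 0 = b k 0 + \sum_j L k j * tnth x j.
  by rewrite mxE; congr (_ + _); rewrite mxE; apply: eq_bigr => j _; rewrite mxE.
by rewrite mxE.
Qed.

(** The bound on the random energy |L x|^2 is part of the event, so no deterministic bound is
    needed. The slope l = tau / rho is optimal: on the event the exponent is at least tau^2 - tau^2
    / 2. For rho = 0 the event is empty. *)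
Lemma gaussian_selfnorm_tail N (L : 'M[R]_N) (rho tau : R) :
  (forall k j : 'I_N, (k <= j)%N -> L k j = 0) -> 0 <= rho -> 0 <= tau ->
  (gaussian N [set x | (tau * rho < dot (tv x) (L *m tv x))%R &&
      (sqn (L *m tv x) <= rho ^+ 2)%R] <= (expR (- (tau ^+ 2 / 2)))%:E)%E.
Proof.
move=> L0; rewrite le_eqVlt => /predU1P[<-|rho0] tau0.
  rewrite [X in gaussian N X](_ : _ = set0) ?measure0 ?lee_fin ?expR_ge0//.
  rewrite -subset0 => x /= /andP[+]; rewrite mulr0 expr0n => h1 h2.
  have /sqn_eq0 e : sqn (L *m tv x) = 0 by apply/eqP; rewrite eq_le h2 sqn_ge0.
  by move: h1; rewrite e dotC dot0l ltxx.
pose l := tau / rho.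
have mL i : measurable_fun [set: N.-tuple R] (fun x => ((l *: L) *m tv x) i 0).
  exact: measurable_mulmx_tv.
have mL' i : measurable_fun [set: N.-tuple R] (fun x => (L *m tv x) i 0).
  exact: measurable_mulmx_tv.
rewrite -[in leRHS](mul1r (expR _)).
apply: (@chernoff _ _ _ _
   (fun x => dot (tv x) ((l *: L) *m tv x) - sqn ((l *: L) *m tv x) / 2)).
- rewrite -[X in measurable X]setTI.
  have mb : measurable_fun [set: N.-tuple R] (fun x =>
    (tau * rho < dot (tv x) (L *m tv x)) && (sqn (L *m tv x) <= rho ^+ 2)).
    apply: measurable_and.
    + apply: measurable_fun_ltr => //; apply: measurable_dot => //.
      exact: measurable_tv.
    + by apply: measurable_fun_ler => //; exact: measurable_sqn.
  by have := mb measurableT [set true] I; congr (measurable _).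
- apply: measurable_funB; first by apply: measurable_dot => //; exact: measurable_tv.
  by apply: measurable_funM => //; exact: measurable_sqn.
- have := @gaussian_selfnorm N (l *: L) 0; under eq_integral do rewrite add0r.
  by move=> -> // k j kj; rewrite mxE L0 ?mulr0.
- move=> x /= /andP[h1 h2]; rewrite -scalemxAl dotZr sqnZ.
  have l0 : 0 <= l by rewrite divr_ge0// ltW.
  have : l * (tau * rho) <= l * dot (tv x) (L *m tv x) by rewrite ler_wpM2l// ltW.
  have : l ^+ 2 * sqn (L *m tv x) <= l ^+ 2 * rho ^+ 2 by rewrite ler_wpM2l// sqr_ge0.
  have -> : l * (tau * rho) = tau ^+ 2 by rewrite /l; field; rewrite gt_eqF.
  have -> : l ^+ 2 * rho ^+ 2 = tau ^+ 2 by rewrite /l; field; rewrite gt_eqF.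
  lra.
Qed.

(** The case L = 0 of [gaussian_selfnorm], where the compensator is the constant |b|^2 / 2. *)
Lemma gaussian_linear_mgf N (b : 'cV[R]_N) :
  (\int[gaussian N]_x (expR (dot b (tv x)))%:E = (expR (sqn b / 2))%:E)%E.
Proof.
have e0 x : (0 <= (expR (x : R))%:E)%E by rewrite lee_fin expR_ge0.
have := @gaussian_selfnorm N 0 b (fun _ _ _ => mxE _ _ _ _).
under eq_integral do rewrite mul0mx addr0 addrC expRD EFinM dotC.
rewrite ge0_integralZl//; last first.
  apply/measurable_EFinP/measurableT_comp => //; apply: measurable_dot => // i.
  exact: measurable_tv.
move=> h; rewrite -[LHS]mul1e -{1}(expR0 R) -(subrr (sqn b / 2)) expRD EFinM.
by rewrite -muleA h mule1.
Qed.

End ExpBounds.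

Section Tails.
Context {R : realType}.

Let e0 (x : R) : (0 <= (expR x)%:E)%E. Proof. by rewrite lee_fin expR_ge0. Qed.

Lemma integral_cst_gaussian N : (\int[@gaussian R N]_x 1 = 1)%E.
Proof. by rewrite integral_cst// mul1e; exact: (probability_setT (gaussian N)). Qed.

Lemma measurable_setb d (T : measurableType d) (b : T -> bool) :
  measurable_fun setT b -> measurable [set x | b x].
Proof.
move=> mb; rewrite -[X in measurable X]setTI.
by have := mb measurableT [set true] I; congr (measurable _).
Qed.

Lemma gaussian_linear_tail N (b : 'cV[R]_N) (tau : R) : 0 <= tau ->
  (gaussian N [set x | (tau * norm2 b < `|dot b (tv x)|)%R]
   <= (2 * expR (- (tau ^+ 2 / 2)))%:E)%E.
Proof.
move=> tau0; have md (c : 'cV[R]_N) : measurable_fun [set: N.-tuple R] (fun x => dot c (tv x)).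
  by apply: measurable_dot => // i; exact: measurable_tv.
have [b0|b0] := eqVneq (norm2 b) 0.
  rewrite [X in gaussian N X](_ : _ = set0) ?measure0 ?lee_fin ?mulr_ge0 ?expR_ge0//.
  by rewrite -subset0 => x /=; rewrite b0 (norm2_eq0 b0) dot0l normr0 mulr0 ltxx.
have {}b0 : 0 < norm2 b by rewrite lt_neqAle eq_sym b0 norm2_ge0.
have one (c : 'cV[R]_N) : norm2 c = norm2 b ->
  (gaussian N [set x | (tau * norm2 b < dot c (tv x))%R] <= (expR (- (tau ^+ 2 / 2)))%:E)%E.
  move=> cb; have -> : expR (- (tau ^+ 2 / 2)) = expR (tau ^+ 2 / 2) * expR (- tau ^+ 2).
    by rewrite -expRD; congr expR; field.
  apply: (@chernoff _ _ _ _ _ (fun x => dot ((tau / norm2 b) *: c) (tv x))) => //.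
  - by apply: measurable_setb; apply: measurable_fun_ltr.
  - rewrite gaussian_linear_mgf lee_fin sqnZ -norm2_sqr cb -exprMn.
    by rewrite divfK ?gt_eqF.
  - move=> x /= h; rewrite dotZl.
    have -> : tau ^+ 2 = tau / norm2 b * (tau * norm2 b) by field; rewrite gt_eqF.
    by rewrite ler_wpM2l ?divr_ge0 ?norm2_ge0 ?(ltW h).
have m1 (c : 'cV[R]_N) : measurable [set x : N.-tuple R | tau * norm2 b < dot c (tv x)].
  by apply: measurable_setb; apply: measurable_fun_ltr.
apply: (@le_trans _ _ (gaussian N ([set x | (tau * norm2 b < dot b (tv x))%R] `|`
  [set x | (tau * norm2 b < dot (- b) (tv x))%R]))).
  apply: le_measure; rewrite ?inE.
  - apply: measurable_setb; apply: measurable_fun_ltr => //.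
    exact: measurableT_comp.
  - exact: measurableU.
  - move=> x /=; rewrite dotNl; case: (ger0P (dot b (tv x))) => _; by [left|right].
rewrite mulr_natl mulr2n EFinD; apply: le_trans (measureU2 _ _ _) _ => //.
by apply: leeD; apply: one; rewrite ?norm2N.
Qed.

(** An auxiliary Gaussian g linearises the square: exp(s z^2 / 2) is the mean of exp(sqrt s z g).
    After Tonelli, the integral over x is that of a linear form, and a one-dimensional integral in g
    remains. *)
Lemma integral_expR_sqr_dot N (b : 'cV[R]_N) (s : R) : 0 <= s -> s * sqn b < 1 ->
  (\int[gaussian N]_x (expR (s * dot b (tv x) ^+ 2 / 2))%:E
   = ((Num.sqrt (1 - s * sqn b))^-1)%:E)%E.
Proof.
move=> s0 sb.
have md (c : 'cV[R]_N) : measurable_fun [set: N.-tuple R] (fun x => dot c (tv x)).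
  by apply: measurable_dot => // i; exact: measurable_tv.
transitivity (\int[gaussian N]_x \int[@N01 R]_g
    (expR (Num.sqrt s * dot b (tv x) * g))%:E)%E.
  apply: eq_integral => x _; rewrite integral_N01_expR.
  by rewrite exprMn sqr_sqrtr.
pose f (p : N.-tuple R * R) := (expR (Num.sqrt s * dot b (tv p.1) * p.2))%:E.
have mf : measurable_fun setT f.
  apply/measurable_EFinP/measurableT_comp => //; apply: measurable_funM => //.
  apply: measurable_funM => //; apply: (measurableT_comp (md b)) => //.
rewrite -[LHS]/(\int[gaussian N]_x (fubini_F (@N01 R) f) x)%E.
rewrite (fubini_tonelli f mf) => [|p]; last exact: e0.
transitivity (\int[@N01 R]_g (expR ((s * sqn b / 2) * g ^+ 2))%:E)%E.
  apply: eq_integral => g _; rewrite /fubini_G /f /=.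
  transitivity (\int[gaussian N]_x (expR (dot ((Num.sqrt s * g) *: b) (tv x)))%:E)%E.
    by apply: eq_integral => x _; rewrite dotZl mulrAC.
  rewrite gaussian_linear_mgf sqnZ exprMn sqr_sqrtr//; congr (expR _)%:E.
  by field.
rewrite integral_N01_expR_sqr; last by lra.
by congr ((Num.sqrt (1 - _))^-1)%:E; field.
Qed.

(** Sums the tangent line inequality for exp at the weighted mean. *)
Lemma expR_jensen (I : finType) (w y : I -> R) :
  (forall i, 0 <= w i) -> \sum_i w i = 1 ->
  expR (\sum_i w i * y i) <= \sum_i w i * expR (y i).
Proof.
move=> w0 w1; set m := \sum_i _.
have : \sum_i w i * (expR m * (1 + (y i - m))) <= \sum_i w i * expR (y i).
  apply: ler_sum => i _; apply: ler_wpM2l => //.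
  by rewrite -[in leRHS](subrK m (y i)) [y i - m + m]addrC expRD ler_wpM2l ?expR_ge0 ?expR_ge1Dx.
apply: le_trans.
have -> : \sum_i w i * (expR m * (1 + (y i - m))) =
    expR m * ((1 - m) * \sum_i w i + \sum_i w i * y i).
  rewrite mulr_sumr -big_split mulr_sumr /=; apply: eq_bigr => i _; ring.
by rewrite w1 -/m mulr1 subrK mulr1.
Qed.

(** Diagonalising B^T B is avoided: with rows b_i, |B x|^2 is the average of |B|_F^2 <b_i, x>^2 /
    |b_i|^2 with weights |b_i|^2 / |B|_F^2. Jensen's inequality then reduces the claim to a single
    row, where the exact value is at most (1 - 1/2)^(-1/2). *)
Lemma integral_expR_sqn_mulmx N p (B : 'M[R]_(p, N)) (s : R) :
  0 <= s -> s * fro2 B <= 2^-1 ->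
  (\int[gaussian N]_x (expR (s * sqn (B *m tv x) / 2))%:E <= (Num.sqrt 2)%:E)%E.
Proof.
move=> s0 sB; have mB i := @measurable_mulmx_tv R N p B i.
have mB2 : measurable_fun [set: N.-tuple R] (fun x => (expR (s * sqn (B *m tv x) / 2))%:E).
  apply/measurable_EFinP/measurableT_comp => //; apply: measurable_funM => //.
  by apply: measurable_funM => //; exact: measurable_sqn.
have [B0|B0] := eqVneq (fro2 B) 0.
  apply: (@le_trans _ _ (\int[gaussian N]_x 1)%E).
    apply: ge0_le_integral => //.
    move=> x _; rewrite lee_fin -[leRHS]expR0 ler_expR.
    have := sqn_mulmx_le B (tv x); rewrite B0 mul0r => h.
    have -> : sqn (B *m tv x) = 0 by apply/eqP; rewrite eq_le h sqn_ge0.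
    by rewrite mulr0 mul0r.
  rewrite integral_cst_gaussian lee_fin.
  by rewrite -[leLHS]sqrtr1 ler_sqrt// ler1n.
have F0 : 0 < fro2 B by rewrite lt_neqAle eq_sym B0 fro2_ge0.
pose b i := (row i B)^T.
pose w (i : 'I_p) := sqn (b i) / fro2 B.
have w0 i : 0 <= w i by rewrite divr_ge0 ?sqn_ge0 ?fro2_ge0.
have w1 : \sum_i w i = 1 by rewrite -mulr_suml -sqn_row divff.
have mb i : measurable_fun [set: N.-tuple R] (fun x => dot (b i) (tv x)).
  by apply: measurable_dot => // k; exact: measurable_tv.
have me i : measurable_fun [set: N.-tuple R]
    (fun x => expR (s * fro2 B / sqn (b i) * dot (b i) (tv x) ^+ 2 / 2)).
  apply/measurableT_comp => //; apply: measurable_funM => //.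
  by apply: measurable_funM => //; exact: measurable_funX.
apply: (@le_trans _ _ (\int[gaussian N]_x (\sum_i (w i)%:E *
    (expR (s * fro2 B / sqn (b i) * dot (b i) (tv x) ^+ 2 / 2))%:E))%E).
  apply: ge0_le_integral => //.
  - apply: emeasurable_sum => i; apply: emeasurable_funM => //.
    exact/measurable_EFinP.
  - move=> x _; under eq_bigr do rewrite -EFinM; rewrite sumEFin lee_fin.
    apply: le_trans (expR_jensen _ w0 w1); rewrite ler_expR.
    rewrite [sqn _]/sqn mulr_sumr mulr_suml; apply: ler_sum => i _.
    have -> : (B *m tv x) i 0 = dot (b i) (tv x).
      by rewrite dot_mx trmxK -row_mul [RHS]mxE.
    have [bi|bi] := eqVneq (sqn (b i)) 0.
      by rewrite (sqn_eq0 bi) dot0l expr0n !(mulr0, mul0r).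
    by rewrite /w le_eqVlt; apply/orP; left; apply/eqP; field; rewrite bi B0.
rewrite ge0_integral_sum//; last 2 first.
- move=> i; apply: emeasurable_funM => //; exact/measurable_EFinP.
- by move=> i x _; rewrite mule_ge0// lee_fin.
apply: (@le_trans _ _ (\sum_i (w i)%:E * (Num.sqrt 2)%:E)%E); last first.
  under eq_bigr do rewrite -EFinM; rewrite sumEFin -mulr_suml w1 mul1r.
  by [].
apply: lee_sum => i _; rewrite ge0_integralZl//; last 2 first.
- exact/measurable_EFinP.
- by rewrite lee_fin.
apply: lee_wpmul2l; first by rewrite lee_fin.
have [bi|bi] := eqVneq (sqn (b i)) 0.
  apply: (@le_trans _ _ (\int[gaussian N]_x 1)%E).
    apply: ge0_le_integral => //; first exact/measurable_EFinP.
    by move=> x _; rewrite (sqn_eq0 bi) dot0l expr0n mulr0 mul0r expR0.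
  rewrite integral_cst_gaussian lee_fin.
  by rewrite -[leLHS]sqrtr1 ler_sqrt// ler1n.
rewrite integral_expR_sqr_dot; last 2 first.
- by rewrite divr_ge0 ?sqn_ge0// mulr_ge0// fro2_ge0.
- by rewrite divfK//; lra.
rewrite divfK// lee_fin -[leRHS]invrK lef_pV2 ?posrE ?invr_gt0 ?sqrtr_gt0//; last by lra.
by rewrite -sqrtrV// ler_sqrt; lra.
Qed.

End Tails.

(** * Exponential moments and tails of Gaussian quadratic forms *)

Section Chaos.
Context {R : realType}.

Let e0 (x : R) : (0 <= (expR x)%:E)%E. Proof. by rewrite lee_fin expR_ge0. Qed.

Lemma sqrtr2_le2 : Num.sqrt 2 <= 2 :> R.
Proof.
rewrite -ler_sqr ?nnegrE ?sqrtr_ge0// sqr_sqrtr//; lra.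
Qed.

Lemma gaussian_psd_tail N p (B : 'M[R]_(p, N)) (u : R) :
  (gaussian N [set x | (4 * fro2 B * u < sqn (B *m tv x))%R]
   <= (2 * expR (- u))%:E)%E.
Proof.
have mB i := @measurable_mulmx_tv R N p B i.
have [B0|B0] := eqVneq (fro2 B) 0.
  rewrite [X in gaussian N X](_ : _ = set0) ?measure0 ?lee_fin ?mulr_ge0 ?expR_ge0//.
  rewrite -subset0 => x /=; rewrite B0 mulr0 mul0r => h.
  by have := sqn_mulmx_le B (tv x); rewrite B0 mul0r leNgt h.
have F0 : 0 < fro2 B by rewrite lt_neqAle eq_sym B0 fro2_ge0.
apply: (@chernoff _ _ _ _ _ (fun x => (2 * fro2 B)^-1 * sqn (B *m tv x) / 2)).
- by apply: measurable_setb; apply: measurable_fun_ltr => //; exact: measurable_sqn.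
- apply: measurable_funM => //; apply: measurable_funM => //; exact: measurable_sqn.
- apply: le_trans (integral_expR_sqn_mulmx _ _) _.
  + by rewrite invr_ge0 mulr_ge0// ltW.
  + by rewrite invfM -mulrA mulVf// mulr1.
  + by rewrite lee_fin sqrtr2_le2.
- move=> x /= h; have -> : u = (2 * fro2 B)^-1 * (4 * fro2 B * u) / 2 by field.
  rewrite ler_pM2r// ler_pM2l ?(ltW h)// invr_gt0 mulr_gt0//.
Qed.

(** The bound ln (1 - y) >= - y - 2 y^2, obtained from 1 + x <= exp x after taking inverses. The
    first-order term will cancel the mean of a centred square. *)
Lemma expR_le_1B (y : R) : `|y| <= 2^-1 -> expR (- y - 2 * y ^+ 2) <= 1 - y.
Proof.
rewrite ler_norml => /andP[y1 y2].
have [y0|y0] := leP 0 y.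
  rewrite -opprD expRN -[leRHS]invrK lef_pV2 ?posrE ?expR_gt0 ?invr_gt0 //; last by lra.
  apply: le_trans (expR_ge1Dx _).
  rewrite -[leLHS]mul1r ler_pdivrMr; last by lra.
  have : 0 <= y ^+ 2 * (1 - 2 * y) by rewrite mulr_ge0 ?sqr_ge0; lra.
  have := sqr_ge0 y; nra.
set z := - y; have z0 : 0 < z by rewrite oppr_gt0.
have -> : z - 2 * y ^+ 2 = - (2 * z ^+ 2 - z) by rewrite /z; ring.
rewrite expRN -[leRHS]invrK lef_pV2 ?posrE ?expR_gt0 ?invr_gt0 //; last by lra.
apply: le_trans (expR_ge1Dx _).
rewrite -[leLHS]mul1r ler_pdivrMr; last by lra.
have : 0 <= z ^+ 2 * z by rewrite mulr_ge0 ?sqr_ge0; lra.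
have := sqr_ge0 z; nra.
Qed.

Lemma integral_N01_expR_sqrB1 (c : R) : `|c| <= 4^-1 ->
  (\int[N01]_x (expR (c * (x ^+ 2 - 1)))%:E <= (expR (4 * c ^+ 2))%:E)%E.
Proof.
move=> c4; have := c4; rewrite ler_norml => /andP[c1 c2].
apply: (@le_trans _ _ (\int[N01]_x ((expR (- c))%:E * (expR (c * x ^+ 2))%:E))%E).
  rewrite le_eqVlt; apply/orP; left; apply/eqP.
  by apply: eq_integral => x _; rewrite -EFinM -expRD; congr (expR _)%:E; ring.
rewrite ge0_integralZl//; last first.
  by apply/measurable_EFinP/measurableT_comp => //; exact: measurable_funM.
rewrite integral_N01_expR_sqr; last by lra.
rewrite -EFinM lee_fin ler_pdivrMr ?sqrtr_gt0; last by lra.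
have -> : - c = 4 * c ^+ 2 + (- c - 4 * c ^+ 2) by ring.
rewrite expRD ler_pM2l ?expR_gt0//.
rewrite -ler_sqr ?nnegrE ?expR_ge0 ?sqrtr_ge0// sqr_sqrtr; last by lra.
rewrite -expRM_natl.
have -> : 2%:R * (- c - 4 * c ^+ 2) = - (2 * c) - 2 * (2 * c) ^+ 2 by ring.
by apply: expR_le_1B; rewrite ler_norml; lra.
Qed.

Lemma integral_expR_diag N (c : 'I_N -> R) : (forall k, `|c k| <= 4^-1) ->
  (\int[gaussian N]_x (expR (\sum_k c k * (tnth x k ^+ 2 - 1)))%:E
   <= (expR (4 * \sum_k c k ^+ 2))%:E)%E.
Proof.
have mE M (c' : 'I_M -> R) : measurable_fun [set: M.-tuple R]
    (fun x => (expR (\sum_k c' k * (tnth x k ^+ 2 - 1)))%:E).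
  apply/measurable_EFinP/measurableT_comp => //; apply: measurable_sum => k.
  apply: measurable_funM => //; apply: measurable_funB => //.
  apply: measurable_funX; exact: measurable_tnth.
elim: N c => [|N IH] c c4.
  by rewrite gaussian0E ?big_ord0 ?mulr0 ?lexx// => x; rewrite big_ord0 expR0.
rewrite gaussianSE//.
pose I0 := expR (4 * \sum_(k < N) c (lift ord0 k) ^+ 2).
have I00 : (0 <= I0%:E)%E by exact: e0.
apply: (@le_trans _ _ (\int[N01]_x ((expR (c ord0 * (x ^+ 2 - 1)))%:E * I0%:E))%E).
  apply: ge0_le_integral => //.
  - by move=> x _; apply: integral_ge0.
  - have := measurable_fun_fubini_tonelli_F.
    move=> /(_ _ _ _ _ _ (gaussian N) (fun p => (expR (\sum_k c k * (tnth (tcons p) k ^+ 2 - 1)))%:E)).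
    apply => //; exact: (measurableT_comp (mE _ _) (@measurable_tcons R N)).
  - apply: emeasurable_funM => //; apply/measurable_EFinP/measurableT_comp => //.
    by apply: measurable_funM => //; apply: measurable_funB.
  - move=> x _.
    apply: (@le_trans _ _ (\int[gaussian N]_y ((expR (c ord0 * (x ^+ 2 - 1)))%:E *
       (expR (\sum_k c (lift ord0 k) * (tnth y k ^+ 2 - 1)))%:E))%E).
      rewrite le_eqVlt; apply/orP; left; apply/eqP.
      apply: eq_integral => y _; rewrite big_ord_recl tnth_tcons0 -EFinM -expRD.
      congr EFin; congr expR; congr (_ + _).
      by apply: eq_bigr => k _; rewrite tnth_tconsS.
    rewrite ge0_integralZl//; last exact: mE.
    apply: lee_wpmul2l => //.
    by apply: IH => k; exact: c4.
rewrite ge0_integralZr//; last first.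
  apply/measurable_EFinP/measurableT_comp => //.
  by apply: measurable_funM => //; apply: measurable_funB.
apply: (@le_trans _ _ ((expR (4 * c ord0 ^+ 2))%:E * I0%:E)%E).
  by rewrite lee_wpmul2r// integral_N01_expR_sqrB1.
by rewrite -EFinM lee_fin -expRD ler_expR big_ord_recl mulrDr.
Qed.

End Chaos.

Section ChaosTail.
Context {R : realType}.

Let e0 (x : R) : (0 <= (expR x)%:E)%E. Proof. by rewrite lee_fin expR_ge0. Qed.

Definition quad N (B : 'M[R]_N) (x : N.-tuple R) := dot (tv x) (B *m tv x).

Lemma measurable_quad N (B : 'M[R]_N) : measurable_fun [set: N.-tuple R] (quad B).
Proof.
apply: measurable_dot => i; [exact: measurable_tv|exact: measurable_mulmx_tv].
Qed.

(** The off-diagonal part of the form folded into the strict lower triangle: same values as a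
    quadratic form, but now causal, so that [gaussian_selfnorm] applies. *)
Definition lowpart N (B : 'M[R]_N) : 'M[R]_N :=
  \matrix_(k, j) (if (j < k)%N then B k j + B j k else 0).

Lemma sum_triangle N (F : 'I_N -> 'I_N -> R) :
  \sum_k \sum_j F k j =
  \sum_k F k k + \sum_(k < N) \sum_(j < N | (j < k)%N) (F k j + F j k).
Proof.
transitivity (\sum_(k < N) (F k k + \sum_(j < N | (j < k)%N) F k j
    + \sum_(j < N | (k < j)%N) F k j)).
  apply: eq_bigr => k _.
  rewrite (bigID (fun j : 'I_N => (j < k)%N)) /= addrC [RHS]addrAC; congr (_ + _).
  rewrite (bigD1 k) ?ltnn//=; congr (_ + _); apply: eq_bigl => j.
  by rewrite -leqNgt ltn_neqAle andbC eq_sym.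
rewrite !big_split /= -addrA; congr (_ + _).
under [in RHS]eq_bigr do rewrite big_split /=.
rewrite big_split /=; congr (_ + _).
rewrite (exchange_big_dep predT)//=.
Qed.

Lemma quad_low N (B : 'M[R]_N) x : quad B x - \tr B =
  \sum_k B k k * (tnth x k ^+ 2 - 1) + dot (tv x) (lowpart B *m tv x).
Proof.
have -> : quad B x = \sum_k \sum_j B k j * (tnth x k * tnth x j).
  apply: eq_bigr => k _; rewrite [tv x k 0]mxE [X in _ * X]mxE mulr_sumr.
  apply: eq_bigr => j _.
  by rewrite mxE; ring.
rewrite sum_triangle addrAC; congr (_ + _).
  by rewrite -sumrB; apply: eq_bigr => k _; ring.
apply: eq_bigr => k _; rewrite [tv x k 0]mxE [X in _ * X]mxE mulr_sumr.
rewrite big_mkcond; apply: eq_bigr => j _; rewrite !mxE.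
by case: ifP => _; ring.
Qed.

Lemma fro2_lowpart N (B : 'M[R]_N) : fro2 (lowpart B) <= 2 * fro2 B.
Proof.
rewrite [fro2 B]sum_triangle mulrDr ler_wpDl ?mulr_ge0//.
  by apply: sumr_ge0 => k _; exact: sqr_ge0.
rewrite mulr_sumr; apply: ler_sum => k _; rewrite mulr_sumr [leRHS]big_mkcond.
apply: ler_sum => j _; rewrite mxE; case: ifP => _; last by rewrite expr0n.
have := sqr_ge0 (B k j - B j k); nra.
Qed.

(** Replaces the Cauchy-Schwarz inequality for integrals: dependent parts of a chaos are integrated
    separately, at the price of doubled slopes. *)
Lemma expR_midpoint (a b : R) : expR (a + b) <= (expR (2 * a) + expR (2 * b)) / 2.
Proof.
rewrite expRD !expRM_natl.
have := sqr_ge0 (expR a - expR b); nra.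
Qed.

(** Two midpoint splittings: diagonal against off-diagonal, then the compensated martingale against
    its compensator. The constant 256 keeps each diagonal slope below 1/8 and the scale of the
    compensator, 32 l^2 |B|_F^2, below 1/8. *)
Lemma integral_expR_quad N (B : 'M[R]_N) (l : R) : l ^+ 2 * fro2 B <= 256^-1 ->
  (\int[gaussian N]_x (expR (l * (quad B x - \tr B)))%:E <= 2%:E)%E.
Proof.
move=> lB; set L := lowpart B.
have mL c i : measurable_fun [set: N.-tuple R] (fun x => ((c *: L) *m tv x) i 0).
  exact: measurable_mulmx_tv.
have mL1 i : measurable_fun [set: N.-tuple R] (fun x => (L *m tv x) i 0).
  exact: measurable_mulmx_tv.
pose f1 (x : N.-tuple R) := expR (\sum_k (2 * l * B k k) * (tnth x k ^+ 2 - 1)).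
pose f2 (x : N.-tuple R) := expR (dot (tv x) (0 + ((4 * l) *: L) *m tv x)
    - sqn (0 + ((4 * l) *: L) *m tv x) / 2).
pose f3 (x : N.-tuple R) := expR (16 * l ^+ 2 * sqn (L *m tv x) / 2).
have m1 : measurable_fun setT f1.
  apply/measurableT_comp => //; apply: measurable_sum => k.
  apply: measurable_funM => //; apply: measurable_funB => //.
  apply: measurable_funX; exact: measurable_tnth.
have m2 : measurable_fun setT f2.
  apply/measurableT_comp => //; under eq_fun do rewrite add0r.
  apply: measurable_funB; first by apply: measurable_dot => //; exact: measurable_tv.
  by apply: measurable_funM => //; exact: measurable_sqn.
have m3 : measurable_fun setT f3.
  apply/measurableT_comp => //; apply: measurable_funM => //.
  by apply: measurable_funM => //; exact: measurable_sqn.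
have n1 x : (0 <= (f1 x)%:E)%E by exact: e0.
have n2 x : (0 <= (f2 x)%:E)%E by exact: e0.
have n3 x : (0 <= (f3 x)%:E)%E by exact: e0.
have mE1 := (measurable_EFinP _ _).2 m1.
have mE2 := (measurable_EFinP _ _).2 m2.
have mE3 := (measurable_EFinP _ _).2 m3.
apply: (@le_trans _ _ (\int[gaussian N]_x
    ((2^-1)%:E * (f1 x)%:E + ((4^-1)%:E * (f2 x)%:E + (4^-1)%:E * (f3 x)%:E)))%E).
  apply: ge0_le_integral => //.
  - apply/measurable_EFinP/measurableT_comp => //; apply: measurable_funM => //.
    by apply: measurable_funB => //; exact: measurable_quad.
  - apply: emeasurable_funD; first exact: emeasurable_funM.
    by apply: emeasurable_funD; exact: emeasurable_funM.
  - move=> x _; rewrite -!EFinM -!EFinD lee_fin quad_low mulrDr.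
    apply: le_trans (expR_midpoint _ _) _.
    have -> : expR (2 * (l * \sum_k B k k * (tnth x k ^+ 2 - 1))) = f1 x.
      by congr expR; rewrite !mulr_sumr; apply: eq_bigr => k _; ring.
    suff : expR (2 * (l * dot (tv x) (L *m tv x))) <= (f2 x + f3 x) / 2 by lra.
    (* The compensator of the doubled slope 4 l is subtracted and added back: doubling turns the
       first part into the exponent of mean one. *)
    have -> : 2 * (l * dot (tv x) (L *m tv x)) =
        (2 * l * dot (tv x) (L *m tv x) - 4 * l ^+ 2 * sqn (L *m tv x))
        + 4 * l ^+ 2 * sqn (L *m tv x) by ring.
    apply: le_trans (expR_midpoint _ _) _; rewrite ler_pM2r ?invr_gt0//.
    rewrite le_eqVlt; apply/orP; left; apply/eqP; congr (expR _ + expR _).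
      by rewrite !add0r -scalemxAl dotZr sqnZ; field.
    by field.
have h0 (r : R) : 0 <= r -> (0 <= r%:E)%E by rewrite lee_fin.
rewrite ge0_integralD//; last 4 first.
- by move=> x _; rewrite mule_ge0// h0.
- exact: emeasurable_funM.
- by move=> x _; rewrite adde_ge0// mule_ge0// h0.
- by apply: emeasurable_funD; exact: emeasurable_funM.
rewrite ge0_integralD//; last 4 first.
- by move=> x _; rewrite mule_ge0// h0.
- exact: emeasurable_funM.
- by move=> x _; rewrite mule_ge0// h0.
- exact: emeasurable_funM.
rewrite !ge0_integralZl//; try by rewrite h0.
apply: (@le_trans _ _ ((2^-1)%:E * 2%:E + ((4^-1)%:E * 1%:E + (4^-1)%:E * 2%:E))%E); last first.
  by rewrite -!EFinM -!EFinD lee_fin; lra.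
apply: leeD; last apply: leeD.
- apply: lee_wpmul2l; first by rewrite h0.
  apply: le_trans (integral_expR_diag _) _.
    move=> k; rewrite -ler_sqr ?nnegrE// -normrX ger0_norm ?sqr_ge0//.
    have : B k k ^+ 2 <= fro2 B.
      rewrite /fro2 (bigD1 k)//= (bigD1 k)//= -addrA ler_wpDr// addr_ge0//.
        by apply: sumr_ge0 => ? _; exact: sqr_ge0.
      by do 2!apply: sumr_ge0 => ? _; exact: sqr_ge0.
    move=> /(ler_wpM2l (sqr_ge0 l)); rewrite !exprMn; lra.
  rewrite lee_fin; apply: (@le_trans _ _ (expR 16^-1)).
    rewrite ler_expR.
    have : \sum_k B k k ^+ 2 <= fro2 B.
      apply: ler_sum => k _; rewrite (bigD1 k)//= ler_wpDr//.
      by apply: sumr_ge0 => ? _; exact: sqr_ge0.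
    move=> /(ler_wpM2l (sqr_ge0 l)).
    have -> : \sum_k (2 * l * B k k) ^+ 2 = 4 * (l ^+ 2 * \sum_k B k k ^+ 2).
      by rewrite !mulr_sumr; apply: eq_bigr => k _; ring.
    lra.
  rewrite -[leLHS]invrK -expRN -[leRHS]invrK lef_pV2 ?posrE ?invr_gt0 ?expR_gt0//.
  by apply: le_trans (expR_ge1Dx _); lra.
- apply: lee_wpmul2l; first by rewrite h0.
  rewrite gaussian_selfnorm// => k j kj; rewrite !mxE ltnNge kj mulr0//.
- apply: lee_wpmul2l; first by rewrite h0.
  apply: le_trans (integral_expR_sqn_mulmx _ _) _.
  + by rewrite mulr_ge0// sqr_ge0.
  + have := ler_wpM2l (sqr_ge0 l) (fro2_lowpart B); rewrite -/L; lra.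
  + by rewrite lee_fin sqrtr2_le2.
Qed.

(** A weak form of the Hanson-Wright inequality: only the exponential regime, at the scale of the
    Frobenius norm. The slope 1 / (16 |B|_F) is the largest that [integral_expR_quad] admits. *)
Lemma gaussian_chaos_tail N (B : 'M[R]_N) (u : R) :
  (gaussian N [set x | (16 * u * Num.sqrt (fro2 B) < `|quad B x - \tr B|)%R]
   <= (4 * expR (- u))%:E)%E.
Proof.
have mq (C : 'M[R]_N) := @measurable_quad N C.
have mq1 (C : 'M[R]_N) : measurable_fun setT (fun x => quad C x - \tr C).
  exact: measurable_funB.
have one (C : 'M[R]_N) : fro2 C != 0 ->
  (gaussian N [set x | (16 * u * Num.sqrt (fro2 C) < quad C x - \tr C)%R] <= (2 * expR (- u))%:E)%E.
  move=> C0; have F0 : 0 < fro2 C by rewrite lt_neqAle eq_sym C0 fro2_ge0.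
  set s := Num.sqrt (fro2 C); have s0 : 0 < s by rewrite sqrtr_gt0.
  apply: (@chernoff _ _ _ _ _ (fun x => (16 * s)^-1 * (quad C x - \tr C))).
  - by apply: measurable_setb; apply: measurable_fun_ltr.
  - exact: measurable_funM.
  - apply: integral_expR_quad; rewrite -(sqr_sqrtr (ltW F0)) -/s.
    by rewrite le_eqVlt; apply/orP; left; apply/eqP; field; rewrite gt_eqF.
  - move=> x /= h; have -> : u = (16 * s)^-1 * (16 * u * s) by field; rewrite gt_eqF.
    by rewrite ler_wpM2l ?(ltW h)// invr_ge0 mulr_ge0// ltW.
have [B0|B0] := eqVneq (fro2 B) 0.
  rewrite [X in gaussian N X](_ : _ = set0) ?measure0 ?lee_fin ?mulr_ge0 ?expR_ge0//.
  rewrite -subset0 => x /=; rewrite B0 sqrtr0 mulr0.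
  have Be : B = 0.
    apply/matrixP => i j; rewrite mxE; apply/eqP; rewrite -sqrf_eq0; apply/eqP.
    move: B0 => /eqP; rewrite psumr_eq0; last first.
      by move=> ? _; apply: sumr_ge0 => ? _; exact: sqr_ge0.
    move=> /allP /(_ i (mem_index_enum _)) /=.
    rewrite psumr_eq0; last by move=> ? _; exact: sqr_ge0.
    by move=> /allP /(_ j (mem_index_enum _)) /= /eqP.
  by rewrite Be /quad mul0mx dotC dot0l mxtrace0 subr0 normr0 ltxx.
have m1 (C : 'M[R]_N) (t : R) : measurable [set x : N.-tuple R | t < quad C x - \tr C].
  by apply: measurable_setb; apply: measurable_fun_ltr.
have frN : fro2 (- B) = fro2 B.
  by apply: eq_bigr => i _; apply: eq_bigr => j _; rewrite mxE sqrrN.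
set t := 16 * u * _.
apply: (@le_trans _ _ (gaussian N ([set x | (t < quad B x - \tr B)%R] `|`
  [set x | (t < quad (- B) x - \tr (- B))%R]))).
  apply: le_measure; rewrite ?inE.
  - apply: measurable_setb; apply: measurable_fun_ltr => //.
    exact: measurableT_comp.
  - exact: measurableU.
  - move=> x /=; rewrite /quad mulNmx dotNr raddfN /= opprK [- _ + _]addrC -[\tr B - _]opprB.
    by case: (ger0P (dot _ _ - _)) => _; [left|right].
have -> : 4 * expR (- u) = 2 * expR (- u) + 2 * expR (- u) by ring.
rewrite EFinD; apply: le_trans (measureU2 _ _ _) _ => //.
apply: leeD; first exact: one.
by rewrite /t -frN; apply: one; rewrite frN.
Qed.

End ChaosTail.

(** * Rotation invariance and transfer from random variables *)

Section Rotation.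
Context {R : realType}.
Local Notation mu := (@lebesgue_measure R).

Let affine (a b : R) : measurableTypeR R -> measurableTypeR R := fun x => a * x + b.

Let measurable_affineR (a b : R) : measurable_fun setT (affine a b).
Proof.
have : measurable_fun [set: measurableTypeR R] (fun x : measurableTypeR R => (a * x + b : R)).
  by apply: measurable_funD => //; exact: measurable_funM.
by [].
Qed.

Let affine_measure (a b : R) : {measure set (measurableTypeR R) -> \bar R} :=
  measure_function_pushforward__canonical__measure_function_Measure
    mu (measurable_affineR a b).

Lemma lebesgue_measure_affine (a b : R) (a0 : 0 < a) (A : set R) : measurable A ->
  mu A = mscale (NngNum (ltW a0)) (affine_measure a b) A.
Proof.
move=> mA; apply: lebesgue_measure_unique => //= _ [[c d]] _ <-.
rewrite /mscale /= /pushforward.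
have -> : affine a b @^-1` `]c, d] = `](c - b) / a, (d - b) / a]%classic.
  apply/seteqP; split => x; rewrite /affine /= !in_itv /= => /andP[h1 h2];
    apply/andP; split; move: h1 h2; rewrite ?ltr_pdivrMr ?ler_pdivlMr//; lra.
rewrite !lebesgue_measure_itv/= !lte_fin ltr_pM2r ?invr_gt0// ltrD2r.
case: ifP => _; last by rewrite mule0.
by rewrite -!EFinD -EFinM; congr EFin; field; rewrite gt_eqF.
Qed.

Lemma integral_lebesgue_affine (a b : R) (f : R -> \bar R) : 0 < a ->
  (forall x, 0 <= f x)%E -> measurable_fun setT f ->
  (\int[mu]_x f x = a%:E * \int[mu]_x f (a * x + b)%R)%E.
Proof.
move=> a0 f0 mf.
rewrite (eq_measure_integral (mscale (NngNum (ltW a0)) (affine_measure a b))); last first.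
  by move=> A mA _; exact: lebesgue_measure_affine.
rewrite ge0_integral_mscale//.
by rewrite /affine_measure ge0_integral_pushforward// preimage_setT.
Qed.

(** Only one-dimensional affine changes of variable are used: y = sqrt 2 p - x at fixed x, then,
    after Tonelli, x = (p + q) / sqrt 2 at fixed p. The two Jacobians cancel, and the joint density
    depends only on x^2 + y^2 = p^2 + q^2. *)
Lemma integral_N01_rotation (f : R * R -> \bar R) :
  (forall p, 0 <= f p)%E -> measurable_fun setT f ->
  (\int[@N01 R]_x \int[@N01 R]_y f ((x + y) / Num.sqrt 2, (x - y) / Num.sqrt 2)%R
   = \int[@N01 R]_x \int[@N01 R]_y f (x, y))%E.
Proof.
move=> f0 mf; set r := Num.sqrt 2 : R.
have r0 : 0 < r by rewrite sqrtr_gt0.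
have rn0 : r != 0 by rewrite gt_eqF.
have r2 : r ^+ 2 = 2 by rewrite sqr_sqrtr.
pose phi (x : R) : \bar R := (normal_pdf 0 1 x)%:E.
have phi0 x : (0 <= phi x)%E by rewrite lee_fin normal_pdf_ge0.
have mphi : measurable_fun [set: R] phi.
  by apply/measurable_EFinP; exact: measurable_normal_pdf.
have mphiT d (T : measurableType d) (h : T -> R) :
    measurable_fun setT h -> measurable_fun setT (fun x => phi (h x)).
  by move=> mh; exact: (measurableT_comp mphi mh).
have mfT d (T : measurableType d) (g h : T -> R) :
    measurable_fun setT g -> measurable_fun setT h -> measurable_fun setT (fun x => f (g x, h x)).
  by move=> mg mh; apply: (measurableT_comp mf); exact/measurable_fun_pairP.
have iN (g : R -> \bar R) := @integral_N01 R g.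
have int2 (h : R * R -> \bar R) : (forall p, 0 <= h p)%E -> measurable_fun setT h ->
   (\int[@N01 R]_x \int[@N01 R]_y h (x, y) =
    \int[mu]_x \int[mu]_y (h (x, y) * phi y * phi x))%E.
  move=> h0 mh.
  rewrite iN; last 2 first.
  - by move=> x; apply: integral_ge0.
  - exact: (measurable_fun_fubini_tonelli_F h mh h0).
  apply: eq_integral => x _.
  have mhx : measurable_fun [set: R] (fun y => h (x, y)).
    by apply: (measurableT_comp mh); exact: measurable_fun_pair.
  rewrite iN// ge0_integralZr//.
  - by apply: emeasurable_funM => //.
  - by move=> y _; rewrite mule_ge0.
have rr : 2 / r = r by rewrite -r2 expr2 mulfK.
rewrite (int2 (fun p => f ((p.1 + p.2) / r, (p.1 - p.2) / r)))//; last first.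
  apply: mfT; apply: measurable_funM => //; [exact: measurable_funD|exact: measurable_funB].
apply: (etrans _ (esym (int2 f f0 mf))).
transitivity (\int[mu]_x \int[mu]_p
    (r%:E * (f (p, r * x - p)%R * phi (r * p - x)%R * phi x)))%E.
  apply: eq_integral => x _.
  rewrite (@integral_lebesgue_affine r (- x) (fun y => f ((x + y) / r, (x - y) / r)%R * phi y * phi x)%E)//; last 2 first.
  - by move=> y; rewrite !mule_ge0.
  - apply: emeasurable_funM => //; apply: emeasurable_funM; last exact: mphiT.
    apply: mfT; apply: measurable_funM => //; [exact: measurable_funD|exact: measurable_funB].
  rewrite -ge0_integralZl//=; last 3 first.
  - apply: emeasurable_funM => //; apply: emeasurable_funM; last first.
      by apply: mphiT; apply: measurable_funB => //; exact: measurable_funM.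
    apply: mfT; apply: measurable_funM => //.
    + apply: measurable_funD => //; apply: measurable_funB => //; exact: measurable_funM.
    + apply: measurable_funB => //; apply: measurable_funB => //; exact: measurable_funM.
  - by move=> p _; rewrite !mule_ge0.
  - by rewrite lee_fin ltW.
  apply: eq_integral => p _; congr (_ * (f (_, _) * _ * _))%E.
  - by field.
  - by rewrite -[X in _ = X * x - _]rr; field.
pose F (z : R * R) := (r%:E * (f (z.2, r * z.1 - z.2)%R * phi (r * z.2 - z.1)%R * phi z.1))%E.
have mF : measurable_fun [set: measurableTypeR R * measurableTypeR R] F.
  apply: emeasurable_funM => //; apply: emeasurable_funM; last exact: mphiT.
  apply: emeasurable_funM.
    apply: mfT => //; apply: measurable_funB => //; exact: measurable_funM.
  by apply: mphiT; apply: measurable_funB => //; exact: measurable_funM.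
have F0 z : (0 <= F z)%E.
  by rewrite /F !mule_ge0// lee_fin ltW.
transitivity (\int[mu]_p \int[mu]_x F (x, p))%E.
  exact: (@fubini_tonelli _ _ (measurableTypeR R) (measurableTypeR R) R mu mu F mF F0).
apply: eq_integral => p _; rewrite /F /=.
rewrite (@integral_lebesgue_affine r^-1 (p / r) (fun x => r%:E * (f (p, r * x - p)%R * phi (r * p - x)%R * phi x))%E) ?invr_gt0//; last 2 first.
- by move=> x; rewrite !mule_ge0// lee_fin ltW.
- apply: emeasurable_funM => //; apply: emeasurable_funM => //; apply: emeasurable_funM.
    apply: mfT => //; apply: measurable_funB => //; exact: measurable_funM.
  by apply: mphiT; apply: measurable_funB.
rewrite -ge0_integralZl//=; last 3 first.
- apply: emeasurable_funM => //; apply: emeasurable_funM; last first.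
    by apply: mphiT; apply: measurable_funD => //; exact: measurable_funM.
  apply: emeasurable_funM.
    apply: mfT => //; apply: measurable_funB => //; apply: measurable_funM => //.
    by apply: measurable_funD => //; exact: measurable_funM.
  apply: mphiT; apply: measurable_funB => //; apply: measurable_funD => //; exact: measurable_funM.
- by move=> x _; rewrite !mule_ge0// lee_fin ltW.
- by rewrite lee_fin invr_ge0 ltW.
apply: eq_integral => q _.
rewrite muleA -EFinM mulVf// mul1e -!muleA; congr (f (_, _) * _)%E.
  by field.
rewrite /phi -!EFinM; congr EFin.
rewrite !normal_pdfE ?oner_eq0// /normal_fun mulrACA [RHS]mulrACA -!expRD.
congr (_ * expR _).
have -> : r * p - (r^-1 * q + p / r) = (p * (r ^+ 2 - 1) - q) / r by field.
rewrite !subr0 expr1n.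
have -> : - ((p * (r ^+ 2 - 1) - q) / r) ^+ 2 / (1 *+ 2) + - (r^-1 * q + p / r) ^+ 2 / (1 *+ 2)
  = - ((p * (r ^+ 2 - 1) - q) ^+ 2 + (q + p) ^+ 2) / (2 * r ^+ 2) by field.
by rewrite r2; field.
Qed.
End Rotation.

Section GaussianRotation.
Context {R : realType}.

Definition rotp N (x y : N.-tuple R) : N.-tuple R :=
  mktuple (fun i => (tnth x i + tnth y i) / Num.sqrt 2).
Definition rotm N (x y : N.-tuple R) : N.-tuple R :=
  mktuple (fun i => (tnth x i - tnth y i) / Num.sqrt 2).

Lemma rotp_tcons N (x0 y0 : R) (x y : N.-tuple R) :
  rotp (tcons (x0, x)) (tcons (y0, y)) = tcons ((x0 + y0) / Num.sqrt 2, rotp x y).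
Proof.
apply: eq_from_tnth => i; rewrite tnth_mktuple.
case: (unliftP ord0 i) => [j|] ->.
  by rewrite !tnth_tconsS tnth_mktuple.
by rewrite !tnth_tcons0.
Qed.

Lemma rotm_tcons N (x0 y0 : R) (x y : N.-tuple R) :
  rotm (tcons (x0, x)) (tcons (y0, y)) = tcons ((x0 - y0) / Num.sqrt 2, rotm x y).
Proof.
apply: eq_from_tnth => i; rewrite tnth_mktuple.
case: (unliftP ord0 i) => [j|] ->.
  by rewrite !tnth_tconsS tnth_mktuple.
by rewrite !tnth_tcons0.
Qed.

Lemma measurable_rotp d (T : measurableType d) N (g h : T -> N.-tuple R) :
  measurable_fun setT g -> measurable_fun setT h ->
  measurable_fun setT (fun t => rotp (g t) (h t)).
Proof.
move=> mg mh; apply/measurable_fun_tnthP => i.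
rewrite [X in measurable_fun _ X](_ : _ = fun t => (tnth (g t) i + tnth (h t) i) / Num.sqrt 2).
  apply: measurable_funM => //; apply: measurable_funD.
    exact: (measurableT_comp (@measurable_tnth _ _ _ i) mg).
  exact: (measurableT_comp (@measurable_tnth _ _ _ i) mh).
by apply/funext => t /=; rewrite tnth_mktuple.
Qed.

Lemma measurable_rotm d (T : measurableType d) N (g h : T -> N.-tuple R) :
  measurable_fun setT g -> measurable_fun setT h ->
  measurable_fun setT (fun t => rotm (g t) (h t)).
Proof.
move=> mg mh; apply/measurable_fun_tnthP => i.
rewrite [X in measurable_fun _ X](_ : _ = fun t => (tnth (g t) i - tnth (h t) i) / Num.sqrt 2).
  apply: measurable_funM => //; apply: measurable_funB.
    exact: (measurableT_comp (@measurable_tnth _ _ _ i) mg).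
  exact: (measurableT_comp (@measurable_tnth _ _ _ i) mh).
by apply/funext => t /=; rewrite tnth_mktuple.
Qed.

Lemma measurable_tcons2 d (T : measurableType d) N (g : T -> R) (h : T -> N.-tuple R) :
  measurable_fun setT g -> measurable_fun setT h ->
  measurable_fun setT (fun t => tcons (g t, h t)).
Proof. by move=> mg mh; exact: measurable_cons. Qed.

Lemma measurable_int_param d d' (T : measurableType d) (U : measurableType d')
    (P : probability U R) (F : T * U -> \bar R) :
  measurable_fun setT F -> (forall p, 0 <= F p)%E ->
  measurable_fun setT (fun t => \int[P]_u F (t, u))%E.
Proof. move=> mF F0; exact: (measurable_fun_fubini_tonelli_F F mF F0). Qed.

Lemma swap_int d d' (T : measurableType d) (U : measurableType d')
    (P : probability T R) (Q : probability U R) (F : T -> U -> \bar R) :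
  measurable_fun setT (fun p : T * U => F p.1 p.2) -> (forall t u, 0 <= F t u)%E ->
  (\int[P]_t \int[Q]_u F t u = \int[Q]_u \int[P]_t F t u)%E.
Proof.
move=> mF F0; exact: (@fubini_tonelli _ _ _ _ _ P Q (fun p => F p.1 p.2) mF (fun p => F0 _ _)).
Qed.

Lemma gaussianSE2 N (f : N.+1.-tuple R * N.+1.-tuple R -> \bar R) :
  (forall p, 0 <= f p)%E -> measurable_fun setT f ->
  (\int[gaussian N.+1]_x \int[gaussian N.+1]_y f (x, y) =
   \int[@N01 R]_x0 \int[@N01 R]_y0 \int[gaussian N]_x \int[gaussian N]_y
     f (tcons (x0, x), tcons (y0, y)))%E.
Proof.
move=> f0 mf.
rewrite gaussianSE; last 2 first.
- by move=> x; apply: integral_ge0.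
- exact: measurable_int_param.
apply: eq_integral => x0 _.
transitivity (\int[gaussian N]_x \int[@N01 R]_y0 \int[gaussian N]_y
    f (tcons (x0, x), tcons (y0, y)))%E.
  apply: eq_integral => x _; rewrite gaussianSE//.
  by apply: (measurableT_comp mf); exact: measurable_fun_pair.
apply: (@swap_int _ _ _ _ _ _ (fun x y0 => \int[gaussian N]_y f (tcons (x0, x), tcons (y0, y)))%E).
  apply: (@measurable_int_param _ _ _ _ _ (fun z => f (tcons (x0, z.1.1), tcons (z.1.2, z.2)))) => //.
  apply: (measurableT_comp mf); apply: measurable_fun_pair; apply: measurable_tcons2 => //.
    exact: (measurableT_comp measurable_fst measurable_fst).
  exact: (measurableT_comp measurable_snd measurable_fst).
by move=> x y0; apply: integral_ge0.
Qed.

Lemma gaussian_rotation N (f : N.-tuple R * N.-tuple R -> \bar R) :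
  (forall p, 0 <= f p)%E -> measurable_fun setT f ->
  (\int[gaussian N]_x \int[gaussian N]_y f (rotp x y, rotm x y)
   = \int[gaussian N]_x \int[gaussian N]_y f (x, y))%E.
Proof.
elim: N f => [|N IH] f f0 mf.
  by apply: eq_integral => x _; apply: eq_integral => y _; congr (f (_, _)); apply: eq_from_tnth => -[].
have mrot M : measurable_fun setT (fun p : M.-tuple R * M.-tuple R => (rotp p.1 p.2, rotm p.1 p.2)).
  apply: measurable_fun_pair.
    exact: (measurable_rotp measurable_fst measurable_snd).
  exact: (measurable_rotm measurable_fst measurable_snd).
rewrite (@gaussianSE2 N (fun p => f (rotp p.1 p.2, rotm p.1 p.2)))//; last exact: (measurableT_comp mf (mrot _)).
apply: (etrans _ (esym (gaussianSE2 f0 mf))).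
pose G (p : R * R) := (\int[gaussian N]_x \int[gaussian N]_y f (tcons (p.1, x), tcons (p.2, y)))%E.
transitivity (\int[@N01 R]_x0 \int[@N01 R]_y0 G ((x0 + y0) / Num.sqrt 2, (x0 - y0) / Num.sqrt 2)%R)%E.
  apply: eq_integral => x0 _; apply: eq_integral => y0 _ /=.
  under eq_integral do under eq_integral do rewrite rotp_tcons rotm_tcons.
  rewrite (IH (fun p => f (tcons ((x0 + y0) / Num.sqrt 2, p.1), tcons ((x0 - y0) / Num.sqrt 2, p.2))))//.
  by apply: (measurableT_comp mf); apply: measurable_fun_pair; apply: measurable_tcons2.
apply: integral_N01_rotation.
- by move=> p; apply: integral_ge0 => x _; apply: integral_ge0.
- apply: (@measurable_int_param _ _ _ _ _ (fun z => \int[gaussian N]_y f (tcons (z.1.1, z.2), tcons (z.1.2, y)))%E).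
    apply: (@measurable_int_param _ _ _ _ _ (fun z => f (tcons (z.1.1.1, z.1.2), tcons (z.1.1.2, z.2)))) => //.
    apply: (measurableT_comp mf); apply: measurable_fun_pair; apply: measurable_tcons2 => //.
    + apply: (measurableT_comp measurable_fst); exact: (measurableT_comp measurable_fst measurable_fst).
    + exact: (measurableT_comp measurable_snd measurable_fst).
    + apply: (measurableT_comp measurable_snd); exact: (measurableT_comp measurable_fst measurable_fst).
  by move=> z; apply: integral_ge0.
Qed.

End GaussianRotation.

Section Transfer.
Context {R : realType}.

Definition rect N (B : 'I_N -> set R) : set (N.-tuple R) :=
  [set x | forall i, B i (tnth x i)].

Lemma measurable_rect N (B : 'I_N -> set R) :
  (forall i, measurable (B i)) -> measurable (rect B).
Proof.
move=> mB.
have -> : rect B = \bigcap_(i in [set: 'I_N]) ((@tnth N R)^~ i @^-1` B i).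
  by apply/seteqP; split => x /= h i; [move=> _; exact: h|exact: h].
apply: fin_bigcap_measurable => // i _.
by rewrite -[X in measurable X]setTI; exact: measurable_tnth.
Qed.

Lemma gaussian_rect N (B : 'I_N -> set R) : (forall i, measurable (B i)) ->
  gaussian N (rect B) = (\prod_i N01 (B i))%E.
Proof.
elim: N B => [|N IH] B mB.
  rewrite big_ord0 /= diracE mem_set// => -[]//.
have E : @tcons R N @^-1` rect B = B ord0 `*` rect (fun i => B (lift ord0 i)).
  apply/seteqP; split => -[x y] /=.
    move=> h; split => [|i] /=; first by have := h ord0; rewrite tnth_tcons0.
    by have := h (lift ord0 i); rewrite tnth_tconsS.
  move=> [h0 h] i; case: (unliftP ord0 i) => [j|] ->.
    by rewrite tnth_tconsS; exact: h.
  by rewrite tnth_tcons0.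
rewrite -[LHS]/((N01 \x gaussian N)%E (@tcons R N @^-1` rect B)) E.
rewrite product_measure1E//; last by apply: measurable_rect => i.
rewrite big_ord_recl; congr (_ * _)%E; exact: IH.
Qed.

Lemma measurable_tuple_rect N : @measurable _ (N.-tuple R) =
  <<s [set rect B | B in [set B : 'I_N -> set R | forall i, measurable (B i)]] >>.
Proof.
apply/seteqP; split; last first.
  apply: smallest_sub; first exact: sigma_algebra_measurable.
  by move=> _ [B mB <-]; exact: measurable_rect.
apply: smallest_sub; first exact: smallest_sigma_algebra.
rewrite -bigcup_seq => A [i _] [B mB <-]; apply: sub_sigma_algebra.
exists (fun j => if j == i then B else setT).
  by move=> j /=; case: ifP.
rewrite setTI; apply/seteqP; split => x /=.
  by move=> /(_ i); rewrite eqxx.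
by move=> Bx j; case: eqP => // ->.
Qed.

Context d (Omega : measurableType d) (P : probability Omega R).
Variables (N : nat) (X : 'I_N -> {RV P >-> R}).

Definition rvtuple (w : Omega) : N.-tuple R := mktuple (fun i => X i w).

Lemma measurable_rvtuple : measurable_fun setT rvtuple.
Proof.
apply/measurable_fun_tnthP => i.
have E : (fun w => tnth (rvtuple w) i) = X i.
  by apply/funext => w; rewrite tnth_mktuple.
by rewrite -[X in measurable_fun _ X]/(fun w => tnth (rvtuple w) i) E.
Qed.

HB.instance Definition _ := isMeasurableFun.Build _ _ _ _ rvtuple measurable_rvtuple.

Hypothesis indX : mutually_independent X.
Hypothesis normX : forall i, standard_normal (X i).

(** Both laws agree on rectangles, by independence and by [gaussian_rect]. Rectangles are stable
    under intersection and generate the sigma-algebra of tuples, so the laws are equal. *)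
Lemma rvtuple_gaussian A : measurable A -> P (rvtuple @^-1` A) = gaussian N A.
Proof.
move=> mA; rewrite -[LHS]/(distribution P rvtuple A).
apply: (measure_unique [set rect B | B in [set B : 'I_N -> set R | forall i, measurable (B i)]] (fun=> setT)) => //.
- exact: measurable_tuple_rect.
- move=> _ _ [B mB <-] [C mC <-]; exists (fun i => B i `&` C i).
    by move=> i; exact: measurableI.
  apply/seteqP; split => x /=.
    by move=> h; split => i; have [] := h i.
  by move=> [h1 h2] i; split; [exact: h1|exact: h2].
- by move=> _; exists (fun=> setT) => //; apply/seteqP; split.
- by rewrite bigcup_const.
- move=> _ [B mB <-]; apply: (etrans _ (esym (gaussian_rect mB))).
  transitivity (P (\bigcap_(i in [set i | i \in [set: 'I_N]%SET]) (X i @^-1` B i))).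
    congr (P _); apply/seteqP; split => w /=.
      by move=> h i _ /=; have := h i; rewrite tnth_mktuple.
    by move=> h i; rewrite tnth_mktuple; apply: h; rewrite /= finset.in_setT.
  rewrite indX//.
  rewrite (eq_bigl predT); last by move=> i; rewrite finset.in_setT.
  by apply: eq_bigr => i _; exact: normX.
- move=> _; rewrite [ltLHS](_ : _ = 1%E) ?ltry//.
  exact: (probability_setT (distribution P rvtuple)).
Qed.

End Transfer.

(** * Chaining over an l1 ball *)

Section TailSum.
Context {R : realType}.
Variables (v : nat -> R).
Hypotheses (v0 : forall i, 0 <= v i) (vS : forall i, v i.+1 <= v i).

Lemma noninc_le i j : (i <= j)%N -> v j <= v i.
Proof.
move=> /subnK <-; elim: (j - i)%N => [|k IH]//.
by rewrite addSn; exact: le_trans (vS _) IH.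
Qed.

(** Cauchy condensation in base 4: the block between 4^J and 4^(J+1) has 3 * 4^J terms, each at
    least the value at its right end, whence the factor 4/3. *)
Lemma sum_pow4_le J :
  \sum_(j < J.+1) 4 ^+ j * v (4 ^ j)%N <= 4 / 3 * \sum_(0 <= i < (4 ^ J).+1) v i.
Proof.
elim: J => [|J IH].
  rewrite big_ord1 expr0 mul1r expn0 big_nat_recr//= big_nat1.
  by have := v0 0; have := v0 1; lra.
rewrite big_ord_recr /=; apply: le_trans (lerD IH (lexx _)) _.
have J4 : (4 ^ J <= 4 ^ J.+1)%N by rewrite leq_pexp2l.
rewrite [in leRHS](big_cat_nat (n := (4 ^ J).+1))//= mulrDr lerD2l.
apply: (@le_trans _ _ (4 / 3 * \sum_((4 ^ J).+1 <= i < (4 ^ J.+1).+1) v (4 ^ J.+1)%N)).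
  rewrite sumr_const_nat subSS -(mulr_natr (v _)) natrB// !natrX exprS.
  have -> : 4%:R * 4%:R ^+ J - 4%:R ^+ J = 3 * 4 ^+ J :> R by ring.
  by rewrite le_eqVlt; apply/orP; left; apply/eqP; field.
apply: ler_wpM2l; first by lra.
by apply: ler_sum_nat => i /andP[_ iJ]; exact: noninc_le.
Qed.

(** For v the decreasing rearrangement of the entries of a vector, the l2 error of keeping the 4^j
    largest ones. *)
Definition vtail J j := Num.sqrt (\sum_((4 ^ j)%N <= i < (4 ^ J)%N) v i ^+ 2).

(* Spares the chaining bound any factor beyond the logarithm of the dimension. *)
Lemma vtail_sum J :
  \sum_(j < J) 2 ^+ j * vtail J j <= 6 * \sum_(0 <= i < (4 ^ J).+1) v i.
Proof.
(* The first block has 3 * 4^j entries, none above v (4^j), so its l2 norm is at most 2 * 2^j * v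
   (4^j). *)
have rec j : (j < J)%N -> vtail J j <= 2 * 2 ^+ j * v (4 ^ j)%N + vtail J j.+1.
  move=> jJ; rewrite -ler_sqr ?nnegrE ?addr_ge0 ?sqrtr_ge0 ?mulr_ge0 ?exprn_ge0//.
  have s0 k : 0 <= \sum_((4 ^ k)%N <= i < (4 ^ J)%N) v i ^+ 2.
    by apply: sumr_ge0 => i _; exact: sqr_ge0.
  rewrite sqr_sqrtr// (big_cat_nat (n := (4 ^ j.+1)%N)) ?leq_pexp2l//=.
  rewrite sqrrD sqr_sqrtr//.
  have : \sum_((4 ^ j)%N <= i < (4 ^ j.+1)%N) v i ^+ 2 <= (2 * 2 ^+ j * v (4 ^ j)%N) ^+ 2.
    apply: (@le_trans _ _ (\sum_((4 ^ j)%N <= i < (4 ^ j.+1)%N) v (4 ^ j)%N ^+ 2)).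
      apply: ler_sum_nat => i /andP[ji _].
      by rewrite ler_sqr ?nnegrE//; exact: noninc_le.
    rewrite sumr_const_nat -(mulr_natr (v _ ^+ 2)) natrB ?leq_pexp2l// !natrX (exprS _ j).
    have e4 : 4 ^+ j = (2 ^+ j) ^+ 2 :> R.
      by rewrite -exprM mulnC exprM; congr (_ ^+ _); ring.
    have : 0 <= v (4 ^ j)%N ^+ 2 * 4 ^+ j by rewrite mulr_ge0 ?sqr_ge0 ?exprn_ge0.
    by rewrite e4; set a := 2 ^+ j; set b := v _; nra.
  have : 0 <= 2 * 2 ^+ j * v (4 ^ j)%N * vtail J j.+1.
    by rewrite !mulr_ge0 ?exprn_ge0 ?sqrtr_ge0.
  by rewrite /vtail; lra.
have t0 j : 0 <= 2 ^+ j * vtail J j by rewrite mulr_ge0 ?exprn_ge0 ?sqrtr_ge0.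
case: J rec t0 => [|J] rec t0.
  by rewrite big_ord0 mulr_ge0// sumr_ge0.
set S := \sum_(j < _) _.
(* The weights 2^j grow geometrically, so the shifted sum is at most half of S and is absorbed; a
   condensed sum of v remains. *)
have : S <= \sum_(j < J.+1) 2 * (4 ^+ j * v (4 ^ j)%N) + 2^-1 * S.
  apply: (@le_trans _ _ (\sum_(j < J.+1) (2 * (4 ^+ j * v (4 ^ j)%N)
     + 2^-1 * (2 ^+ j.+1 * vtail J.+1 j.+1)))).
    apply: ler_sum => j _.
    have := ler_wpM2l (exprn_ge0 j (ler0n R 2)) (rec j (ltn_ord j)).
    have -> : 2 ^+ j * (2 * 2 ^+ j * v (4 ^ j)%N + vtail J.+1 j.+1) =
       2 * ((2 ^+ j * 2 ^+ j) * v (4 ^ j)%N) + 2^-1 * (2 ^+ j.+1 * vtail J.+1 j.+1).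
      by rewrite exprS; field.
    by rewrite -exprMn; have -> : 2 * 2 = 4 :> R by ring.
  rewrite big_split /= lerD2l -mulr_sumr ler_wpM2l//.
  rewrite big_ord_recr /= [X in _ + X](_ : _ = 0); last first.
    by rewrite /vtail big_geq// sqrtr0 mulr0.
  by rewrite addr0 [leRHS]big_ord_recl ler_wpDl.
rewrite -mulr_sumr; have := sum_pow4_le J.
have : \sum_(0 <= i < (4 ^ J).+1) v i <= \sum_(0 <= i < (4 ^ J.+1).+1) v i.
  have J4 : (4 ^ J <= 4 ^ J.+1)%N by rewrite leq_pexp2l.
  by rewrite [leRHS](big_cat_nat (n := (4 ^ J).+1))//= lerDl sumr_ge0.
have : 0 <= \sum_(0 <= i < (4 ^ J.+1).+1) v i by rewrite sumr_ge0.
lra.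
Qed.

End TailSum.

Section Sparse.
Context {R : realType}.

Lemma sort_perm n (w : 'I_n -> R) :
  exists s : {perm 'I_n}, forall i j : 'I_n, (i <= j)%N -> w (s j) <= w (s i).
Proof.
pose r := fun a b : 'I_n => w b <= w a.
pose l := sort r (enum 'I_n).
have sl : size l = n by rewrite size_sort size_enum_ord.
have ul : uniq l by rewrite sort_uniq enum_uniq.
have srt : sorted r l.
  by apply: sort_sorted => a b; exact: le_total.
pose f (i : 'I_n) := nth i l i.
have finj : injective f.
  move=> i j; rewrite /f (set_nth_default i j) ?sl// => /eqP.
  by rewrite nth_uniq ?sl// => /eqP/val_inj.
exists (perm finj) => i j ij; rewrite !permE /f.
rewrite (set_nth_default i j) ?sl//.
apply: (@sorted_leq_nth _ r _ _ i l srt); rewrite ?inE ?sl//.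
- by move=> a b c; rewrite /r => h1 h2; exact: le_trans h2 h1.
- by move=> a; rewrite /r lexx.
Qed.

Lemma quantize (K : nat) (x : R) : (0 < K)%N -> `|x| <= 1 ->
  exists k : 'I_(2 * K).+1, `|x - (k%:R - K%:R) / K%:R| <= K%:R^-1.
Proof.
move=> K0; rewrite ler_norml => /andP[x1 x2].
have K1 : 0 < K%:R :> R by rewrite ltr0n.
pose z := Num.floor (x * K%:R).
have zl : z%:~R <= x * K%:R by exact: floor_le_tmp.
have zu : x * K%:R < z%:~R + 1 by have := floorD1_gt (x * K%:R); rewrite intrD.
have z1 : (- (K : int) <= z)%R.
  rewrite -ltzD1 -(ltr_int R) intrD intrN; apply: le_lt_trans zu.
  by rewrite -[leLHS]mulN1r ler_pM2r.
have z2 : (z <= (K : int))%R.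
  rewrite -(ler_int R); apply: le_trans zl _.
  by rewrite -[leRHS]mul1r ler_pM2r.
have zK : (absz (z + Posz K)%R < (2 * K).+1)%N by lia.
exists (Ordinal zK); rewrite /=.
have -> : (absz (z + Posz K)%R)%:R = z%:~R + K%:R :> R.
  by rewrite natr_absz ger0_norm ?intrD//; lia.
rewrite addrK -[x](mulfK (lt0r_neq0 K1)) -mulrBl normrM normfV [X in _ / X]gtr0_norm//.
rewrite -[leRHS]mul1r ler_pM2r ?invr_gt0// ger0_norm; lra.
Qed.

(* A label of level [j] is a list of [4 ^ j] quantised entries: a coordinate and an
   integer multiple of [16 ^ - j] in [-1, 1], stored shifted by [16 ^ j]. *)
Definition lab n j := {ffun 'I_(4 ^ j) -> 'I_n.+1 * 'I_(2 * 16 ^ j).+1}.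

Definition spvec n j (t : lab n j) : 'cV[R]_n.+1 :=
  \sum_i (((t i).2%:R - (16 ^ j)%:R) / (16 ^ j)%:R) *: delta_mx (t i).1 0.

(** Level j keeps the 4^j largest entries rounded to multiples of 16^-j. Rounding costs sqrt(4^j) *
    16^-j = 8^-j and the dropped entries cost [vtail]. One profile v serves all levels, which lets
    [vtail_sum] add up the errors. *)
Lemma sparse_approx n (u : 'cV[R]_n.+1) (J : nat) : norm1 u <= 1 -> (n < 4 ^ J)%N ->
  exists v : nat -> R, [/\ forall i, 0 <= v i, forall i, v i.+1 <= v i,
    forall i, (n < i)%N -> v i = 0, forall K, \sum_(0 <= i < K) v i <= 1 &
    forall j, exists t : lab n j, norm2 (u - spvec t) <= (8 ^+ j)^-1 + vtail v J j].
Proof.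
move=> u1 nJ; have [s sP] := sort_perm (fun i => `|u i 0|).
pose v (i : nat) : R := if insub i is Some k then `|u (s (k : 'I_n.+1)) 0| else 0.
have vE (i : 'I_n.+1) : v i = `|u (s i) 0| by rewrite /v valK.
have vO i : (n < i)%N -> v i = 0 by move=> ni; rewrite /v insubF// ltnS leqNgt ni.
have v0 i : 0 <= v i by rewrite /v; case: insubP.
have uv : norm1 u = \sum_(i < n.+1) v i.
  by rewrite /norm1 (reindex_inj (@perm_inj _ s)) /=; apply: eq_bigr => i _; rewrite vE.
have vK K : \sum_(0 <= i < K) v i <= 1.
  apply: le_trans u1; rewrite uv -(big_mkord predT v).
  have [Kn|nK] := leqP K n.+1.
    by rewrite [leRHS](big_cat_nat (n := K))//= lerDl sumr_ge0.
  rewrite (big_cat_nat (n := n.+1)) ?(ltnW nK)//= [X in _ + X]big1_seq ?addr0// => i.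
  by rewrite mem_index_iota => /andP[_ /andP[ni _]]; exact: vO.
have ui1 i : `|u i 0| <= 1.
  apply: le_trans u1; rewrite /norm1 (bigD1 i)//= lerDl.
  by apply: sumr_ge0 => k _.
exists v; split => //.
  move=> i; have [ni|ni] := ltnP n i.+1; first by rewrite (vO i.+1).
  have := sP (Ordinal (ltnW ni : (i < n.+1)%N)) (Ordinal (ni : (i.+1 < n.+1)%N)) (leqnSn _).
  by rewrite -!vE.
move=> j; have K0 : (0 < 16 ^ j)%N by rewrite expn_gt0.
have [q qP] : exists q : 'I_n.+1 -> 'I_(2 * 16 ^ j).+1, forall i,
    `|u i 0 - ((q i)%:R - (16 ^ j)%:R) / (16 ^ j)%:R| <= (16 ^ j)%:R^-1.
  have := fun i => quantize K0 (ui1 i); move/choice => [q qP]; by exists q.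
(* When 4^j exceeds the dimension, the spare slots hold the shifted code 16^j, which stands for the
   value 0. *)
pose t : lab n j := [ffun i : 'I_(4 ^ j) => if insub (i : nat) is Some k then (s (k : 'I_n.+1), q (s k))
   else (ord0, inord (16 ^ j))].
exists t.
have tE a : spvec t (s a) 0 = if (a < 4 ^ j)%N then ((q (s a))%:R - (16 ^ j)%:R) / (16 ^ j)%:R else 0.
  rewrite /spvec summxE.
  have zero (i : 'I_(4 ^ j)) : (i : nat) != a ->
     ((((t i).2%:R - (16 ^ j)%:R) / (16 ^ j)%:R) *: delta_mx (t i).1 0 : 'cV[R]_n.+1) (s a) 0 = 0.
    move=> ia; rewrite !mxE eqxx andbT ffunE.
    case: insubP => [k _ ki|_] /=; last first.
      by rewrite inordK ?subrr ?mul0r// ltnS leq_pmull.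
    rewrite (inj_eq perm_inj); case: eqP => [ak|_]; last by rewrite mulr0.
    by move: ia; rewrite ak -ki eqxx.
  case: ifP => aj.
    rewrite (bigD1 (Ordinal aj))//= big1 ?addr0; last by move=> i ia; exact: zero.
    by rewrite !mxE eqxx andbT ffunE /= valK /= eqxx mulr1.
  apply: big1 => i _; apply: zero; apply: contraFneq aj => <-; exact: ltn_ord.
have e0 : 0 <= (8 ^+ j : R)^-1 by rewrite invr_ge0 exprn_ge0.
rewrite -ler_sqr ?nnegrE ?norm2_ge0 ?addr_ge0 ?sqrtr_ge0// norm2_sqr.
have tl0 : 0 <= \sum_((4 ^ j)%N <= i < (4 ^ J)%N) v i ^+ 2.
  by apply: sumr_ge0 => i _; exact: sqr_ge0.
rewrite sqrrD sqr_sqrtr//.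
suff : sqn (u - spvec t) <= (8 ^+ j)^-1 ^+ 2 + \sum_((4 ^ j)%N <= i < (4 ^ J)%N) v i ^+ 2.
  have : 0 <= (8 ^+ j)^-1 * vtail v J j by rewrite mulr_ge0 ?sqrtr_ge0.
  by rewrite -/(vtail v J j); lra.
rewrite /sqn (reindex_inj (@perm_inj _ s)) /=.
rewrite (bigID (fun i : 'I_n.+1 => (i < 4 ^ j)%N)) /=; apply: lerD.
  apply: (@le_trans _ _ (\sum_(i < n.+1 | (i < 4 ^ j)%N) ((16 ^ j)%:R^-1) ^+ 2)).
    apply: ler_sum => i ij; rewrite !mxE tE ij -ler_sqrt ?sqr_ge0//.
    by rewrite !sqrtr_sqr [leRHS]ger0_norm ?invr_ge0.
  rewrite sumr_const -[_ *+ _]mulr_natr.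
  have c4 : #|[pred i : 'I_n.+1 | (i < 4 ^ j)%N]|%:R <= 4 ^+ j :> R.
    rewrite -natrX ler_nat cardE -(size_map val) -[leqRHS](size_iota 0).
    apply: uniq_leq_size; first by rewrite map_inj_uniq ?enum_uniq//; exact: val_inj.
    move=> _ /mapP[i + ->]; rewrite mem_enum inE => ij; by rewrite mem_iota.
  apply: (@le_trans _ _ ((16 ^ j)%:R^-1 ^+ 2 * 4 ^+ j)).
    by rewrite ler_wpM2l ?sqr_ge0.
  have pw k c : 2 ^+ k = c%:R :> R -> c%:R ^+ j = (2 ^+ j) ^+ k :> R.
    by move=> <-; rewrite -!exprM mulnC.
  rewrite natrX (pw 4 16) ?(pw 2 4) ?(pw 3 8); [|by ring..].
  have : 2 ^+ j != 0 :> R by rewrite expf_neq0.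
  by move: (2 ^+ j) => a a0; rewrite le_eqVlt; apply/orP; left; apply/eqP; field.
apply: (@le_trans _ _ (\sum_(i < n.+1 | ~~ (i < 4 ^ j)%N) v i ^+ 2)).
  apply: ler_sum => i ij; rewrite !mxE tE (negbTE ij) subr0 vE.
  by rewrite -normrX ger0_norm ?sqr_ge0.
rewrite -(big_mkord (fun i => ~~ (i < 4 ^ j)%N) (fun i => v i ^+ 2)).
rewrite [leRHS](big_nat_widenl _ 0%N)//= [leRHS](big_cat_nat (n := n.+1))//=.
rewrite (eq_bigl (fun i => 4 ^ j <= i)%N); last by move=> i; rewrite -leqNgt.
by rewrite lerDl; apply: sumr_ge0 => i _; exact: sqr_ge0.
Qed.

End Sparse.

Section Chain.
Context {R : realType}.

Lemma norm2_le_norm1 n (u : 'cV[R]_n) : norm2 u <= norm1 u.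
Proof.
have n0 : 0 <= norm1 u by apply: sumr_ge0.
rewrite -ler_sqr ?nnegrE ?norm2_ge0// norm2_sqr expr2 {1}/norm1 mulr_suml.
apply: ler_sum => i _; rewrite -real_normK ?num_real// expr2.
by rewrite ler_wpM2l// /norm1 (bigD1 i)//= lerDl sumr_ge0.
Qed.

Lemma norm1Z n a (u : 'cV[R]_n) : norm1 (a *: u) = `|a| * norm1 u.
Proof. by rewrite mulr_sumr; apply: eq_bigr => i _; rewrite mxE normrM. Qed.

Lemma expR1_le4 : expR 1 <= 4 :> R.
Proof.
have h : 2^-1 <= expR (- 2^-1) :> R by have := expR_ge1Dx (- 2^-1 : R); lra.
have h2 : expR 2^-1 <= 2 :> R.
  by rewrite -[leRHS]invrK -[leLHS]invrK -expRN lef_pV2 ?posrE ?invr_gt0 ?expR_gt0.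
have -> : 1 = 2^-1 + 2^-1 :> R by field.
rewrite expRD; have := expR_gt0 (2^-1 : R); nra.
Qed.

Lemma ln_pow4 j n : (4 ^ j <= n)%N -> j%:R <= ln n.+1%:R :> R.
Proof.
move=> jn; rewrite -[leLHS]expRK ler_ln ?posrE ?expR_gt0 ?ltr0n//.
rewrite -[j%:R]mulr1 expRM_natl; apply: (@le_trans _ _ (4 ^+ j)).
  by rewrite lerXn2r ?nnegrE ?expR_ge0// expR1_le4.
by rewrite -natrX ler_nat; exact: leqW.
Qed.

(** Its square is, up to constants, the logarithm of the number of labels of level j ([card_lab])
    plus 4^j s: the deviation level that a union bound over the links of level j can afford. *)
Definition tauj n (s : R) j := 2 ^+ j * Num.sqrt (ln n.+1%:R + s + j.+1%:R).

(** The term j + 1 inside [tauj] is absorbed in two ways: the rounding error 8^-j has room to spare,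
    and a nonzero tail a occurs only for 4^j <= n, where j is at most ln (n + 1). *)
Lemma tauj_le n (s a : R) j (L := ln n.+1%:R : R) : 1 <= s ->
  0 <= a -> (a != 0 -> (4 ^ j <= n)%N) ->
  tauj n s j * ((8 ^+ j)^-1 + a) <= Num.sqrt (L + s) * (2 * (2 ^- j) + 2 * (2 ^+ j * a)).
Proof.
move=> s1 a0 aj; rewrite /tauj -/L.
have s0 : 0 <= s by lra.
have L0 : 0 <= L by rewrite ln_ge0// ler1n.
have Q0 : 0 <= Num.sqrt (L + s) by exact: sqrtr_ge0.
have p0 : 0 < 2 ^+ j :> R by rewrite exprn_gt0.
have -> : 8 ^+ j = (2 ^+ j) ^+ 3 :> R.
  by rewrite -!exprM mulnC exprM; congr (_ ^+ _); ring.
have s2 : Num.sqrt (L + s + j.+1%:R) <= Num.sqrt (L + s) * (2 * 2 ^+ j).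
  rewrite -ler_sqr ?nnegrE ?mulr_ge0 ?sqrtr_ge0// ?(ltW p0)// exprMn !sqr_sqrtr ?addr_ge0//.
  have j2 : j.+2%:R <= 2 * 2 ^+ j :> R.
    rewrite -natrX -natrM ler_nat; elim: (j) => // k IH.
    by rewrite expnS; move: IH; lia.
  move: j2; rewrite -(natr1 j.+1); set X := 2 * 2 ^+ j; set k := j.+1%:R => j2.
  have k0 : 0 <= k by rewrite ler0n.
  have h1 : 0 <= (L + s) * (X * (X - 1)) by apply: mulr_ge0; [lra|apply: mulr_ge0; lra].
  have h2 : 0 <= (L + s) * (X - (k + 1)) by apply: mulr_ge0; lra.
  have h3 : 0 <= (L + s - 1) * k by apply: mulr_ge0; lra.
  lra.
have s3 : a != 0 -> Num.sqrt (L + s + j.+1%:R) <= 2 * Num.sqrt (L + s).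
  move=> /aj/ln_pow4; rewrite -/L => jL.
  rewrite -ler_sqr ?nnegrE ?mulr_ge0 ?sqrtr_ge0// exprMn !sqr_sqrtr ?addr_ge0//.
  by rewrite -natr1; lra.
rewrite [leLHS]mulrDr [leRHS]mulrDr; apply: lerD.
  have := ler_wpM2l (ltW p0) s2 => /(fun h => @ler_wpM2r R ((2 ^+ j) ^+ 3)^-1 _ _ _ h).
  rewrite invr_ge0 exprn_ge0 ?(ltW p0)// => /(_ isT) /le_trans; apply.
  by rewrite le_eqVlt; apply/orP; left; apply/eqP; field; rewrite gt_eqF.
have [->|an] := eqVneq a 0; first by rewrite !mulr0.
have := ler_wpM2l (ltW p0) (s3 an) => /(fun h => @ler_wpM2r R a _ _ _ h) => /(_ a0).
by move=> /le_trans; apply; rewrite le_eqVlt; apply/orP; left; apply/eqP; ring.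
Qed.

(** Applied to the pairwise distances of a finite family, it gives a level where the approximation
    error separates distinct members; the chain then ends with no remainder. *)
Lemma separation_level (F : finType) (n : nat) (x : F -> R) :
  exists J, (n < 4 ^ J)%N /\ forall f, 0 < x f -> 2 * (8 ^+ J)^-1 < x f.
Proof.
pose k f := Num.truncn (2 / x f).
exists (n + \max_f k f)%N; split.
  apply: leq_ltn_trans (leq_addr (\max_f k f) _) _; exact: ltn_expl.
move=> f xf; set J := (n + _)%N.
have kJ : (k f <= J)%N by rewrite (leq_trans (leq_bigmax f)) ?leq_addl.
have J8 : J.+1%:R <= 8 ^+ J :> R by rewrite -natrX ler_nat ltn_expl.
have : 2 / x f < (k f).+1%:R by have /andP[] := truncn_itv (divr_ge0 (ler0n R 2) (ltW xf)).
rewrite ltr_pdivrMr// => h; rewrite ltr_pdivrMr ?exprn_gt0//.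
apply: lt_le_trans h _; rewrite mulrC ler_pM2l//; apply: le_trans J8.
by rewrite ler_nat.
Qed.

Lemma l1_chain n (lab : nat -> finType) (sp : forall j, lab j -> 'cV[R]_n.+1)
    (F : finType) (f0 : F) (u : F -> 'cV[R]_n.+1) (Psi : R) :
  (forall (w : 'cV[R]_n.+1) J, norm1 w <= 1 -> (n < 4 ^ J)%N ->
    exists v : nat -> R, [/\ forall i, 0 <= v i, forall i, v i.+1 <= v i,
      forall i, (n < i)%N -> v i = 0, forall K, \sum_(0 <= i < K) v i <= 1 &
      forall j, exists t : lab j, norm2 (w - sp j t) <= (8 ^+ j)^-1 + vtail v J j]) ->
  0 < Psi -> (forall f, norm1 (u f) <= Psi) ->
  exists (J : nat) (l : forall j, F -> lab j) (rep : forall j, lab j -> F),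
    (forall f, u (rep J (l J f)) = u f) /\
    forall s f, 1 <= s ->
      tauj n s 0 * norm2 (u (rep 0 (l 0 f))) + \sum_(j < J) tauj n s j
        * norm2 (u (rep j.+1 (l j.+1 f)) - u (rep j (l j f)))
      <= 60 * Psi * Num.sqrt (ln n.+1%:R + s).
Proof.
move=> spP; move=> P0 uP; pose w f := Psi^-1 *: u f.
have w1 f : norm1 (w f) <= 1.
  by rewrite norm1Z ger0_norm ?invr_ge0 ?(ltW P0)// ler_pdivrMl ?mulr1.
have [J [nJ sepJ]] := @separation_level (F * F)%type n (fun p => norm2 (w p.1 - w p.2)).
have /choice[v vP] := fun f => spP _ J (w1 f) nJ.
have v0 f := let: And5 a _ _ _ _ := vP f in a.
have vS f := let: And5 _ a _ _ _ := vP f in a.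
have vO f := let: And5 _ _ a _ _ := vP f in a.
have v1 f := let: And5 _ _ _ a _ := vP f in a.
have tex j f : exists t : lab j, norm2 (w f - sp j t) <= (8 ^+ j)^-1 + vtail (v f) J j.
  by have [_ _ _ _] := vP f; apply.
pose l j f : lab j := sval (cid (tex j f)).
have lP j f : norm2 (w f - sp j (l j f)) <= (8 ^+ j)^-1 + vtail (v f) J j.
  by rewrite /l; case: cid.
pose e j f := norm2 (w f - sp j (l j f)).
(* A label is represented by the best approximated member carrying it. The links are thus
   differences of members of the family, at most twice the approximation error away from their
   targets, while their number is still bounded by the number of pairs of labels. *)
pose rep j (t : lab j) : F :=
  if [pick f | l j f == t] is Some f1 then [arg min_(f < f1 | l j f == t) e j f]%O else f0.
have repP j f : l j (rep j (l j f)) = l j f /\ e j (rep j (l j f)) <= e j f.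
  rewrite /rep; case: pickP => [f1 f1P|/(_ f)]; last by rewrite eqxx.
  by case: arg_minP => // f2 /eqP f2P minf; split => //; exact: minf.
have dist j f : norm2 (w (rep j (l j f)) - w f) <= 2 * e j f.
  have [h1 h2] := repP j f.
  have -> : w (rep j (l j f)) - w f =
    (w (rep j (l j f)) - sp j (l j (rep j (l j f)))) - (w f - sp j (l j f)).
    by rewrite h1 opprB addrA subrK.
  by apply: le_trans (norm2B _ _) _; move: h2; rewrite /e; lra.
exists J, l, rep; split.
  move=> f; suff : w (rep J (l J f)) = w f.
    by move/(congr1 (fun x => Psi *: x)); rewrite !scalerA divff ?scale1r// gt_eqF.
  apply/eqP; rewrite -subr_eq0; apply/eqP/norm2_eq0/eqP; apply: contraT => ne.
  have : 0 < norm2 (w (rep J (l J f)) - w f) by rewrite lt_neqAle eq_sym ne norm2_ge0.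
  move=> /(sepJ (rep J (l J f), f)) /=.
  rewrite ltNge; apply: contraNT => _; apply: le_trans (dist J f) _.
  have := lP J f; rewrite /e /vtail big_geq// sqrtr0 addr0.
  by move=> h; rewrite ler_wpM2l.
move=> s f s1; pose p j := rep j (l j f); rewrite -!/(p _).
under eq_bigr do rewrite -!/(p _).
set Q := Num.sqrt (ln n.+1%:R + s).
have Q0 : 0 <= Q by exact: sqrtr_ge0.
have uw g h : norm2 (u g - u h) = Psi * norm2 (w g - w h).
  rewrite -scalerBr norm2Z ger0_norm ?invr_ge0 ?ltW// mulrA divff ?mul1r//.
  by rewrite gt_eqF.
have uw0 g : norm2 (u g) = Psi * norm2 (w g).
  rewrite norm2Z ger0_norm ?invr_ge0 ?ltW// mulrA divff ?mul1r//.
  by rewrite gt_eqF.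
have t0 j : 0 <= tauj n s j by rewrite mulr_ge0 ?sqrtr_ge0 ?exprn_ge0.
have vt0 j : 0 <= vtail (v f) J j by exact: sqrtr_ge0.
have vt4 j k : (j <= k)%N -> vtail (v f) J k != 0 -> (4 ^ j <= n)%N.
  move=> jk; apply: contraNT; rewrite -ltnNge => nj.
  rewrite /vtail big1_seq ?sqrtr0// => i /andP[_]; rewrite mem_index_iota => /andP[ki _].
  rewrite vO ?expr0n//; apply: leq_trans nj _; apply: leq_trans ki.
  by rewrite leq_pexp2l.
have step j : (j < J)%N -> tauj n s j * norm2 (w (p j.+1) - w (p j)) <=
   Q * (8 * 2 ^- j + 4 * (2 ^+ j * vtail (v f) J j) + 2 * (2 ^+ j.+1 * vtail (v f) J j.+1)).
  move=> jJ.
  have b1 := tauj_le s1 (vt0 j) (vt4 _ _ (leqnn j)).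
  have b2 := tauj_le s1 (vt0 j.+1) (vt4 _ _ (leqnSn j)).
  have d1 : norm2 (w (p j.+1) - w (p j)) <= 2 * e j.+1 f + 2 * e j f.
    have -> : w (p j.+1) - w (p j) = (w (p j.+1) - w f) - (w (p j) - w f).
      by rewrite opprB addrA subrK.
    by apply: le_trans (norm2B _ _) _; apply: lerD; exact: dist.
  have d2 : norm2 (w (p j.+1) - w (p j)) <=
     2 * ((8 ^+ j)^-1 + vtail (v f) J j.+1) + 2 * ((8 ^+ j)^-1 + vtail (v f) J j).
    apply: le_trans d1 _; apply: lerD; rewrite ler_wpM2l//; last exact: lP.
    apply: le_trans (lP _ _) _; rewrite lerD2r lef_pV2 ?posrE ?exprn_gt0//.
    by rewrite ler_weXn2l// ler1n.
  apply: le_trans (ler_wpM2l (t0 j) d2) _.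
  have b2' : tauj n s j * ((8 ^+ j)^-1 + vtail (v f) J j.+1) <=
      Q * (2 * 2 ^- j + 2 * (2 ^+ j * vtail (v f) J j.+1)).
    by apply: tauj_le s1 (vt0 j.+1) (vt4 _ _ (leqnSn j)).
  by move: b1 b2'; rewrite -/Q exprS; lra.
have start : tauj n s 0 * norm2 (w (p 0)) <= 2 * Q.
  have w21 g : norm2 (w g) <= 1 by apply: le_trans (norm2_le_norm1 _) (w1 _).
  have L0 : 0 <= ln n.+1%:R :> R by rewrite ln_ge0// ler1n.
  apply: (@le_trans _ _ (tauj n s 0 * 1)); first by rewrite ler_wpM2l.
  rewrite mulr1 /tauj expr0 mul1r.
  rewrite -ler_sqr ?nnegrE ?sqrtr_ge0 ?mulr_ge0// exprMn !sqr_sqrtr; lra.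
have geo K : \sum_(j < K) (2 : R) ^- j <= 2 - 2 * 2 ^- K.
  elim: K => [|K IH]; first by rewrite big_ord0 expr0 invr1; lra.
  rewrite big_ord_recr /=; apply: le_trans (lerD IH (lexx _)) _.
  rewrite exprS invfM; have : 0 < 2 ^- K :> R by rewrite invr_gt0 exprn_gt0.
  lra.
rewrite uw0; under eq_bigr do rewrite uw mulrCA.
rewrite mulrCA -mulr_sumr -mulrDr -mulrA [leRHS]mulrCA ler_pM2l//.
apply: (@le_trans _ _ (2 * Q + \sum_(j < J) Q * (8 * 2 ^- j
  + 4 * (2 ^+ j * vtail (v f) J j) + 2 * (2 ^+ j.+1 * vtail (v f) J j.+1)))).
  by apply: lerD => //; apply: ler_sum => j _; exact: step.
rewrite -mulr_sumr 2!big_split /= -3!mulr_sumr.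
have T1 := vtail_sum (v0 f) (vS f) J.
have T2 : \sum_(j < J) 2 ^+ j.+1 * vtail (v f) J j.+1 <= \sum_(j < J) 2 ^+ j * vtail (v f) J j.
  case: (J) => [|K]; first by rewrite !big_ord0.
  rewrite big_ord_recr /= [X in _ + X](_ : _ = 0); last first.
    by rewrite /vtail big_geq// sqrtr0 mulr0.
  by rewrite addr0 [leRHS]big_ord_recl ler_wpDl// mulr_ge0 ?exprn_ge0 ?sqrtr_ge0.
have := v1 f (4 ^ J).+1; have G := geo J.
have : 0 < 2 ^- J :> R by rewrite invr_gt0 exprn_gt0.
move: T1 T2 G; set A := \sum_(j < J) _; set B := \sum_(j < J) _; set C := \sum_(j < J) _.
move: (\sum_(0 <= i < _) _) => S T1 T2 G J0 S1.
have : 0 <= Q * (58 - (8 * C + 4 * A + 2 * B)) by rewrite mulr_ge0//; lra.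
lra.
Qed.

End Chain.

Lemma integral_prob_cst d (T : measurableType d) (R : realType)
    (P : probability T R) (c : \bar R) : (\int[P]_x c = c)%E.
Proof. by rewrite integral_cst//= probability_setT mule1. Qed.

(** * Union bounds for decoupled bilinear forms *)

Section Decoupled.
Context {R : realType}.

Lemma card_lab n j :
  #|lab n j|%:R <= expR (4 ^+ j * (ln n.+1%:R + 4 * j.+1%:R)) :> R.
Proof.
rewrite card_ffun card_prod !card_ord natrX natrM.
have -> : 4 ^+ j = (4 ^ j)%:R :> R by rewrite natrX.
rewrite expRM_natl lerXn2r ?nnegrE ?mulr_ge0 ?expR_ge0//.
rewrite expRD lnK ?posrE ?ltr0n// ler_wpM2l//.
have e16 : 16 <= expR 4 :> R.
  have e2 : 2 <= expR 1 :> R by have := expR_ge1Dx (1 : R); lra.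
  have -> : 4 = 4%:R * 1 :> R by ring.
  rewrite expRM_natl; apply: (@le_trans _ _ (2 ^+ 4)); first by lra.
  by rewrite lerXn2r ?nnegrE ?expR_ge0.
apply: (@le_trans _ _ (16 ^+ j.+1)); last first.
  rewrite [4 * _]mulrC expRM_natl lerXn2r ?nnegrE ?expR_ge0//.
rewrite -natrX ler_nat expnS.
have : (0 < 16 ^ j)%N by rewrite expn_gt0.
lia.
Qed.

Definition gauss2 N : probability (N.-tuple R * N.-tuple R)%type R :=
  (gaussian N \x gaussian N)%E.

Lemma gauss2E N (S : set (N.-tuple R * N.-tuple R)) : measurable S ->
  gauss2 N S = (\int[gaussian N]_x \int[gaussian N]_y (\1_S (x, y))%:E)%E.
Proof.
move=> mS; rewrite -[in LHS](setIT S) -integral_indic//.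
by rewrite (fubini_tonelli1 (fun z => (\1_S z)%:E))//; exact/measurable_EFinP.
Qed.

Lemma measurable_section1 N (S : set (N.-tuple R * N.-tuple R)) x : measurable S ->
  measurable [set y | S (x, y)].
Proof.
move=> mS; rewrite -[X in measurable X]setTI.
by apply: (measurable_fun_pair (f := fun _ => x) (g := id)).
Qed.

Lemma gauss2_section N (S : set (N.-tuple R * N.-tuple R)) : measurable S ->
  gauss2 N S = (\int[gaussian N]_x gaussian N [set y | S (x, y)])%E.
Proof.
move=> mS; rewrite gauss2E//; apply: eq_integral => x _.
rewrite -[in RHS](setIT [set y | S (x, y)]) -integral_indic//; last exact: measurable_section1.
Qed.

Lemma gauss2_rotation N (S : set (N.-tuple R * N.-tuple R)) : measurable S ->
  measurable [set z | S (rotp z.1 z.2, rotm z.1 z.2)] /\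
  gauss2 N [set z | S (rotp z.1 z.2, rotm z.1 z.2)] = gauss2 N S.
Proof.
move=> mS.
have mrot : measurable_fun setT (fun p : N.-tuple R * N.-tuple R => (rotp p.1 p.2, rotm p.1 p.2)).
  apply: measurable_fun_pair.
    exact: (measurable_rotp measurable_fst measurable_snd).
  exact: (measurable_rotm measurable_fst measurable_snd).
have mS' : measurable [set z | S (rotp z.1 z.2, rotm z.1 z.2)].
  by rewrite -[X in measurable X]setTI; exact: mrot.
split; first exact: mS'.
rewrite (gauss2E mS') (gauss2E mS).
rewrite -(@gaussian_rotation R N (fun p => (\1_S p)%:E))//; last exact/measurable_EFinP.
Qed.

(** Given one copy, the form is linear in the other, with standard deviation equal to the random
    norm in the event; Tonelli does the rest. The second event is the first with the copies
    exchanged. *)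
Lemma decoupled_tail N (C : 'M[R]_N) (tau : R) : 0 <= tau ->
  let S := [set z : N.-tuple R * N.-tuple R |
     (tau * norm2 (C *m tv z.1) < `|dot (tv z.2) (C *m tv z.1)|)] in
  let S' := [set z : N.-tuple R * N.-tuple R |
     (tau * norm2 (C *m tv z.2) < `|dot (tv z.1) (C *m tv z.2)|)] in
  [/\ measurable S, measurable S',
    (gauss2 N S <= (2 * expR (- (tau ^+ 2 / 2)))%:E)%E &
    (gauss2 N S' <= (2 * expR (- (tau ^+ 2 / 2)))%:E)%E].
Proof.
move=> tau0 S S'.
have mt (i : 'I_N) (g : N.-tuple R * N.-tuple R -> N.-tuple R) : measurable_fun setT g ->
    measurable_fun setT (fun z => tv (g z) i 0).
  by move=> mg; apply: (measurableT_comp (measurable_tv i) mg).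
have mC (i : 'I_N) (g : N.-tuple R * N.-tuple R -> N.-tuple R) : measurable_fun setT g ->
    measurable_fun setT (fun z => (C *m tv (g z)) i 0).
  by move=> mg; apply: (measurableT_comp (measurable_mulmx_tv C i) mg).
have mset (g h : N.-tuple R * N.-tuple R -> N.-tuple R) :
    measurable_fun setT g -> measurable_fun setT h ->
    measurable [set z | (tau * norm2 (C *m tv (g z)) < `|dot (tv (h z)) (C *m tv (g z))|)].
  move=> mg mh; apply: measurable_setb; apply: measurable_fun_ltr.
    apply: measurable_funM => //; apply: measurableT_comp => //.
      by apply: continuous_measurable_fun; exact: sqrt_continuous.
    by apply: measurable_sum => i; apply: measurable_funX; exact: mC.
  apply: measurableT_comp => //; apply: measurable_sum => i.
  by apply: measurable_funM; [exact: mt|exact: mC].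
have mS : measurable S by apply: mset.
have mS' : measurable S' by apply: mset.
have bnd x : (gaussian N [set y | S (x, y)] <= (2 * expR (- (tau ^+ 2 / 2)))%:E)%E.
  rewrite /S /=; under eq_set do rewrite dotC.
  exact: gaussian_linear_tail.
have g1 : (gauss2 N S <= (2 * expR (- (tau ^+ 2 / 2)))%:E)%E.
  rewrite gauss2_section//.
  apply: (@le_trans _ _ (\int[gaussian N]_x (2 * expR (- (tau ^+ 2 / 2)))%:E)%E).
    apply: ge0_le_integral => //.
    have -> : (fun x => gaussian N [set y | S (x, y)]) = gaussian N \o xsection S.
      apply/funext => x; congr (gaussian N _).
      by apply/seteqP; split => y; rewrite /xsection /= inE.
    exact: measurable_fun_xsection.
  by rewrite integral_prob_cst.
split; [exact: mS|exact: mS'|exact: g1|].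
suff -> : gauss2 N S' = gauss2 N S by exact: g1.
rewrite (gauss2E mS') (gauss2E mS).
rewrite (@swap_int _ _ _ _ _ (gaussian N) (gaussian N) (fun x y => (\1_S' (x, y))%:E))//.
apply/measurable_EFinP; have -> : (fun p : N.-tuple R * N.-tuple R => \1_S' (p.1, p.2)) = \1_S' :> (_ -> R).
  by apply/funext => -[].
exact: measurable_indic.
Qed.

End Decoupled.

Lemma union_bound d (T : measurableType d) (R : realType) (P : probability T R)
    (I : finType) (F : I -> set T) (c : I -> R) :
  (forall i, measurable (F i)) -> (forall i, (P (F i) <= (c i)%:E)%E) ->
  measurable [set x | exists i, F i x] /\
  (P [set x | exists i, F i x] <= (\sum_i c i)%:E)%E.
Proof.
move=> mF PF.
have -> : [set x | exists i, F i x] = \big[setU/set0]_(i <- index_enum I) F i.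
  rewrite -bigcup_seq; apply/seteqP; split => x /=.
    by move=> [i Fi]; exists i => //=; rewrite mem_index_enum.
  by move=> [i _ Fi]; exists i.
elim: (index_enum I) => [|i r [mr IH]].
  by rewrite !big_nil measure0; split.
rewrite !big_cons; split; first exact: measurableU.
rewrite EFinD; apply: le_trans (measureU2 _ (mF i) mr) _; exact: (leeD (PF i) IH).
Qed.

Section ChainEvent.
Context {R : realType}.

Lemma expR_nat_ge k : 2 ^+ k <= expR k%:R :> R.
Proof.
rewrite -[k%:R]mulr1 expRM_natl lerXn2r ?nnegrE ?expR_ge0//.
by have := expR_ge1Dx (1 : R); lra.
Qed.

Lemma dot_trmul p q k (D : 'M[R]_(p, q)) (B : 'M[R]_(p, k)) x y :
  dot x ((D^T *m B) *m y) = dot (D *m x) (B *m y).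
Proof. by rewrite -mulmxA dot_mulmx trmxK. Qed.

Lemma sum_cst_card (I : finType) (x : R) : \sum_(i : I) x = #|I|%:R * x.
Proof. by rewrite sumr_const mulr_natl. Qed.

(** With L = ln (n + 1), the pairs of labels have log-cardinality at most 4^j (5 L + 20 (j + 1) +
    16). The factor 9 makes the exponent 40.5 * 4^j (L + s + j + 1), leaving exp(-s) and a geometric
    factor summable over j. *)
Lemma chain_level_bound n j (s : R) : 1 <= s ->
  #|lab n j|%:R * #|lab n j.+1|%:R * (4 * expR (- ((9 * tauj n s j) ^+ 2 / 2)))
  <= expR (- s) * (16^-1 * 2 ^- j.+1).
Proof.
move=> s1; set L := ln n.+1%:R : R.
have L0 : 0 <= L by rewrite ln_ge0// ler1n.
have e0 := @expR_ge0 R.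
apply: (@le_trans _ _ (expR (4 ^+ j * (L + 4 * j.+1%:R)) * expR (4 ^+ j.+1 * (L + 4 * j.+2%:R))
  * (4 * expR (- ((9 * tauj n s j) ^+ 2 / 2))))).
  rewrite ler_wpM2r ?mulr_ge0//; apply: ler_pM => //; exact: card_lab.
have -> : (9 * tauj n s j) ^+ 2 / 2 = 81 / 2 * (4 ^+ j * (L + s + j.+1%:R)).
  rewrite /tauj -/L !exprMn sqr_sqrtr; last by rewrite !addr_ge0//; lra.
  have -> : 4 ^+ j = (2 ^+ j) ^+ 2 :> R by rewrite -exprM mulnC exprM; congr (_ ^+ _); ring.
  by field.
rewrite mulrCA -!expRD.
have p1 : 1 <= 4 ^+ j :> R by rewrite exprn_ege1//; lra.
apply: (@le_trans _ _ (4 * expR (- s + - (j.+1 + 6)%:R))).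
  rewrite ler_wpM2l// ler_expR exprS -(natr1 j.+1) natrD; set k := j.+1%:R.
  have k1 : 1 <= k by rewrite ler1n.
  set p := 4 ^+ j in p1 *.
  have : 0 <= (p - 1) * (k + s + 6) by rewrite mulr_ge0//; lra.
  have : 0 <= p * L by rewrite mulr_ge0//; lra.
  have : 0 <= p * (k - 1) by rewrite mulr_ge0//; lra.
  have : 0 <= p * (s - 1) by rewrite mulr_ge0//; lra.
  lra.
rewrite expRD mulrCA ler_wpM2l// expRN.
have := expR_nat_ge (j.+1 + 6).
rewrite -(@lef_pV2 _ _ (2 ^+ _)) ?posrE ?exprn_gt0 ?expR_gt0// => h.
apply: (@le_trans _ _ (4 * (2 ^+ (j.+1 + 6))^-1)); first by rewrite ler_wpM2l.
rewrite exprD le_eqVlt; apply/orP; left; apply/eqP.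
have : 2 ^+ j.+1 != 0 :> R by rewrite expf_neq0.
by move: (2 ^+ j.+1) => a a0; field.
Qed.

Lemma chain_start_bound n (s : R) : 1 <= s ->
  #|lab n 0|%:R * (2 * expR (- ((9 * tauj n s 0) ^+ 2 / 2))) <= expR (- s) * 8^-1.
Proof.
move=> s1; set L := ln n.+1%:R : R.
have L0 : 0 <= L by rewrite ln_ge0// ler1n.
have e0 := @expR_ge0 R.
apply: (@le_trans _ _ (expR (4 ^+ 0 * (L + 4 * 1%:R)) * (2 * expR (- ((9 * tauj n s 0) ^+ 2 / 2))))).
  by rewrite ler_wpM2r ?mulr_ge0//; exact: card_lab.
have -> : (9 * tauj n s 0) ^+ 2 / 2 = 81 / 2 * (L + s + 1%:R).
  rewrite /tauj -/L expr0 mul1r !exprMn sqr_sqrtr; last by rewrite !addr_ge0//; lra.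
  by field.
rewrite mulrCA -expRD; apply: (@le_trans _ _ (2 * expR (- s + - 4%:R))).
  by rewrite ler_wpM2l// ler_expR expr0; lra.
rewrite expRD mulrCA ler_wpM2l// expRN.
have := expR_nat_ge 4; rewrite -(@lef_pV2 _ _ (2 ^+ _)) ?posrE ?exprn_gt0 ?expR_gt0//; lra.
Qed.

Variables (N q n : nat) (F : finType) (f0 : F) (A : F -> 'M[R]_(q, N)).
Variables (u : F -> 'cV[R]_n.+1) (b Psi : R).
Hypotheses (b0 : 0 <= b) (Psi0 : 0 < Psi) (uPsi : forall f, norm1 (u f) <= Psi).
Hypothesis Ab : forall f y, norm2 ((A f)^T *m y) <= b * norm2 (u f) * norm2 y.
Hypothesis AbB : forall f g y,
  norm2 ((A f - A g)^T *m y) <= b * norm2 (u f - u g) * norm2 y.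

(** Along a link from A to A', the form changes by <(A' - A) p, A' q> + <A p, (A' - A) q>, and each
    term is decoupled with conditional deviation at most b |u' - u| r. The radius r is quantified
    after S because it will depend on the sample. The constant is 1080 = 2 * 9 * 60: two terms, the
    factor 9 and the chain length. *)
Lemma chain_event (s : R) : 1 <= s ->
  exists S : set (N.-tuple R * N.-tuple R),
  [/\ measurable S, (gauss2 N S <= (expR (- s) / 4)%:E)%E &
    forall z r, ~ S z ->
      (forall f, norm2 (A f *m tv z.1) <= r /\ norm2 (A f *m tv z.2) <= r) ->
      forall f, `|dot (A f *m tv z.1) (A f *m tv z.2)|
        <= 1080 * b * Psi * Num.sqrt (ln n.+1%:R + s) * r].
Proof.
move=> s1.
have [J [l [rep [repJ chain]]]] := @l1_chain R n (lab n) (@spvec R n) F f0 u Psi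
  (@sparse_approx R n) Psi0 uPsi.
pose Sq C (tau : R) := [set z : N.-tuple R * N.-tuple R |
     (tau * norm2 (C *m tv z.2) < `|dot (tv z.1) (C *m tv z.2)|)].
pose Sp C (tau : R) := [set z : N.-tuple R * N.-tuple R |
     (tau * norm2 (C *m tv z.1) < `|dot (tv z.2) (C *m tv z.1)|)].
pose tau j := 9 * tauj n s j.
have tau0 j : 0 <= tau j by rewrite !mulr_ge0 ?sqrtr_ge0 ?exprn_ge0.
pose S0 (t : lab n 0) := Sq ((A (rep 0 t))^T *m A (rep 0 t)) (tau 0).
pose SJ (j : 'I_J) (t : lab n j * lab n j.+1) :=
  Sq ((A (rep j.+1 t.2) - A (rep j t.1))^T *m A (rep j.+1 t.2)) (tau j) `|`
  Sp ((A (rep j.+1 t.2) - A (rep j t.1))^T *m A (rep j t.1)) (tau j).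
have [m0 P0] := @union_bound _ _ _ (gauss2 N) _ S0
   (fun _ => 2 * expR (- (tau 0 ^+ 2 / 2)))
   (fun t => let: And4 _ a _ _ := decoupled_tail _ (tau0 0) in a)
   (fun t => let: And4 _ _ _ a := decoupled_tail _ (tau0 0) in a).
have mPj (j : 'I_J) (t : lab n j * lab n j.+1) : measurable (SJ j t) /\
   (gauss2 N (SJ j t) <= (4 * expR (- (tau j ^+ 2 / 2)))%:E)%E.
  have [_ m1 _ p1] := decoupled_tail ((A (rep j.+1 t.2) - A (rep j t.1))^T *m A (rep j.+1 t.2)) (tau0 j).
  have [m2 _ p2 _] := decoupled_tail ((A (rep j.+1 t.2) - A (rep j t.1))^T *m A (rep j t.1)) (tau0 j).
  split; first exact: measurableU.
  have -> : 4 * expR (- (tau j ^+ 2 / 2)) = 2 * expR (- (tau j ^+ 2 / 2)) + 2 * expR (- (tau j ^+ 2 / 2)) by ring.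
  rewrite EFinD; apply: le_trans (measureU2 _ m1 m2) _; exact: (leeD p1 p2).
have mPJ (j : 'I_J) : measurable [set z | exists t, SJ j t z] /\
   (gauss2 N [set z | exists t, SJ j t z] <= (expR (- s) * (16^-1 * 2 ^- j.+1))%:E)%E.
  have [mj pj] := @union_bound _ _ _ (gauss2 N) _ (SJ j)
    (fun _ => 4 * expR (- (tau j ^+ 2 / 2))) (fun t => proj1 (mPj j t)) (fun t => proj2 (mPj j t)).
  split => //; apply: le_trans pj _; rewrite lee_fin sum_cst_card card_prod natrM.
  exact: chain_level_bound.
have [mA PA] := @union_bound _ _ _ (gauss2 N) _ (fun j : 'I_J => [set z | exists t, SJ j t z])
   (fun j => expR (- s) * (16^-1 * 2 ^- j.+1)) (fun j => proj1 (mPJ j)) (fun j => proj2 (mPJ j)).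
exists ([set z | exists t, S0 t z] `|` [set z | exists j : 'I_J, exists t, SJ j t z]).
split; first exact: measurableU.
  apply: le_trans (measureU2 _ m0 mA) _; apply: le_trans (leeD P0 PA) _.
  rewrite -EFinD lee_fin sum_cst_card.
  apply: (@le_trans _ _ (expR (- s) * 8^-1 + expR (- s) * 16^-1)); last first.
    by have := expR_ge0 (- s); lra.
  apply: lerD; first exact: chain_start_bound.
  rewrite -mulr_sumr ler_wpM2l ?expR_ge0// -mulr_sumr -[leRHS]mulr1 ler_wpM2l//.
  have geo K : \sum_(j < K) (2 : R) ^- j.+1 <= 1 - 2 ^- K.
    elim: K => [|K IH]; first by rewrite big_ord0 expr0 invr1 subrr.
    rewrite big_ord_recr /=; apply: le_trans (lerD IH (lexx _)) _.
    rewrite exprS invfM; have : 0 < 2 ^- K :> R by rewrite invr_gt0 exprn_gt0.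
    lra.
  apply: le_trans (geo J) _.
  by rewrite gerBl invr_ge0 exprn_ge0.
move=> z r /not_orP[nS0 nSJ] rA f.
have r0 : 0 <= r by apply: le_trans (rA f0).1; exact: norm2_ge0.
pose p j := rep j (l j f).
have start : `|dot (A (p 0) *m tv z.1) (A (p 0) *m tv z.2)|
    <= tau 0 * (b * norm2 (u (p 0)) * r).
  rewrite dotC dot_mulmx dotC mulmxA.
  have : ~ S0 (l 0 f) z by move=> h; apply: nS0; exists (l 0 f).
  move=> /negP; rewrite -leNgt => h; apply: le_trans h _.
  rewrite ler_wpM2l// -mulmxA; apply: le_trans (Ab _ _) _.
  by rewrite ler_wpM2l ?mulr_ge0 ?norm2_ge0//; have [] := rA (p 0).
have step j : (j < J)%N ->
    `|dot (A (p j.+1) *m tv z.1) (A (p j.+1) *m tv z.2)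
      - dot (A (p j) *m tv z.1) (A (p j) *m tv z.2)|
    <= 2 * (tau j * (b * norm2 (u (p j.+1) - u (p j)) * r)).
  move=> jJ; have nS : ~ SJ (Ordinal jJ) (l j f, l j.+1 f) z.
    by move=> h; apply: nSJ; exists (Ordinal jJ), (l j f, l j.+1 f).
  move: nS => /not_orP[/negP + /negP]; rewrite -!leNgt /= -!/(p _) => h1 h2.
  have -> : dot (A (p j.+1) *m tv z.1) (A (p j.+1) *m tv z.2)
      - dot (A (p j) *m tv z.1) (A (p j) *m tv z.2) =
    dot (tv z.1) (((A (p j.+1) - A (p j))^T *m A (p j.+1)) *m tv z.2) +
    dot (tv z.2) (((A (p j.+1) - A (p j))^T *m A (p j)) *m tv z.1).
    rewrite !dot_trmul !mulmxBl !dotBl.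
    by rewrite !(dotC (_ *m tv z.2)); ring.
  apply: le_trans (ler_normD _ _) _; rewrite mulr_natl mulr2n; apply: lerD.
    apply: le_trans h1 _; rewrite ler_wpM2l// -mulmxA; apply: le_trans (AbB _ _ _) _.
    by rewrite ler_wpM2l ?mulr_ge0 ?norm2_ge0//; have [] := rA (p j.+1).
  apply: le_trans h2 _; rewrite ler_wpM2l// -mulmxA; apply: le_trans (AbB _ _ _) _.
  by rewrite ler_wpM2l ?mulr_ge0 ?norm2_ge0//; have [] := rA (p j).
have tele K : (K <= J)%N -> `|dot (A (p K) *m tv z.1) (A (p K) *m tv z.2)| <=
   tau 0 * (b * norm2 (u (p 0)) * r) +
   \sum_(j < K) 2 * (tau j * (b * norm2 (u (p j.+1) - u (p j)) * r)).
  elim: K => [|K IH] KJ; first by rewrite big_ord0 addr0.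
  rewrite big_ord_recr /= addrA.
  rewrite -[X in `|X|](subrK (dot (A (p K) *m tv z.1) (A (p K) *m tv z.2))).
  apply: le_trans (ler_normD _ _) _; rewrite [leRHS]addrC; apply: lerD; first exact: step.
  by apply: IH; exact: ltnW.
(* The last representative has the same vector as f; the Lipschitz hypothesis [AbB] turns this into
   equality of the matrices. *)
have Af : A (p J) = A f.
  apply/eqP; rewrite -subr_eq0; apply/eqP/trmx_inj; rewrite trmx0.
  apply/matrixP => i j; rewrite [RHS]mxE.
  have : norm2 ((A (p J) - A f)^T *m delta_mx j 0) = 0.
    apply/eqP; rewrite eq_le norm2_ge0 andbT; apply: le_trans (AbB _ _ _) _.
    by rewrite (repJ f) subrr norm2_0 mulr0 mul0r.
  move=> /norm2_eq0; rewrite -colE => /colP/(_ i); rewrite !mxE//.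
have := tele J (leqnn J); rewrite Af => h; apply: le_trans h _.
have := chain s f s1; rewrite -!/(p _) => ch.
apply: (@le_trans _ _ (18 * b * r * (tauj n s 0 * norm2 (u (p 0)) +
   \sum_(j < J) tauj n s j * norm2 (u (p j.+1) - u (p j))))).
  rewrite mulrDr; apply: lerD.
    rewrite /tau; have : 0 <= b * r * (tauj n s 0 * norm2 (u (p 0))).
      by rewrite !mulr_ge0 ?norm2_ge0 ?sqrtr_ge0.
    by lra.
  rewrite mulr_sumr; apply: ler_sum => j _; rewrite /tau.
  by rewrite le_eqVlt; apply/orP; left; apply/eqP; ring.
apply: le_trans (ler_wpM2l _ ch) _; first by rewrite !mulr_ge0.
by rewrite le_eqVlt; apply/orP; left; apply/eqP; ring.
Qed.

End ChainEvent.

Lemma sqn_rotp (R : realType) q N (A : 'M[R]_(q, N)) (x y : N.-tuple R) :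
  sqn (A *m tv (rotp x y)) <= sqn (A *m tv x) + sqn (A *m tv y).
Proof.
have -> : tv (rotp x y) = (Num.sqrt 2)^-1 *: (tv x + tv y).
  by apply/colP => i; rewrite !mxE tnth_mktuple mulrC.
rewrite -scalemxAr mulmxDr sqnZ exprVn sqr_sqrtr// sqnD.
have := sqn_ge0 (A *m tv x - A *m tv y); rewrite sqnB; lra.
Qed.

Lemma sqn_rotm (R : realType) q N (A : 'M[R]_(q, N)) (x y : N.-tuple R) :
  sqn (A *m tv (rotm x y)) <= sqn (A *m tv x) + sqn (A *m tv y).
Proof.
have -> : tv (rotm x y) = (Num.sqrt 2)^-1 *: (tv x - tv y).
  by apply/colP => i; rewrite !mxE tnth_mktuple mulrC.
rewrite -scalemxAr mulmxBr sqnZ exprVn sqr_sqrtr// sqnB.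
have := sqn_ge0 (A *m tv x + A *m tv y); rewrite sqnD; lra.
Qed.

(** The polarisation identity behind the symmetrisation: a difference of two copies of the chaos is
    exactly a decoupled form in the rotated pair, which has the law of two independent copies. *)
Lemma dot_rot (R : realType) q N (A : 'M[R]_(q, N)) (x y : N.-tuple R) :
  2 * dot (A *m tv (rotp x y)) (A *m tv (rotm x y)) = sqn (A *m tv x) - sqn (A *m tv y).
Proof.
have -> : tv (rotp x y) = (Num.sqrt 2)^-1 *: (tv x + tv y).
  by apply/colP => i; rewrite !mxE tnth_mktuple mulrC.
have -> : tv (rotm x y) = (Num.sqrt 2)^-1 *: (tv x - tv y).
  by apply/colP => i; rewrite !mxE tnth_mktuple mulrC.
rewrite -!scalemxAr dotZl dotZr mulmxDr mulmxBr !mulrA -!dotvv.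
rewrite -[2 * _ * _]mulrA -invfM -expr2 sqr_sqrtr// divff// mul1r.
by rewrite dotDl !dotBr (dotC (A *m tv y)); ring.
Qed.

Lemma fro2_mulmx_op (R : realType) p q k (C : 'M[R]_(p, q)) (B : 'M[R]_(q, k)) (c : R) :
  0 <= c -> (forall y, norm2 (C *m y) <= c * norm2 y) -> fro2 (C *m B) <= c ^+ 2 * fro2 B.
Proof.
move=> c0 Cc; rewrite -fro2_tr -(fro2_tr B) !sqn_row mulr_sumr; apply: ler_sum => i _.
have -> : (row i (C *m B)^T)^T = C *m (row i B^T)^T.
  by rewrite trmx_mul row_mul trmx_mul trmxK.
by rewrite -!norm2_sqr -exprMn ler_sqr ?nnegrE ?mulr_ge0 ?norm2_ge0.
Qed.

(** Here a is the supremum at x, M a bound at the copy, and r a bound on the norms of the rotated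
    pair. The hypotheses give 2 k r <= a / 2 and 64 w <= a / 4, so a is not reached. *)
Lemma chaos_step_arith (R : realType) (k V t a M w r : R) :
  0 <= k -> 0 <= r -> 0 < t -> t <= V -> 10 * (k * Num.sqrt V) <= t -> t <= a -> M <= 2 * a ->
  0 <= M -> r ^+ 2 = 2 * V + a + M -> 16 * (16 * w) <= t ->
  16 * 4 * w + 2 * (k * r) < a.
Proof.
move=> k0 r0 t0 tV kt ta Ma M0 r2 wt.
have V0 : 0 <= V by exact: le_trans (ltW t0) tV.
have k2V : (10 * k) ^+ 2 * V <= t ^+ 2.
  rewrite -[X in _ * X](sqr_sqrtr V0) -exprMn ler_sqr ?nnegrE ?mulr_ge0 ?sqrtr_ge0// -?mulrA//; exact: ltW.
have k2 : (10 * k) ^+ 2 <= t.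
  have Vp : 0 < V by exact: lt_le_trans t0 tV.
  rewrite -(ler_pM2r Vp); apply: le_trans k2V _.
  by rewrite expr2 ler_pM2l.
have a0 : 0 < a by exact: lt_le_trans ta.
have kr2 : (10 * k * r) ^+ 2 <= (5 / 2 * a) ^+ 2.
  rewrite exprMn r2.
  have h3 : (10 * k) ^+ 2 * (a + M) <= t * (3 * a).
    apply: ler_pM => //; [exact: sqr_ge0|by rewrite addr_ge0// ltW|lra].
  have h4 : t * a <= a * a by rewrite ler_wpM2r// ltW.
  have h5 : t ^+ 2 <= a * a by rewrite expr2; apply: ler_pM => //; exact: ltW.
  have e2 : (5 / 2 * a) ^+ 2 = 25 / 4 * (a * a) by field.
  rewrite -addrA mulrDr mulrCA e2; move: k2V h3 h4 h5; set X := (10 * k) ^+ 2; set Y := t ^+ 2; have : 0 <= a * a by rewrite mulr_ge0 ?ltW//.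
  lra.
have kr : 10 * k * r <= 5 / 2 * a.
  by rewrite -ler_sqr ?nnegrE ?mulr_ge0//; exact: ltW.
have : 16 * 16 * w <= a by rewrite -mulrA; exact: le_trans ta.
clear -kr a0; move: kr; rewrite -mulrA; move: (k * r) => x; lra.
Qed.

Definition chain_const (R : realType) n (b Psi s : R) : R :=
  1080 * b * Psi * Num.sqrt (ln n.+1%:R + s).

(** * The supremum of a chaos over a finite family *)

Section ChaosSup.
Context {R : realType}.
Variables (N q n : nat) (F : finType) (f0 : F) (A : F -> 'M[R]_(q, N)).
Variables (u : F -> 'cV[R]_n.+1) (b beta V Psi : R).
Hypotheses (b0 : 0 <= b) (Psi0 : 0 < Psi) (uPsi : forall f, norm1 (u f) <= Psi).
Hypothesis Ab : forall f y, norm2 ((A f)^T *m y) <= b * norm2 (u f) * norm2 y.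
Hypothesis AbB : forall f g y,
  norm2 ((A f - A g)^T *m y) <= b * norm2 (u f - u g) * norm2 y.
Hypotheses (beta0 : 0 <= beta)
  (Abeta : forall f y, norm2 ((A f)^T *m y) <= beta * norm2 y).
Hypothesis AV : forall f, fro2 (A f) <= V.

Let Z f x := sqn (A f *m tv x) - fro2 (A f).

Lemma measurable_chaosZ f : measurable_fun [set: N.-tuple R] (Z f).
Proof.
apply: measurable_funB => //; apply: measurable_sqn => i; exact: measurable_mulmx_tv.
Qed.

Let mZ f (y : R) : measurable [set x | y < `|Z f x|].
Proof.
apply: measurable_setb; apply: measurable_fun_ltr => //.
by apply: measurableT_comp => //; exact: measurable_chaosZ.
Qed.

Let mB (y : R) : measurable [set x | exists f, y < `|Z f x|].
Proof.
by apply: (proj1 (@union_bound _ _ _ (gaussian N) _ (fun f => [set x | y < `|Z f x|]) (fun=> 1) _ _)) => // f; exact: probability_le1.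
Qed.

Lemma chaosZ_tail f (w : R) : 0 <= w ->
  (gaussian N [set x | (16 * w * (beta * Num.sqrt V) < `|Z f x|)%R] <= (4 * expR (- w))%:E)%E.
Proof.
move=> w0; apply: le_trans (gaussian_chaos_tail ((A f)^T *m A f) w).
apply: le_measure; rewrite ?inE//.
  apply: measurable_setb; apply: measurable_fun_ltr => //.
  apply: measurableT_comp => //; apply: measurable_funB => //.
  exact: measurable_quad.
move=> x /=; rewrite mxtrace_fro2 /quad dot_trmul dotvv -/(Z f x); apply: le_lt_trans.
rewrite ler_wpM2l ?mulr_ge0//.
have V0 : 0 <= V by apply: le_trans (AV f); exact: fro2_ge0.
rewrite -(ger0_norm beta0) -sqrtr_sqr -sqrtrM ?sqr_ge0// ler_wsqrtr//.
apply: le_trans (fro2_mulmx_op _ beta0 (Abeta f)) _.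
by rewrite ler_wpM2l ?sqr_ge0.
Qed.

(* With an independent copy [x'] of [x], the difference [Z f x - Z f x'] is, after a
   rotation, twice the decoupled form [<A f p, A f q>], which chaining bounds by the
   square root of the supremum of [Z]; hence a crude bound on the supremum halves. *)
Lemma chaos_step (s t M : R) : 1 <= s -> 0 < t -> t <= V ->
  10 * (chain_const n b Psi s * Num.sqrt V) <= t ->
  16 * (16 * (beta * Num.sqrt V)) <= t ->
  (gaussian N [set x | exists f, (M < `|Z f x|)%R] <= (4^-1)%:E)%E ->
  (gaussian N [set x | exists f, (Num.max t (M / 2) < `|Z f x|)%R] <= (expR (- s) / 2)%:E)%E.
Proof.
move=> s1 t0 tV kt bt vM; set y := Num.max _ _.
have V0 : 0 <= V by exact: le_trans (ltW t0) tV.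
have k0 : 0 <= chain_const n b Psi s.
  exact: (mulr_ge0 (mulr_ge0 (mulr_ge0 (ler0n R 1080) b0) (ltW Psi0)) (sqrtr_ge0 _)).
have [S [mS PS SP]] := chain_event f0 b0 Psi0 uPsi Ab AbB s1.
have [mK PK] := gauss2_rotation mS.
set K := [set z | _] in mK PK.
set B := [set x | _].
have yt : t <= y by rewrite le_max lexx.
have yM : M <= 2 * y.
  have : M / 2 <= y by rewrite le_max lexx orbT.
  by rewrite ler_pdivrMr// mulrC.
have sect x : B x -> ((2^-1)%:E <= gaussian N [set x' | K (x, x')])%E.
  move=> [f1 yf1].
  (* The maximiser depends on x only, so at the independent copy x' it is a single fixed member,
     controlled by [chaosZ_tail] without a union bound. *)
  pose f := [arg max_(f > f1) `|Z f x|]%O.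
  have fmax g : `|Z g x| <= `|Z f x|.
    by rewrite /f; case: arg_maxP => // h _ /(_ g isT).
  have {yf1}yf : y < `|Z f x| by apply: lt_le_trans yf1 (fmax f1).
  (* Two failures of the copy, each of probability at most 1/4: the crude bound M, and the tail of
     the single member f at w = 4, since 4 exp(-4) <= 1/4. *)
  pose H := [set x' | exists g, M < `|Z g x'|] `|` [set x' | 16 * 4 * (beta * Num.sqrt V) < `|Z f x'|].
  have mH : measurable H by exact: measurableU.
  have PH : (gaussian N H <= (2^-1)%:E)%E.
    apply: le_trans (measureU2 _ (mB M) (mZ f _)) _.
    have -> : 2^-1 = 4^-1 + 4^-1 :> R by field.
    rewrite EFinD; apply: leeD => //.
    apply: le_trans (chaosZ_tail f _) _ => //; rewrite lee_fin.
    have := expR_nat_ge (R := R) 4; rewrite expRN => h.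
    by rewrite -ler_pdivlMl// -(invrK (4^-1 * 4^-1)) lef_pV2 ?posrE ?expR_gt0 ?invr_gt0//; lra.
  have mKx : measurable [set x' | K (x, x')] by exact: measurable_section1.
  have cover : setT `<=` H `|` [set x' | K (x, x')].
    move=> x' _; have [Kx|nK] := pselect (K (x, x')); first by right.
    left; apply: contrapT => /not_orP[nM nf]; move: nf => /negP; rewrite -leNgt => nf.
    have nM' g : `|Z g x'| <= M.
      by rewrite leNgt; apply/negP => h; apply: nM; exists g.
    set a := `|Z f x| in fmax yf.
    pose r := Num.sqrt (2 * V + a + M).
    have M0 : 0 <= M by apply: le_trans (nM' f).
    have a0 : 0 <= a by exact: normr_ge0.
    have bnd g w c : `|Z g w| <= c -> sqn (A g *m tv w) <= V + c.
      by rewrite /Z ler_norml => /andP[_]; have := AV g; lra.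
    have rr (w : N.-tuple R) g : sqn (A g *m tv w) <= sqn (A g *m tv x) + sqn (A g *m tv x') ->
        norm2 (A g *m tv w) <= r.
      move=> h; rewrite /norm2 -/(sqn _) ler_wsqrtr//; apply: le_trans h _.
      by have := bnd g x a (fmax g); have := bnd g x' M (nM' g); lra.
    have := SP (rotp x x', rotm x x') r nK
      (fun g => conj (rr _ g (sqn_rotp _ _ _)) (rr _ g (sqn_rotm _ _ _))) f.
    rewrite /= -[1080 * b * Psi * _]/(chain_const n b Psi s) => h.
    have h2 : a <= 16 * 4 * (beta * Num.sqrt V) + 2 * (chain_const n b Psi s * r).
      have -> : a = `|Z f x' + 2 * dot (A f *m tv (rotp x x')) (A f *m tv (rotm x x'))|.
        by rewrite dot_rot /a /Z; congr `|_|; ring.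
      apply: le_trans (ler_normD _ _) _; apply: lerD => //.
      by rewrite normrM ger0_norm// ler_wpM2l.
    suff : 16 * 4 * (beta * Num.sqrt V) + 2 * (chain_const n b Psi s * r) < a by rewrite ltNge h2.
    have r2 : r ^+ 2 = 2 * V + a + M.
      by apply: sqr_sqrtr; exact: (addr_ge0 (addr_ge0 (mulr_ge0 (ler0n R 2) V0) a0) M0).
    have Ma : M <= 2 * a by apply: le_trans yM _; rewrite ler_wpM2l// ltW.
    exact: (chaos_step_arith k0 (sqrtr_ge0 _) t0 tV kt (le_trans yt (ltW yf)) Ma M0 r2 bt).
  have : (1 <= gaussian N H + gaussian N [set x' | K (x, x')])%E.
    apply: le_trans (measureU2 _ mH mKx).
    rewrite -(probability_setT (gaussian N)).
    by apply: le_measure; rewrite ?inE//; exact: measurableU.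
  move=> h; have : ((2^-1)%:E + (2^-1)%:E <= (2^-1)%:E + gaussian N [set x' | K (x, x')])%E.
    rewrite -EFinD; have -> : 2^-1 + 2^-1 = 1 :> R by field.
    by apply: le_trans h _; exact: leeD.
  by rewrite leeD2lE.
(* Every x in B has at least half of the copies in K, hence P(B) / 2 <= P(K), and P(K) = P(S) by
   rotation. *)
have : ((2^-1)%:E * gaussian N B <= (expR (- s) / 4)%:E)%E.
  apply: le_trans PS; rewrite -PK gauss2_section//.
  rewrite -[X in (_ * gaussian N X)%E](setIT B) -integral_indic//; last exact: mB.
  rewrite -ge0_integralZl//; last first.
    by apply/measurable_EFinP/measurable_indic; exact: mB.
  apply: ge0_le_integral => //.
  - by apply: emeasurable_funM => //; apply/measurable_EFinP/measurable_indic; exact: mB.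
  - have -> : (fun x => gaussian N [set y | K (x, y)]) = gaussian N \o xsection K.
      apply/funext => x; congr (gaussian N _).
      by apply/seteqP; split => z; rewrite /xsection /= inE.
    exact: measurable_fun_xsection.
  - move=> x _; rewrite indicE; case: (boolP (x \in B)) => [/set_mem Bx|_].
      by rewrite mule1; exact: sect.
    by rewrite mule0.
have two0 : (0 <= (2 : R)%:E)%E by rewrite lee_fin.
move=> h; have := lee_wpmul2l two0 h.
rewrite muleA -!EFinM divff// mul1e => h2; apply: le_trans h2 _.
by rewrite lee_fin; have := expR_ge0 (- s); lra.
Qed.

(** A union bound gives a first valid M, which may depend on the size of the family. Each round
    preserves probability 1/4 and halves M until it reaches t; one more round gives the stated
    probability, free of the size of the family. *)
Lemma chaos_sup (s t : R) : 1 <= s -> 0 < t -> t <= V ->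
  10 * (chain_const n b Psi s * Num.sqrt V) <= t ->
  16 * (16 * (beta * Num.sqrt V)) <= t ->
  (gaussian N [set x | exists f, (t < `|sqn (A f *m tv x) - fro2 (A f)|)%R]
   <= (expR (- s) / 2)%:E)%E.
Proof.
move=> s1 t0 tV kt bt.
pose valid M := (gaussian N [set x | exists f, (M < `|Z f x|)%R] <= (4^-1)%:E)%E.
have step M : valid M -> valid (Num.max t (M / 2)).
  move=> vM; apply: le_trans (chaos_step s1 t0 tV kt bt vM) _; rewrite lee_fin.
  have : expR (- s) <= 2^-1.
    rewrite expRN lef_pV2 ?posrE ?expR_gt0//.
    by have := expR_ge1Dx s; lra.
  lra.
have [M0 [M0p vM0]] : exists M, 0 <= M /\ valid M.
  pose w : R := 16 * #|F|%:R; exists (16 * w * (beta * Num.sqrt V)).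
  have w0 : 0 <= w by rewrite mulr_ge0.
  split; first by rewrite !mulr_ge0// sqrtr_ge0.
  have [_] := @union_bound _ _ _ (gaussian N) _
    (fun f => [set x | 16 * w * (beta * Num.sqrt V) < `|Z f x|]) (fun=> 4 * expR (- w))
    (fun f => mZ f _) (fun f => chaosZ_tail f w0).
  move=> /le_trans; apply; rewrite lee_fin sum_cst_card.
  rewrite expRN mulrA ler_pdivrMr ?expR_gt0//.
  have := expR_ge1Dx w; rewrite /w; lra.
have iter j : valid (Num.max t (M0 / 2 ^+ j)).
  elim: j => [|j IH].
    rewrite expr0 divr1; apply: le_trans vM0; apply: le_measure; rewrite ?inE; [exact: mB|exact: mB|].
    by move=> x [f h]; exists f; apply: le_lt_trans h; rewrite le_max lexx orbT.
  have := step _ IH; congr valid.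
  rewrite exprS invfM [in RHS]mulrCA [in RHS]mulrC.
  case: (leP t (M0 / 2 ^+ j)) => h //.
  rewrite !(max_idPl _)//; lra.
have vt : valid t.
  pose j := Num.truncn (M0 / t); have := iter j; congr valid.
  apply/max_idPl; rewrite ler_pdivrMr ?exprn_gt0//.
  have : M0 / t < j.+1%:R by have /andP[] := truncn_itv (divr_ge0 M0p (ltW t0)).
  rewrite ltr_pdivrMr// mulrC => h; apply: le_trans (ltW h) _.
  by rewrite ler_pM2l// -natrX ler_nat ltn_expl.
have := chaos_step s1 t0 tV kt bt vt.
by rewrite (max_idPl _)//; lra.
Qed.

End ChaosSup.

(** * The stacked linear system *)

Section BlockMatrices.
Context {R : realType}.

Definition blk m p (y : 'cV[R]_(m * p)) (l : 'I_m) : 'cV[R]_p :=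
  \col_i y (mxtens_index (l, i)) 0.

Lemma sqn_blk m p (y : 'cV[R]_(m * p)) : sqn y = \sum_l sqn (blk y l).
Proof.
rewrite /sqn sum_mxtens_index; apply: eq_bigr => l _; apply: eq_bigr => i _.
by rewrite mxE.
Qed.

Lemma dot_blk m p (x y : 'cV[R]_(m * p)) : dot x y = \sum_l dot (blk x l) (blk y l).
Proof.
rewrite /dot sum_mxtens_index; apply: eq_bigr => l _; apply: eq_bigr => i _.
by rewrite !mxE.
Qed.

Lemma blkP m p (x y : 'cV[R]_(m * p)) : (forall l, blk x l = blk y l) -> x = y.
Proof.
move=> h; apply/colP => k; case: (mxtens_indexP k) => l i.
by have /colP/(_ i) := h l; rewrite !mxE.
Qed.

Lemma blk_stack m p (u : 'I_m -> 'cV[R]_p) l : blk (stack u) l = u l.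
Proof. by apply/colP => i; rewrite !mxE mxtens_indexK. Qed.

Lemma blkdiagE m p q (B : 'I_m -> 'M[R]_(p, q)) l i l' j :
  blkdiag B (mxtens_index (l, i)) (mxtens_index (l', j)) =
  if l == l' then B l i j else 0.
Proof. by rewrite mxE !mxtens_indexK. Qed.

Lemma blk_blkdiag m p q (B : 'I_m -> 'M[R]_(p, q)) y l :
  blk (blkdiag B *m y) l = B l *m blk y l.
Proof.
apply/colP => i; rewrite !mxE sum_mxtens_index (bigD1 l)//= [X in _ + X]big1 ?addr0.
  by apply: eq_bigr => j _; rewrite blkdiagE eqxx mxE.
by move=> l' l'l; rewrite big1// => j _; rewrite blkdiagE eq_sym (negbTE l'l) mul0r.
Qed.

Lemma matrix_mulP p q (B C : 'M[R]_(p, q)) : (forall y : 'cV_q, B *m y = C *m y) -> B = C.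
Proof.
move=> h; apply/matrixP => i j; have /colP/(_ i) := h (delta_mx j 0).
by rewrite -!colE !mxE.
Qed.

Lemma blkdiag_mul m p q r (B : 'I_m -> 'M[R]_(p, q)) (C : 'I_m -> 'M[R]_(q, r)) :
  blkdiag B *m blkdiag C = blkdiag (fun l => B l *m C l).
Proof.
apply: matrix_mulP => y; apply: blkP => l.
by rewrite -mulmxA !blk_blkdiag mulmxA.
Qed.

Lemma blkdiag_tr m p q (B : 'I_m -> 'M[R]_(p, q)) :
  (blkdiag B)^T = blkdiag (fun l => (B l)^T).
Proof.
apply/matrixP => k k'; case: (mxtens_indexP k) => l i; case: (mxtens_indexP k') => l' j.
by rewrite mxE !blkdiagE eq_sym; case: eqP => // ->; rewrite mxE.
Qed.

Lemma blkdiagD m p q (B C : 'I_m -> 'M[R]_(p, q)) :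
  blkdiag (fun l => B l + C l) = blkdiag B + blkdiag C.
Proof.
apply/matrixP => k k'; case: (mxtens_indexP k) => l i; case: (mxtens_indexP k') => l' j.
by rewrite [RHS]mxE !blkdiagE; case: eqP => // _; rewrite ?mxE ?addr0.
Qed.

Lemma blkdiagZ m p q a (B : 'I_m -> 'M[R]_(p, q)) :
  blkdiag (fun l => a *: B l) = a *: blkdiag B.
Proof.
apply/matrixP => k k'; case: (mxtens_indexP k) => l i; case: (mxtens_indexP k') => l' j.
by rewrite [RHS]mxE !blkdiagE; case: eqP => // _; rewrite ?mxE ?mulr0.
Qed.

Lemma fro2_blkdiag m p q (B : 'I_m -> 'M[R]_(p, q)) :
  fro2 (blkdiag B) = \sum_l fro2 (B l).
Proof.
rewrite /fro2 sum_mxtens_index; apply: eq_bigr => l _; apply: eq_bigr => i _.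
rewrite sum_mxtens_index (bigD1 l)//= [X in _ + X]big1 ?addr0.
  by apply: eq_bigr => j _; rewrite blkdiagE eqxx.
by move=> l' l'l; rewrite big1// => j _; rewrite blkdiagE eq_sym (negbTE l'l) expr0n.
Qed.

Lemma norm2_blkdiag_le m p q (B : 'I_m -> 'M[R]_(p, q)) c :
  0 <= c -> (forall l y, norm2 (B l *m y) <= c * norm2 y) ->
  forall y, norm2 (blkdiag B *m y) <= c * norm2 y.
Proof.
move=> c0 Bc y; rewrite -ler_sqr ?nnegrE ?mulr_ge0 ?norm2_ge0// exprMn !norm2_sqr.
rewrite sqn_blk [in leRHS]sqn_blk mulr_sumr; apply: ler_sum => l _.
by rewrite blk_blkdiag -!norm2_sqr -exprMn ler_sqr ?nnegrE ?mulr_ge0 ?norm2_ge0.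
Qed.

Lemma norm2_trmx_le p q (B : 'M[R]_(p, q)) c : 0 <= c ->
  (forall y, norm2 (B *m y) <= c * norm2 y) -> forall y, norm2 (B^T *m y) <= c * norm2 y.
Proof.
move=> c0 Bc y; have [->|y0] := eqVneq (norm2 (B^T *m y)) 0.
  by rewrite mulr_ge0 ?norm2_ge0.
have yp : 0 < norm2 (B^T *m y) by rewrite lt_def y0 norm2_ge0.
rewrite -(ler_pM2l yp) -expr2 norm2_sqr -dotvv -dot_mulmx.
apply: le_trans (ler_norm _) _; apply: le_trans (dot_le _ _) _.
by rewrite mulrC mulrCA mulrA ler_wpM2r ?norm2_ge0.
Qed.
End BlockMatrices.

Section SpectralNorm.
Context {R : realType}.

Lemma norm2_mulmx_fro p q (B : 'M[R]_(p, q)) x : norm2 (B *m x) <= Num.sqrt (fro2 B) * norm2 x.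
Proof.
rewrite -ler_sqr ?nnegrE ?mulr_ge0 ?norm2_ge0 ?sqrtr_ge0// exprMn !norm2_sqr.
by rewrite sqr_sqrtr ?fro2_ge0// sqn_mulmx_le.
Qed.

Lemma norm2_mulmx_spectral p q (B : 'M[R]_(p, q)) x :
  norm2 (B *m x) <= spectral_norm B * norm2 x.
Proof.
have [x0|x0] := eqVneq (norm2 x) 0.
  by rewrite (norm2_eq0 x0) mulmx0 !norm2_0 mulr0.
have xp : 0 < norm2 x by rewrite lt_def x0 norm2_ge0.
rewrite -ler_pdivrMr//; apply: sup_ubound.
  exists (Num.sqrt (fro2 B)) => _ [y /= y1 <-]; apply: le_trans (norm2_mulmx_fro _ _) _.
  by rewrite -[leRHS]mulr1 ler_wpM2l ?sqrtr_ge0.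
exists ((norm2 x)^-1 *: x) => /=.
  by rewrite norm2Z ger0_norm ?invr_ge0 ?norm2_ge0// mulVf.
by rewrite -scalemxAr norm2Z ger0_norm ?invr_ge0 ?norm2_ge0// mulrC.
Qed.

Lemma spectral_norm_ge0 p q (B : 'M[R]_(p, q)) : 0 <= spectral_norm B.
Proof.
apply: le_trans (norm2_ge0 (B *m 0)) _; apply: sup_ubound.
  exists (Num.sqrt (fro2 B)) => _ [y /= y1 <-]; apply: le_trans (norm2_mulmx_fro _ _) _.
  by rewrite -[leRHS]mulr1 ler_wpM2l ?sqrtr_ge0.
by exists 0 => //=; rewrite norm2_0.
Qed.

End SpectralNorm.

Section Selection.
Context {R : realType}.
Variables (p q : nat) (f : 'I_p -> 'I_q).

Definition selmx : 'M[R]_(p, q) := rowsub f 1%:M.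

Lemma selmxE (y : 'cV_q) i : (selmx *m y) i 0 = y (f i) 0.
Proof. by rewrite mul_rowsub_mx mul1mx mxE. Qed.

Hypothesis fI : injective f.

Lemma selmx_mul_tr : selmx *m selmx^T = 1%:M.
Proof.
rewrite /selmx mul_rowsub_mx mul1mx; apply/matrixP => i j.
by rewrite !mxE eq_sym (inj_eq fI).
Qed.

Lemma norm2_selmx_tr y : norm2 (selmx^T *m y) = norm2 y.
Proof.
apply/eqP; rewrite -(@eqrXn2 _ 2) ?norm2_ge0// !norm2_sqr -dotvv dot_mulmx trmxK.
by rewrite mulmxA selmx_mul_tr mul1mx dotvv.
Qed.

Lemma fro2_mul_selmx k (B : 'M[R]_(k, p)) : fro2 (B *m selmx) = fro2 B.
Proof.
rewrite -(fro2_tr (B *m selmx)) -(fro2_tr B) -!mxtrace_fro2 !trmxK trmx_mul.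
by rewrite mulmxA -(mulmxA B) selmx_mul_tr mulmx1.
Qed.

End Selection.

Section SystemOperator.
Context {R : realType}.
Variables (T d m : nat) (A : 'I_m -> 'M[R]_d).

(* Time is the slowest index, so that a matrix mapping the noise to what the future noise
   is paired with is strictly lower triangular. *)
Definition noise_index (t : 'I_T.+1) (l : 'I_m) (i : 'I_d) : 'I_(T.+1 * (m * d)) :=
  mxtens_index (t, mxtens_index (l, i)).

Definition window_index (s : 'I_T -> 'I_T.+1) (k : 'I_(m * (T * d))) : 'I_(T.+1 * (m * d)) :=
  let l := (mxtens_unindex k).1 in
  let ti := mxtens_unindex (mxtens_unindex k).2 in
  noise_index (s ti.1) l ti.2.

Lemma window_indexE s l t i :
  window_index s (mxtens_index (l, mxtens_index (t, i))) = noise_index (s t) l i.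
Proof. by rewrite /window_index !mxtens_indexK. Qed.

Lemma window_index_inj s : injective s -> injective (window_index s).
Proof.
move=> sI k k'; case: (mxtens_indexP k) => l j; case: (mxtens_indexP k') => l' j'.
case: (mxtens_indexP j) => t i; case: (mxtens_indexP j') => t' i'.
rewrite !window_indexE => /(can_inj (@mxtens_indexK _ _)) h.
have /= /sI -> := congr1 fst h; have /= /(can_inj (@mxtens_indexK _ _)) {}h := congr1 snd h.
by have /= -> := congr1 fst h; have /= -> := congr1 snd h.
Qed.

(** Index t of the noise stands for time t + 1. [early] covers times 1 to T, which produce the
    states x_1, ..., x_T, and [late] covers times 2 to T + 1, the regression noise. *)
Definition early (t : 'I_T) : 'I_T.+1 := widen_ord (leqnSn T) t.
Definition late (t : 'I_T) : 'I_T.+1 := lift ord0 t.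

Definition earlymx : 'M[R]_(m * (T * d), T.+1 * (m * d)) := selmx (window_index early).
Definition latemx : 'M[R]_(m * (T * d), T.+1 * (m * d)) := selmx (window_index late).

Lemma early_inj : injective (window_index early).
Proof. by apply: window_index_inj => t t' /(congr1 val)/= h; exact: val_inj. Qed.

Lemma late_inj : injective (window_index late).
Proof. by apply: window_index_inj; exact: lift_inj. Qed.

Definition statemx := blkdiag (fun l => Atilde T (A l)) *m earlymx.

Definition gainmx (K : 'I_m -> 'M[R]_d) : 'M[R]_(m * (T * d)) :=
  blkdiag (fun l => blkdiag (fun _ : 'I_T => K l)).

Definition hmat (h : 'cV[R]_(m * (d * d))) (l : 'I_m) : 'M[R]_d :=
  \matrix_(i, j) h (mxtens_index (l, mxtens_index (j, i))) 0.

(** For fixed h, the vector Q h is linear in the noise; this is its matrix ([design_designmx]). *)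
Definition designmx h := gainmx (hmat h) *m statemx.

Lemma sqn_hmat h : sqn h = \sum_l fro2 (hmat h l).
Proof.
rewrite sqn_blk; apply: eq_bigr => l _; rewrite /sqn sum_mxtens_index /fro2.
rewrite exchange_big; apply: eq_bigr => i _; apply: eq_bigr => j _.
by rewrite !mxE.
Qed.

Lemma gainmxD K K' : gainmx (fun l => K l + K' l) = gainmx K + gainmx K'.
Proof.
by rewrite /gainmx -blkdiagD; congr blkdiag; apply/funext => l; rewrite blkdiagD.
Qed.

Lemma gainmxZ a K : gainmx (fun l => a *: K l) = a *: gainmx K.
Proof.
by rewrite /gainmx -blkdiagZ; congr blkdiag; apply/funext => l; rewrite blkdiagZ.
Qed.

Lemma gainmx_mul K K' : gainmx K *m gainmx K' = gainmx (fun l => K l *m K' l).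
Proof.
by rewrite /gainmx blkdiag_mul; congr blkdiag; apply/funext => l; rewrite blkdiag_mul.
Qed.

Lemma gainmx_tr K : (gainmx K)^T = gainmx (fun l => (K l)^T).
Proof.
by rewrite /gainmx blkdiag_tr; congr blkdiag; apply/funext => l; rewrite blkdiag_tr.
Qed.

Lemma fro2_gainmx K : fro2 (gainmx K) = T%:R * \sum_l fro2 (K l).
Proof.
rewrite fro2_blkdiag mulr_sumr; apply: eq_bigr => l _; rewrite fro2_blkdiag.
by rewrite sumr_const card_ord mulr_natl.
Qed.

Lemma designmxD h g : designmx (h + g) = designmx h + designmx g.
Proof.
rewrite /designmx -mulmxDl -gainmxD; congr (gainmx _ *m _); apply/funext => l.
by apply/matrixP => i j; rewrite !mxE.
Qed.

Lemma designmxZ a h : designmx (a *: h) = a *: designmx h.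
Proof.
rewrite /designmx scalemxAl -gainmxZ; congr (gainmx _ *m _); apply/funext => l.
by apply/matrixP => i j; rewrite !mxE.
Qed.

Lemma beta_ge0 : 0 <= beta T A.
Proof. by rewrite /beta; elim/big_ind: _ => [//|x y x0 y0|l _]; [by rewrite le_max x0|exact: spectral_norm_ge0]. Qed.

Lemma norm2_Atilde l y : norm2 (Atilde T (A l) *m y) <= beta T A * norm2 y.
Proof.
apply: le_trans (norm2_mulmx_spectral _ _) _; rewrite ler_wpM2r ?norm2_ge0//.
exact: (le_bigmax _ (fun l => spectral_norm (Atilde T (A l)))).
Qed.

Lemma norm2_tr_statemx y : norm2 (statemx^T *m y) <= beta T A * norm2 y.
Proof.
rewrite trmx_mul -mulmxA norm2_selmx_tr; last exact: early_inj.
apply: norm2_trmx_le y; first exact: beta_ge0.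
by apply: norm2_blkdiag_le; [exact: beta_ge0|exact: norm2_Atilde].
Qed.

Lemma fro2_mul_statemx k (B : 'M[R]_(k, m * (T * d))) : fro2 (B *m statemx) <= beta T A ^+ 2 * fro2 B.
Proof.
rewrite -fro2_tr trmx_mul -(fro2_tr B).
by apply: fro2_mulmx_op; [exact: beta_ge0|exact: norm2_tr_statemx].
Qed.

Lemma fro2_designmx_le h : fro2 (designmx h) <= beta T A ^+ 2 * (T%:R * sqn h).
Proof.
apply: le_trans (fro2_mul_statemx _) _.
by rewrite fro2_gainmx sqn_hmat.
Qed.

(** The gains act blockwise, so only the largest one matters. For h = D^+ u this is what brings in
    the row norm [mu']. *)
Lemma norm2_tr_designmx h c : 0 <= c -> (forall l, fro2 (hmat h l) <= c ^+ 2) ->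
  forall y, norm2 ((designmx h)^T *m y) <= beta T A * c * norm2 y.
Proof.
move=> c0 hc y; rewrite trmx_mul -mulmxA; apply: le_trans (norm2_tr_statemx _) _.
rewrite -mulrA ler_wpM2l ?beta_ge0//; apply: norm2_trmx_le => // {}y.
apply: norm2_blkdiag_le => // l {}y; apply: norm2_blkdiag_le => // t {}y.
apply: le_trans (norm2_mulmx_fro _ _) _; rewrite ler_wpM2r ?norm2_ge0//.
by rewrite -(ger0_norm c0) -sqrtr_sqr ler_wsqrtr.
Qed.

End SystemOperator.

Lemma sqn_diff_le (R : realType) n (a b : 'cV[R]_n) :
  `|sqn a - sqn b| <= norm2 (a - b) * norm2 (a + b).
Proof.
have -> : sqn a - sqn b = dot (a - b) (a + b).
  by rewrite dotBl !dotDr !dotvv (dotC b); ring.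
exact: dot_le.
Qed.

Lemma fro2_vec (R : realType) p q (A : 'M[R]_(p, q)) : fro2 A = sqn (vec A).
Proof.
rewrite /fro2 /sqn sum_mxtens_index exchange_big; apply: eq_bigr => i _.
by apply: eq_bigr => j _; rewrite mxE mxtens_indexK.
Qed.

Lemma rational_approx (R : realType) n (u : 'cV[R]_n) (e : R) : 0 < e ->
  exists w : 'cV[rat]_n, norm1 (u - map_mx ratr w) <= e.
Proof.
move=> e0; pose e' := e / n.+1%:R.
have e'0 : 0 < e' by rewrite divr_gt0.
have h i : exists q : rat, `|u i 0 - ratr q| <= e'.
  have : u i 0 - e' < u i 0 + e' by lra.
  move=> /rat_in_itvoo[q]; rewrite in_itv/= => /andP[q1 q2]; exists q.
  by rewrite ler_norml; apply/andP; split; lra.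
have [f fP] := choice h; exists (\col_i f i).
apply: (@le_trans _ _ (\sum_(i < n) e')).
  by apply: ler_sum => i _; rewrite !mxE.
rewrite sumr_const card_ord -mulr_natl /e' mulrCA ger_pMr// ler_pdivrMr// mul1r.
by rewrite ler_nat.
Qed.

(** * From finite families to a whole ball *)

Section ChaosSupBall.
Context {R : realType}.
Variables (N q n p : nat) (A : 'cV[R]_n.+1 -> 'M[R]_(q, N)) (B : 'M[R]_(p, n.+1)).
Variables (b beta V : R).
Hypotheses (b0 : 0 <= b) (beta0 : 0 <= beta) (V0 : 0 <= V).
Hypothesis AD : forall u v, A (u + v) = A u + A v.
Hypothesis AZ : forall a u, A (a *: u) = a *: A u.
Hypothesis Ab : forall u y, norm2 ((A u)^T *m y) <= b * norm2 u * norm2 y.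
Hypothesis Abeta : forall u y, norm2 ((A u)^T *m y) <= beta * norm2 (B *m u) * norm2 y.
Hypothesis AV : forall u, fro2 (A u) <= V * sqn (B *m u).

Let Z u x := sqn (A u *m tv x) - fro2 (A u).

Let AB u v : A (u - v) = A u - A v.
Proof. by rewrite -scaleN1r AD AZ scaleN1r. Qed.

Let froA u : fro2 (A u) <= V * fro2 B * sqn u.
Proof. by apply: le_trans (AV u) _; rewrite -mulrA ler_wpM2l// sqn_mulmx_le. Qed.

(** The Lipschitz constant depends on x and may be large; this is harmless, as the approximation of
    u is chosen after x. *)
Lemma chaos_lipschitz x u v :
  `|Z u x - Z v x| <= V * fro2 B * (sqn (tv x) + 1) * (norm2 (u - v) * norm2 (u + v)).
Proof.
have -> : Z u x - Z v x = (sqn (A u *m tv x) - sqn (A v *m tv x)) - (fro2 (A u) - fro2 (A v)).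
  by rewrite /Z; ring.
apply: le_trans (ler_normB _ _) _.
have c0 : 0 <= V * fro2 B by rewrite mulr_ge0 ?fro2_ge0.
have n2 (k : nat) (w : 'cV[R]_k) c : 0 <= c -> sqn w <= V * fro2 B * c -> norm2 w <= Num.sqrt (V * fro2 B) * Num.sqrt c.
  by move=> cp h; rewrite -sqrtrM// ler_wsqrtr.
rewrite mulrDr mulr1 mulrDl; apply: lerD.
  apply: le_trans (sqn_diff_le _ _) _; rewrite -mulmxBl -mulmxDl -AB -AD.
  have h w : norm2 (A w *m tv x) <= Num.sqrt (V * fro2 B) * Num.sqrt (sqn w * sqn (tv x)).
    apply: n2; first by rewrite mulr_ge0 ?sqn_ge0.
    apply: le_trans (sqn_mulmx_le _ _) _; rewrite mulrA ler_wpM2r ?sqn_ge0//.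
  apply: le_trans (ler_pM (norm2_ge0 _) (norm2_ge0 _) (h _) (h _)) _.
  rewrite (sqrtrM _ (sqn_ge0 (u - v))) (sqrtrM _ (sqn_ge0 (u + v))) mulrACA -expr2 sqr_sqrtr// [X in _ * X]mulrACA -expr2.
  by rewrite sqr_sqrtr ?sqn_ge0 // [X in _ * X]mulrC -!mulrA.
rewrite !fro2_vec; apply: le_trans (sqn_diff_le _ _) _.
have vecD (C D : 'M[R]_(q, N)) : vec C + vec D = vec (C + D) by apply/colP => i; rewrite !mxE.
have vecB (C D : 'M[R]_(q, N)) : vec C - vec D = vec (C - D) by apply/colP => i; rewrite !mxE.
rewrite vecD vecB -AB -AD.
have h w : norm2 (vec (A w)) <= Num.sqrt (V * fro2 B) * Num.sqrt (sqn w).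
  by apply: n2; rewrite ?sqn_ge0// -fro2_vec.
apply: le_trans (ler_pM (norm2_ge0 _) (norm2_ge0 _) (h _) (h _)) _.
by rewrite mulrACA -expr2 sqr_sqrtr// -fro2_vec.
Qed.

Variables (Psi s t : R).
Hypotheses (Psi0 : 0 < Psi) (s1 : 1 <= s) (t0 : 0 < t) (tV : t <= 4 * V).
Hypothesis kt : 10 * (chain_const n b (2 * Psi) s * Num.sqrt (4 * V)) <= t.
Hypothesis bt : 16 * (16 * (2 * beta * Num.sqrt (4 * V))) <= t.

Let admissible (u : 'cV[R]_n.+1) := (norm1 u <= 2 * Psi) && (norm2 (B *m u) <= 2).

(** Enumerates the admissible rational vectors; an index that encodes none is sent to 0, which is
    admissible. The relaxed bounds of [admissible] are the origin of 2 Psi, 2 beta and 4 V in the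
    hypotheses. *)
Let pt (i : nat) : 'cV[R]_n.+1 :=
  if unpickle i is Some w then
    let u := map_mx ratr (w : 'cV[rat]_n.+1) in if admissible u then u else 0
  else 0.

Let pt_adm i : admissible (pt i).
Proof.
have a0 : admissible 0.
  rewrite /admissible mulmx0 norm2_0 ler0n andbT /norm1 big1 ?mulr_ge0 ?ltW//.
  by move=> j _; rewrite mxE normr0.
by rewrite /pt; case: (unpickle i) => [w|//]; case: ifP.
Qed.

(* The supremum over the ball is reached through the rational vectors of the doubled
   ball, a countable increasing union of finite families. *)
Lemma chaos_sup_ball : exists Bad : set (N.-tuple R),
  [/\ measurable Bad, (gaussian N Bad <= (expR (- s) / 2)%:E)%E &
    forall x, ~ Bad x -> forall u, norm1 u <= Psi -> norm2 (B *m u) <= 1 ->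
      `|sqn (A u *m tv x) - fro2 (A u)| <= 2 * t].
Proof.
pose Bk k := [set x : N.-tuple R | exists i : 'I_k.+1, t < `|Z (pt i) x|].
have mZ i : measurable [set x : N.-tuple R | t < `|Z (pt i) x|].
  apply: measurable_setb; apply: measurable_fun_ltr => //.
  apply: measurableT_comp => //; apply: measurable_funB => //.
  by apply: measurable_sqn => j; exact: measurable_mulmx_tv.
have mBk k : measurable (Bk k).
  by have [] := @union_bound _ _ _ (gaussian N) _ (fun f : 'I_k.+1 => [set x | t < `|Z (pt f) x|])
    (fun=> 1) (fun f => mZ f) (fun f => probability_le1 _ (mZ f)).
have PBk k : (gaussian N (Bk k) <= (expR (- s) / 2)%:E)%E.
  apply: (@chaos_sup _ N q n 'I_k.+1 ord0 (fun i => A (pt i)) (fun i => pt i) b (2 * beta)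
     (4 * V) (2 * Psi)) => //.
  - by rewrite mulr_gt0.
  - by move=> f; have /andP[] := pt_adm f.
  - by move=> f g y; rewrite -AB.
  - by rewrite mulr_ge0.
  - move=> f y; apply: le_trans (Abeta _ _) _; rewrite ler_wpM2r ?norm2_ge0// mulrC.
    by rewrite ler_wpM2r//; have /andP[] := pt_adm f.
  - move=> f; apply: le_trans (AV _) _; rewrite mulrC ler_wpM2r// -norm2_sqr.
    have -> : 4 = 2 ^+ 2 :> R by ring.
    by rewrite ler_sqr ?nnegrE ?norm2_ge0//; have /andP[] := pt_adm f.
have mB : measurable (\bigcup_k Bk k) by exact: bigcup_measurable.
exists (\bigcup_k Bk k); split => //.
  have cv : gaussian N \o Bk @ \oo --> gaussian N (\bigcup_k Bk k).
    apply: nondecreasing_cvg_mu => // i j ij; apply/subsetPset => x [f h].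
    by exists (widen_ord (ij : (i.+1 <= j.+1)%N) f).
  rewrite -(cvg_lim _ cv)//; apply: lime_le; first by apply/cvg_ex; eexists; exact: cv.
  by near=> k; exact: PBk.
move=> x nB u u1 u2; rewrite -/(Z u x).
set C := V * fro2 B * (sqn (tv x) + 1).
have C0 : 0 <= C by rewrite !mulr_ge0 ?fro2_ge0// addr_ge0 ?sqn_ge0.
set f := Num.sqrt (fro2 B).
have f0 : 0 <= f by exact: sqrtr_ge0.
(* The three terms keep the rational vector within l1 norm 2 Psi, keep its image by B within norm 2,
   and keep the change of the chaos below t. *)
pose e := Num.min Psi (Num.min (1 + f)^-1 (t / (1 + 3 * Psi * C))).
have D0 : 0 < 1 + 3 * Psi * C.
  by apply: (ltr_pwDl ltr01); exact: (mulr_ge0 (mulr_ge0 (ler0n R 3) (ltW Psi0)) C0).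
have f1 : 0 < 1 + f by move: f0; lra.
have e0 : 0 < e by rewrite !lt_min Psi0 invr_gt0 f1 divr_gt0.
have [w we] := rational_approx u e0; set v := map_mx ratr w in we.
have e1 : e <= Psi by rewrite ge_min lexx.
have e2 : e * (1 + f) <= 1.
  by rewrite -ler_pdivlMr// div1r !ge_min lexx orbT.
have e3 : e * (1 + 3 * Psi * C) <= t.
  by rewrite -ler_pdivlMr// !ge_min lexx !orbT.
have v1 : norm1 v <= 2 * Psi.
  apply: (@le_trans _ _ (norm1 u + norm1 (u - v))); last by move: u1 we e1; lra.
  rewrite /norm1 -big_split /=; apply: ler_sum => i _.
  have -> : v i 0 = u i 0 - (u - v) i 0.
    by rewrite [(u - v) i 0]mxE [(- v) i 0]mxE opprB addrCA subrr addr0.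
  exact: ler_normB.
have uv2 : norm2 (u - v) <= e by apply: le_trans (norm2_le_norm1 _) we.
have va : admissible v.
  rewrite /admissible v1 /=; have -> : v = u - (u - v) by rewrite subKr.
  rewrite mulmxBr; apply: le_trans (norm2B _ _) _.
  have := norm2_mulmx_fro B (u - v); rewrite -/f => h.
  have : f * norm2 (u - v) <= f * e by rewrite ler_wpM2l.
  by move: h u2 e2; lra.
have Zv : `|Z v x| <= t.
  rewrite leNgt; apply/negP => h; apply: nB; exists (pickle w) => //.
  by exists ord_max => /=; rewrite /pt pickleK /= va.
have := chaos_lipschitz x u v; rewrite -/C => L.
have uv3 : norm2 (u + v) <= 3 * Psi.
  apply: le_trans (norm2D _ _) _.
  by have := norm2_le_norm1 u; have := norm2_le_norm1 v; move: u1 v1; lra.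
have L2 : `|Z u x - Z v x| <= t.
  apply: le_trans L _; apply: le_trans e3.
  apply: (@le_trans _ _ (C * (e * (3 * Psi)))).
    by rewrite ler_wpM2l// ler_pM ?norm2_ge0.
  have : 0 <= e by exact: ltW.
  by move: (C) => c; lra.
have -> : Z u x = (Z u x - Z v x) + Z v x by rewrite subrK.
by apply: le_trans (ler_normD _ _) _; move: L2 Zv; lra.
Unshelve. all: by end_near.
Qed.

End ChaosSupBall.

(** * A net of the Euclidean ball *)

Section BallNet.
Context {R : realType}.

Lemma norm1_le_norm2 p (w : 'cV[R]_p) : norm1 w <= Num.sqrt p%:R * norm2 w.
Proof.
have := dot_le (\col_i `|w i 0|) (const_mx 1).
have -> : dot (\col_i `|w i 0|) (const_mx 1) = norm1 w.
  by apply: eq_bigr => i _; rewrite !mxE mulr1.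
have -> : norm2 (\col_i `|w i 0|) = norm2 w.
  by congr Num.sqrt; apply: eq_bigr => i _; rewrite mxE real_normK// num_real.
have -> : norm2 (const_mx 1 : 'cV[R]_p) = Num.sqrt p%:R.
  congr Num.sqrt; rewrite (eq_bigr (fun=> 1)) ?sumr_const ?card_ord// => i _.
  by rewrite mxE expr1n.
by rewrite mulrC; apply: le_trans; exact: ler_norm.
Qed.

Lemma sum_half_pow n : \sum_(k < n) (2^-1 : R) ^+ k <= 2.
Proof.
suff -> : \sum_(k < n) (2^-1 : R) ^+ k = 2 - 2 * 2^-1 ^+ n.
  by rewrite gerBl mulr_ge0// exprn_ge0.
elim: n => [|n IH]; first by rewrite big_ord0 expr0; ring.
by rewrite big_ord_recr /= IH exprS; field.
Qed.

(** Generating function count: each function counted has weight 2^-(its sum) >= 2^-M, and the total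
    weight factorises into p factors 2 * (1 + 1/2 + ...) <= 4. *)
Lemma card_low_weight p K M : (#|[pred f : {ffun 'I_p -> bool * 'I_K} |
  (\sum_i (f i).2 <= M)%N]|%:R <= 2 ^+ M * 4 ^+ p :> R).
Proof.
rewrite -sum1_card natr_sum.
have w0 (f : {ffun 'I_p -> bool * 'I_K}) : 0 <= \prod_i (2^-1 : R) ^+ (f i).2.
  by apply: prodr_ge0 => i _; rewrite exprn_ge0.
apply: (@le_trans _ _ (2 ^+ M * \sum_(f : {ffun 'I_p -> bool * 'I_K}) \prod_i (2^-1 : R) ^+ (f i).2)).
  rewrite mulr_sumr big_mkcond; apply: ler_sum => f _; case: ifP => [|_]; last first.
    by rewrite mulr_ge0// exprn_ge0.
  rewrite inE => fM; rewrite -expr_sum exprVn ler_pdivlMr ?exprn_gt0// mul1r.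
  by rewrite ler_eXn2l// ltr1n.
rewrite ler_wpM2l ?exprn_ge0// -(bigA_distr_bigA (fun (i : 'I_p) (bk : bool * 'I_K) => (2^-1 : R) ^+ bk.2)).
rewrite -[X in 4 ^+ X]card_ord -prodr_const; apply: ler_prod => i _.
rewrite sumr_ge0 /=; last by move=> *; rewrite exprn_ge0.
rewrite -(pair_bigA _ (fun (b : bool) (k : 'I_K) => (2^-1 : R) ^+ k))/=.
rewrite big_bool /=; have := sum_half_pow K; lra.
Qed.

(** A lattice of mesh 1 / (4 sqrt p) instead of a volume argument. Rounding towards zero keeps the
    approximation in the ball and errs by at most sqrt p / (4 sqrt p). The integer coordinates of a
    lattice point of the ball have l1 norm at most 4 p, so there are at most 2^(4p) * 4^p = 64^p of
    them. *)
Lemma ball_net p : exists (I : finType) (z : I -> 'cV[R]_p),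
  [/\ #|I|%:R <= 64 ^+ p :> R, forall i, norm2 (z i) <= 1 &
    forall w, norm2 w <= 1 -> exists i, norm2 (w - z i) <= 4^-1].
Proof.
case: p => [|p].
  exists unit, (fun=> 0); split => [|i|w _]; first by rewrite card_unit expr0.
    by rewrite norm2_0.
  exists tt; rewrite (_ : w - 0 = 0) ?norm2_0//; by apply/colP => -[].
set n := p.+1; pose s : R := Num.sqrt n%:R.
have s0 : 0 < s by rewrite sqrtr_gt0.
have s2 : s * s = n%:R by rewrite -expr2 sqr_sqrtr.
pose pt (f : {ffun 'I_n -> bool * 'I_(4 * n).+1}) : 'cV[R]_n :=
  \col_i ((-1) ^+ (f i).1 * (f i).2%:R / (4 * s)).
have s40 : 0 < 4 * s by rewrite mulr_gt0.
exists {f : {ffun 'I_n -> bool * 'I_(4 * n).+1} | norm2 (pt f) <= 1}, (fun f => pt (val f)).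
split => [|f|w w1]; last 2 first.
- exact: (valP f).
- have kw i : exists2 k, (k < (4 * n).+1)%N & 0 <= 4 * s * `|w i 0| - k%:R <= 1.
    have a0 : 0 <= 4 * s * `|w i 0| by rewrite mulr_ge0// ltW.
    exists (Num.truncn (4 * s * `|w i 0|)); last first.
      have /andP[h1 h2] := truncn_itv a0; rewrite subr_ge0 h1 /= lerBlDl.
      by rewrite natr1 ltW.
    rewrite ltnS -(ler_nat R); apply: le_trans (proj1 (andP (truncn_itv a0))) _.
    have wi : `|w i 0| <= 1.
      apply: le_trans w1; rewrite -sqrtr_sqr ler_wsqrtr// (bigD1 i)//= lerDl.
      by apply: sumr_ge0 => j _; rewrite sqr_ge0.
    have s1 : Num.sqrt 1 <= s by apply: ler_wsqrtr; rewrite ler1n.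
    rewrite sqrtr1 in s1.
    have sn : s <= n%:R by rewrite -s2 ler_peMr// ltW.
    rewrite natrM; apply: le_trans (ler_wpM2l (ltW s40) wi) _.
    by rewrite mulr1 ler_pM2l.
  have [f fP] := choice (fun i => let: ex_intro2 k h1 h2 := kw i in
     ex_intro (fun k : 'I_(4 * n).+1 => 0 <= 4 * s * `|w i 0| - k%:R <= 1) (Ordinal h1) h2).
  pose g : {ffun 'I_n -> bool * 'I_(4 * n).+1} := [ffun i => (w i 0 < 0, f i)].
  have gE i : pt g i 0 = (-1) ^+ (w i 0 < 0)%R * (f i)%:R / (4 * s).
    by rewrite mxE ffunE.
  have wE i : w i 0 = (-1) ^+ (w i 0 < 0)%R * `|w i 0| by exact: numEsign.
  have sg (b : bool) (x : R) : ((-1) ^+ b * x) ^+ 2 = x ^+ 2 by rewrite exprMn sqrr_sign mul1r.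
  have g1 : norm2 (pt g) <= 1.
    apply: le_trans w1; apply: ler_wsqrtr; apply: ler_sum => i _.
    rewrite gE -mulrA sg wE sg ler_sqr ?nnegrE ?divr_ge0 ?(ltW s40)//.
    by rewrite ler_pdivrMr// mulrC -subr_ge0; have /andP[] := fP i.
  exists (exist _ g g1) => /=.
  rewrite -ler_sqr ?nnegrE ?norm2_ge0// norm2_sqr.
  apply: (@le_trans _ _ (\sum_(i < n) ((4 * s)^-1) ^+ 2)).
    apply: ler_sum => i _; rewrite [(w - pt g) i 0]mxE [(- pt g) i 0]mxE gE {1}wE -mulrA -mulrBr sg.
    have /andP[h1 h2] := fP i.
    have -> : `|w i 0| - (f i)%:R / (4 * s) = (4 * s * `|w i 0| - (f i)%:R) / (4 * s).
      by field; rewrite gt_eqF.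
    rewrite ler_sqr ?nnegrE ?divr_ge0 ?invr_ge0 ?(ltW s40)//.
    by rewrite -[leRHS]mul1r ler_wpM2r ?invr_ge0 ?(ltW s40).
  rewrite sumr_const card_ord -[_ *+ n]mulr_natr.
  by have -> : (4 * s)^-1 ^+ 2 * n%:R = 4^-1 ^+ 2 by rewrite -s2; field; rewrite gt_eqF.
rewrite card_sig; apply: (@le_trans _ _ (#|[pred f : {ffun 'I_n -> bool * 'I_(4 * n).+1} |
  (\sum_i (f i).2 <= 4 * n)%N]|%:R)).
  rewrite ler_nat; apply: subset_leq_card; apply/fintype.subsetP => f; rewrite !inE => f1.
  rewrite -(ler_nat R) natr_sum natrM -s2.
  have : norm1 (pt f) <= s by apply: le_trans (norm1_le_norm2 _) _; rewrite -/s -[leRHS]mulr1 ler_pM2l.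
  have -> : norm1 (pt f) = (\sum_i (f i).2%:R) / (4 * s).
    rewrite mulr_suml; apply: eq_bigr => i _; rewrite mxE -mulrA normrM normr_sign mul1r.
    by rewrite ger0_norm// divr_ge0// ltW.
  by rewrite ler_pdivrMr// mulrCA.
apply: le_trans (card_low_weight _ _ _) _.
by rewrite exprM -exprMn; have -> : 2 ^+ 4 * 4 = 64 :> R by ring.
Qed.

End BallNet.

Section Atilde.
Context {R : realType}.
Variables (T d : nat) (A : 'M[R]_d).

Lemma AtildeE t i s j : Atilde T A (mxtens_index (t, i)) (mxtens_index (s, j)) =
  if (s <= t)%N then (A ^+ (t - s)) i j else 0.
Proof. by rewrite mxE !mxtens_indexK. Qed.

Lemma gain_AtildeE (K : 'M[R]_d) t i s j :
  (blkdiag (fun _ : 'I_T => K) *m Atilde T A) (mxtens_index (t, i)) (mxtens_index (s, j)) =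
  if (s <= t)%N then (K *m A ^+ (t - s)) i j else 0.
Proof.
rewrite mxE sum_mxtens_index (bigD1 t)//= [X in _ + X]big1 ?addr0; last first.
  by move=> t' t't; rewrite big1// => k _; rewrite blkdiagE eq_sym (negbTE t't) mul0r.
case: ifP => st; last by rewrite big1// => k _; rewrite AtildeE st mulr0.
by rewrite mxE; apply: eq_bigr => k _; rewrite blkdiagE eqxx AtildeE st.
Qed.

Lemma blk_Atilde (y : 'cV[R]_(T * d)) t :
  blk (Atilde T A *m y) t = \sum_(s < T | (s <= t)%N) A ^+ (t - s) *m blk y s.
Proof.
apply/colP => i; rewrite summxE !mxE sum_mxtens_index [RHS]big_mkcond; apply: eq_bigr => s _.
case: ifP => st; last by rewrite big1// => k _; rewrite AtildeE st mul0r.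
by rewrite mxE; apply: eq_bigr => k _; rewrite AtildeE st !mxE.
Qed.

Lemma GsumE : Gsum T A = \sum_(t < T) Gamma t A.
Proof. by rewrite /Gsum big_add1 big_mkord. Qed.

Lemma mxtrace_gain_Gamma t (K : 'M[R]_d) :
  \tr (K *m Gamma t A *m K^T) = \sum_(k < t.+1) fro2 (K *m A ^+ k).
Proof.
rewrite mulmx_sumr mulmx_suml raddf_sum; apply: eq_bigr => k _ /=.
by rewrite mulmxA -mulmxA -trmx_mul mxtrace_mulC mxtrace_fro2.
Qed.

Lemma fro2_gain_Atilde (K : 'M[R]_d) :
  fro2 (blkdiag (fun _ : 'I_T => K) *m Atilde T A) = \tr (K *m Gsum T A *m K^T).
Proof.
rewrite GsumE mulmx_sumr mulmx_suml raddf_sum /= [LHS]/fro2 sum_mxtens_index.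
apply: eq_bigr => t _; rewrite mxtrace_gain_Gamma.
rewrite [RHS](reindex_inj rev_ord_inj) /=.
have -> : \sum_(k < t.+1) fro2 (K *m A ^+ (t.+1 - k.+1)) =
    \sum_(s < T) if (s <= t)%N then fro2 (K *m A ^+ (t - s)) else 0.
  rewrite -big_mkcond /= (big_ord_widen_cond T xpredT (fun s => fro2 (K *m A ^+ (t.+1 - s.+1))))//.
rewrite (eq_bigr (fun i => \sum_(s < T) \sum_(j < d)
   (if (s <= t)%N then (K *m A ^+ (t - s)) i j ^+ 2 else 0))); last first.
  move=> i _; rewrite sum_mxtens_index; apply: eq_bigr => s _; apply: eq_bigr => j _.
  by rewrite gain_AtildeE; case: ifP => // _; rewrite expr0n.
rewrite exchange_big; apply: eq_bigr => s _; case: ifP => st //.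
by rewrite big1// => i _; rewrite big1.
Qed.

(** Each [Gamma t A] contains the identity, its term k = 0. This is the source of the lower bound T
    |h|^2 on the expected energy. *)
Lemma fro2_gain_Atilde_ge (K : 'M[R]_d) :
  T%:R * fro2 K <= \tr (K *m Gsum T A *m K^T).
Proof.
rewrite GsumE mulmx_sumr mulmx_suml raddf_sum /= mulr_natl.
rewrite -[X in _ *+ X]card_ord -sumr_const; apply: ler_sum => t _.
rewrite mxtrace_gain_Gamma big_ord_recl expr0 mulmx1 lerDl.
by apply: sumr_ge0 => k _; exact: fro2_ge0.
Qed.

End Atilde.

Lemma stateE (R : realType) d (A : 'M[R]_d) (eta : nat -> 'cV[R]_d) t :
  state A eta t = \sum_(s < t) A ^+ (t.-1 - s) *m eta s.+1.
Proof.
elim: t => [|t IH]; first by rewrite big_ord0.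
rewrite big_ord_recr /= subnn expr0 mul1mx IH mulmx_sumr; congr (_ + _).
apply: eq_bigr => s _; rewrite mulmxA -[A *m _]/(A * _) -exprS; congr (_ ^+ _ *m _).
by have := ltn_ord s; lia.
Qed.

Section Trajectory.
Context {R : realType}.
Variables (T d m : nat) (A : 'I_m -> 'M[R]_d).
Local Notation N := (T.+1 * (m * d))%N.

(** The noise of time t sits at index t - 1; the value is meaningful for times 1 to T + 1. *)
Definition noise (x : N.-tuple R) (l : 'I_m) (t : nat) : 'cV[R]_d :=
  \col_i tnth x (noise_index (inord t.-1) l i).

Lemma blk_earlymx x l t : blk (blk (earlymx T d m *m tv x) l) t = noise x l t.+1.
Proof.
apply/colP => i; rewrite mxE mxE /earlymx selmxE window_indexE !mxE.
by congr (tnth x (noise_index _ _ _)); apply: val_inj; rewrite /= inordK// ltnW// ltnS.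
Qed.

Lemma blk_latemx x l t : blk (blk (latemx T d m *m tv x) l) t = noise x l t.+2.
Proof.
apply/colP => i; rewrite mxE mxE /latemx selmxE window_indexE !mxE.
by congr (tnth x (noise_index _ _ _)); apply: val_inj; rewrite /= inordK// ltnS.
Qed.

Lemma blk_statemx x l t : blk (blk (statemx T A *m tv x) l) t = state (A l) (noise x l) t.+1.
Proof.
rewrite /statemx -mulmxA blk_blkdiag blk_Atilde stateE /=.
rewrite (big_ord_widen_cond T xpredT (fun s => (A l) ^+ (t - s) *m noise x l s.+1))//.
apply: eq_big => // s _; by rewrite blk_earlymx.
Qed.

Lemma design_designmx (z : 'I_m -> nat -> 'cV[R]_d) x h :
  (forall l t, (0 < t <= T)%N -> z l t = state (A l) (noise x l) t) ->
  design T z *m h = designmx T A h *m tv x.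
Proof.
move=> zE; apply: blkP => l; apply: blkP => t; rewrite /designmx -mulmxA /gainmx !blk_blkdiag.
rewrite blk_statemx -zE ?ltn_ord//; apply/colP => i; rewrite !mxE sum_mxtens_index exchange_big /=.
rewrite (bigD1 i)//= [X in _ + X]big1 ?addr0.
  apply: eq_bigr => j _; rewrite tensmxE !mxE eqxx mulr1 mulrC; congr (h _ _ * _).
move=> i' i'i; rewrite big1// => j _; rewrite tensmxE [X in _ * X * _]mxE eq_sym (negbTE i'i).
by rewrite mulr0 mul0r.
Qed.

Lemma statemxE l t i s l' j :
  statemx T A (mxtens_index (l, mxtens_index (t, i))) (noise_index s l' j) =
  if (l == l') && (s <= t)%N then (A l ^+ (t - s)) i j else 0.
Proof.
have := congr1 (fun y => blk (blk y l) t i 0) (erefl (statemx T A *m delta_mx (noise_index s l' j) 0)).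
rewrite -{1}colE mxE mxE mxE => -> ; rewrite -mulmxA blk_blkdiag blk_Atilde summxE.
have E k : blk (blk (earlymx T d m *m delta_mx (noise_index s l' j) (0 : 'I_1)) l) k =
    ((l == l') && (s == k :> nat))%:R *: delta_mx j 0 :> 'cV[R]_d.
  apply/colP => a; rewrite mxE mxE /earlymx selmxE window_indexE !mxE eqxx andbT mulr_natl.
  rewrite /noise_index (can_eq (@mxtens_indexK _ _)) xpair_eqE (can_eq (@mxtens_indexK _ _)) xpair_eqE.
  rewrite -val_eqE /= (eq_sym (k : nat)); case: eqP => _; rewrite ?andbF//= andbT.
  by case: eqP => //= _.
rewrite (eq_bigr (fun k : 'I_T => ((l == l') && (s == k :> nat))%:R * ((A l) ^+ (t - k)) i j)); last first.
  by move=> k _; rewrite E -scalemxAr mxE -colE mxE.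
case: eqP => /= [_|_]; last by rewrite big1// => k _; rewrite mul0r.
case: ifP => st; last first.
  rewrite big1// => k kt; case: eqP => [sk|_]; last by rewrite mul0r.
  by move: st; rewrite sk kt.
have sT : (s < T)%N by apply: leq_ltn_trans st _.
rewrite (bigD1 (Ordinal sT))//= eqxx mul1r big1 ?addr0// => k /andP[_ kn].
by rewrite (_ : (s == k :> nat) = false) ?mul0r//; apply/negbTE; rewrite eq_sym; exact: kn.
Qed.

(** Causality: the noise of index t + 1 is paired with K x_(t+1), which involves only the noise of
    indices at most t. As time is the slowest index, a strictly earlier time means a strictly
    smaller position. *)
Lemma late_design_triangular K (k j : 'I_N) : (k <= j)%N ->
  ((latemx T d m)^T *m (gainmx T K *m statemx T A)) k j = 0.
Proof.
move=> kj; rewrite mxE big1// => p _; rewrite mxE.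
case: (mxtens_indexP p) => l q; case: (mxtens_indexP q) => t i.
rewrite /latemx /selmx [rowsub _ _ _ _]mxE window_indexE mxE.
have [kE|_] := eqVneq; last by rewrite mul0r.
rewrite mul1r mxE sum_mxtens_index big1// => l' _; rewrite sum_mxtens_index big1// => t' _.
rewrite big1// => i' _; rewrite blkdiagE; case: eqP => [<-|_]; last by rewrite mul0r.
rewrite blkdiagE; case: eqP => [<-|_]; last by rewrite mul0r.
case: (mxtens_indexP j) kj => s r; case: (mxtens_indexP r) => l'' j'.
rewrite -[mxtens_index (s, _)]/(noise_index s l'' j') statemxE => kj.
suff -> : (s <= t)%N = false by rewrite andbF mulr0.
apply/negbTE; rewrite -ltnNge ltnNge; apply/negP => st.
move: kj; rewrite -kE leqNgt /noise_index /= => /negP; apply.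
have := ltn_ord (mxtens_index (l'', j')); rewrite /bump /=.
have : (s * (m * d) <= t * (m * d))%N by rewrite leq_mul2r st orbT.
nia.
Qed.

End Trajectory.

Section SystemEnergy.
Context {R : realType}.
Variables (T d m : nat) (A : 'I_m -> 'M[R]_d).

Lemma fro2_gain_statemx K :
  fro2 (gainmx T K *m statemx T A) = \sum_l \tr (K l *m Gsum T (A l) *m (K l)^T).
Proof.
rewrite /statemx mulmxA fro2_mul_selmx; last exact: early_inj.
by rewrite blkdiag_mul fro2_blkdiag; apply: eq_bigr => l _; exact: fro2_gain_Atilde.
Qed.

Lemma fro2_designmx_ge h : T%:R * sqn h <= fro2 (designmx T A h).
Proof.
rewrite fro2_gain_statemx sqn_hmat mulr_sumr; apply: ler_sum => l _.
exact: fro2_gain_Atilde_ge.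
Qed.

Lemma fro2_statemx : fro2 (statemx T A) = \sum_l \sum_(t < T) \tr (Gamma t (A l)).
Proof.
have -> : statemx T A = gainmx T (fun _ : 'I_m => 1%:M : 'M[R]_d) *m statemx T A.
  rewrite (_ : gainmx _ _ = 1%:M) ?mul1mx//; apply: matrix_mulP => y.
  apply: blkP => l; apply: blkP => t; by rewrite !blk_blkdiag !mul1mx.
rewrite fro2_gain_statemx; apply: eq_bigr => l _.
by rewrite mul1mx trmx1 mulmx1 GsumE raddf_sum.
Qed.

(** A unit vector supported at the last time is fixed by [Atilde]. *)
Lemma beta_ge1 : (0 < T)%N -> (0 < d)%N -> (0 < m)%N -> 1 <= beta T A.
Proof.
case: T d m A => [|T'] [|d'] [|m'] A' // _ _ _.
pose e : 'cV[R]_(T'.+1 * d'.+1) := delta_mx (mxtens_index (ord_max, ord0)) 0.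
have := norm2_Atilde A' ord0 e.
have n1 p (i : 'I_p) : norm2 (delta_mx i 0 : 'cV[R]_p) = 1.
  rewrite /norm2 (bigD1 i)//= !mxE !eqxx big1 ?addr0 ?expr1n ?sqrtr1// => k ki.
  by rewrite mxE (negbTE ki) expr0n.
have -> : Atilde T'.+1 (A' ord0) *m e = e; last by rewrite !n1 mulr1.
apply: blkP => t; rewrite blk_Atilde.
have E s : blk e s = (s == ord_max)%:R *: delta_mx ord0 0.
  apply/colP => i; rewrite !mxE (can_eq (@mxtens_indexK _ _)) xpair_eqE eqxx !andbT.
  by case: (s == _); rewrite ?mul1r ?mul0r.
rewrite E (eq_bigr (fun s : 'I_T'.+1 => (s == ord_max)%:R *: (A' ord0 ^+ (t - s) *m delta_mx ord0 0))); last first.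
  by move=> s _; rewrite E scalemxAr.
have [->|tm] := eqVneq t ord_max.
  rewrite (bigD1 ord_max)//= eqxx !scale1r subnn expr0 mul1mx big1 ?addr0// => s /andP[_ /negbTE ->].
  by rewrite scale0r.
rewrite scale0r big1// => s st; rewrite (_ : (s == ord_max) = false) ?scale0r//.
apply/negbTE; apply: contra tm => /eqP sm; rewrite -val_eqE /= eqn_leq -ltnS ltn_ord /=.
by move: st; rewrite sm.
Qed.

End SystemEnergy.

Section Nets.
Context {R : realType}.
Variables (p : nat) (I : finType) (z : I -> 'cV[R]_p).
Hypothesis z1 : forall i, norm2 (z i) <= 1.
Hypothesis netz : forall w, norm2 w <= 1 -> exists i, norm2 (w - z i) <= 4^-1.

(** Approximating the direction of v loses a quarter of |v|, whence 4/3 = 1 / (1 - 1/4). *)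
Lemma net_linear (v : 'cV[R]_p) c : 0 <= c -> (forall i, dot v (z i) <= c) ->
  norm2 v <= 4 / 3 * c.
Proof.
move=> c0 vc; have [->|v0] := eqVneq (norm2 v) 0; first by rewrite mulr_ge0.
have vp : 0 < norm2 v by rewrite lt_def v0 norm2_ge0.
pose w := (norm2 v)^-1 *: v.
have w1 : norm2 w <= 1 by rewrite norm2Z ger0_norm ?invr_ge0 ?norm2_ge0// mulVf.
have [i wi] := netz w1.
have vw : dot v w = norm2 v by rewrite dotZr dotvv -norm2_sqr expr2 mulKf.
have : dot v w = dot v (z i) + dot v (w - z i) by rewrite -dotDr addrC subrK.
have := le_trans (ler_norm _) (dot_le v (w - z i)).
have : norm2 v * norm2 (w - z i) <= norm2 v * 4^-1 by rewrite ler_pM2l.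
by have := vc i; rewrite vw; lra.
Qed.

(** With q the form and z the net point near w, q w - q z = <w - z, M (w + z)>. Symmetry bounds
    bilinear values by the supremum of |q|, and 1/4 * 2 = 1/2 of the supremum is absorbed, whence
    the factor 2. *)
Lemma net_quadratic (M : 'M[R]_p) c : M^T = M ->
  (forall i, `|dot (z i) (M *m z i)| <= c) ->
  forall w, `|dot w (M *m w)| <= 2 * c * sqn w.
Proof.
move=> MT zc.
pose q w := dot w (M *m w).
have qZ a w : q (a *: w) = a ^+ 2 * q w by rewrite /q -scalemxAr dotZl dotZr; ring.
pose E := [set `|q w| | w in [set w | norm2 w <= 1]].
have Eb : has_ubound E.
  exists (Num.sqrt (fro2 M)) => _ [w /= w1 <-].
  apply: le_trans (dot_le _ _) _; apply: le_trans (ler_wpM2l (norm2_ge0 _) (norm2_mulmx_fro _ _)) _.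
  by rewrite mulrCA -[leRHS]mulr1 ler_wpM2l ?sqrtr_ge0// mulr_ile1 ?norm2_ge0.
have SE w : `|q w| <= sup E * sqn w.
  have [w0|w0] := eqVneq (norm2 w) 0.
    by rewrite (norm2_eq0 w0) /q dot0l normr0 sqn0 mulr0.
  have wp : 0 < norm2 w by rewrite lt_def w0 norm2_ge0.
  have : `|q ((norm2 w)^-1 *: w)| <= sup E.
    apply: sup_ubound => //; exists ((norm2 w)^-1 *: w) => //=.
    by rewrite norm2Z ger0_norm ?invr_ge0 ?norm2_ge0// mulVf.
  rewrite qZ normrM ger0_norm ?sqr_ge0// exprVn norm2_sqr mulrC ler_pdivrMr//.
  by rewrite -norm2_sqr exprn_gt0.
have S0 : 0 <= sup E.
  apply: le_trans (normr_ge0 (q 0)) _; apply: sup_ubound => //; exists 0 => //=.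
  by rewrite norm2_0.
have Mdot a b : dot a (M *m b) = dot b (M *m a) by rewrite dot_mulmx MT dotC.
have qD a b : q (a + b) = q a + 2 * dot a (M *m b) + q b.
  by rewrite /q mulmxDr !dotDl !dotDr (Mdot b a); ring.
have qN b : q (- b) = q b by rewrite -scaleN1r qZ sqrrN expr1n mul1r.
have polar a b : 2 * `|dot a (M *m b)| <= sup E * (sqn a + sqn b).
  have e4 : 4 * dot a (M *m b) = q (a + b) - q (a - b).
    by rewrite !qD qN mulmxN dotNr; ring.
  have : 4 * `|dot a (M *m b)| <= sup E * (sqn (a + b) + sqn (a - b)).
    rewrite -[4]ger0_norm// -normrM e4 mulrDr; apply: le_trans (ler_normB _ _) _.
    by apply: lerD; exact: SE.
  by rewrite sqnD sqnB; lra.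
have bil a b : `|dot a (M *m b)| <= sup E * (norm2 a * norm2 b).
  have [a0|a0] := eqVneq (norm2 a) 0.
    by rewrite (norm2_eq0 a0) dot0l normr0 norm2_0 mul0r mulr0.
  have [b0|b0] := eqVneq (norm2 b) 0.
    by rewrite (norm2_eq0 b0) mulmx0 dotC dot0l normr0 norm2_0 !mulr0.
  have ap : 0 < norm2 a by rewrite lt_def a0 norm2_ge0.
  have bp : 0 < norm2 b by rewrite lt_def b0 norm2_ge0.
  have := polar ((norm2 a)^-1 *: a) ((norm2 b)^-1 *: b).
  rewrite -scalemxAr dotZl dotZr mulrA !sqnZ !exprVn !norm2_sqr.
  rewrite -[sqn a]norm2_sqr -[sqn b]norm2_sqr !mulVf ?expf_neq0// normrM normrM.
  have pa : 0 <= (norm2 a)^-1 by rewrite invr_ge0 norm2_ge0.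
  have pb : 0 <= (norm2 b)^-1 by rewrite invr_ge0 norm2_ge0.
  rewrite (ger0_norm pa) (ger0_norm pb) => h.
  have {}h : (norm2 a)^-1 * (norm2 b)^-1 * `|dot a (M *m b)| <= sup E by move: h; lra.
  by rewrite -invfM mulrC ler_pdivrMr ?mulr_gt0// in h.
have S2 : sup E <= c + sup E / 2.
  apply: ge_sup; first by exists `|q 0|, 0 => //=; rewrite norm2_0.
  move=> _ [w /= w1 <-]; have [i wi] := netz w1.
  have -> : q w = q (z i) + dot (w - z i) (M *m (w + z i)).
    rewrite /q mulmxDr dotBl !dotDr (Mdot w (z i)); ring.
  apply: le_trans (ler_normD _ _) _; apply: lerD; first exact: zc.
  apply: le_trans (bil _ _) _; rewrite ler_wpM2l//.
  have := norm2D w (z i); have := z1 i; have := norm2_ge0 (w - z i).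
  have := norm2_ge0 (w + z i); move: (norm2 (w + _)) (norm2 (w - _)) wi w1 => x y *; nra.
move=> w; apply: le_trans (SE w) _; rewrite ler_wpM2r ?sqn_ge0//; lra.
Qed.

End Nets.

Lemma big_option (R : realType) (I : finType) (F : option I -> R) :
  \sum_o F o = F None + \sum_i F (Some i).
Proof.
rewrite (bigD1 None)//=; congr (_ + _).
rewrite (reindex_omap (Some : I -> option I) id)/=; last by case.
by apply: eq_bigl => i; rewrite eqxx.
Qed.

(** * The noise pairing and the Gram deviation as linear functions of the gains *)

Section Functionals.
Context {R : realType}.
Variables (T d m : nat) (A : 'I_m -> 'M[R]_d).
Local Notation N := (T.+1 * (m * d))%N.
Local Notation X := (statemx T A).
Local Notation bet := (beta T A).
Implicit Types (K : 'I_m -> 'M[R]_d) (x : N.-tuple R).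

Definition noisemx K : 'M[R]_N := (latemx T d m)^T *m (gainmx T K *m X).
(** The sum over l and 1 <= t <= T of <eta_(l,t+1), K_l x_(l,t)>. *)
Definition noise_form K x := dot (tv x) (noisemx K *m tv x).
Definition gram_form K : 'M[R]_N := X^T *m gainmx T K *m X.
(** The centred sum over l and t of <x_(l,t), K_l x_(l,t)>. Taking K_l = H_l^T H_l gives the
    deviation of |Q h|^2 in a form linear in K, so that the average, cross and centred parts
    separate. *)
Definition gram_dev K x := quad (gram_form K) x - \tr (gram_form K).

Lemma noise_formE K x : noise_form K x = dot (latemx T d m *m tv x) (gainmx T K *m X *m tv x).
Proof. by rewrite /noise_form /noisemx -mulmxA [LHS]dot_mulmx trmxK. Qed.

Lemma sqn_noisemx K x : sqn (noisemx K *m tv x) = sqn (gainmx T K *m X *m tv x).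
Proof. by rewrite /noisemx -mulmxA -!norm2_sqr norm2_selmx_tr//; exact: late_inj. Qed.

Lemma noise_form_hmat h x : dot (latemx T d m *m tv x) (designmx T A h *m tv x) = noise_form (hmat h) x.
Proof. by rewrite noise_formE. Qed.

Lemma noise_formD K K' x : noise_form (fun l => K l + K' l) x = noise_form K x + noise_form K' x.
Proof. by rewrite !noise_formE gainmxD !mulmxDl dotDr. Qed.

Lemma noise_formZ a K x : noise_form (fun l => a *: K l) x = a * noise_form K x.
Proof. by rewrite !noise_formE gainmxZ -!scalemxAl dotZr. Qed.

Lemma gram_devD K K' x : gram_dev (fun l => K l + K' l) x = gram_dev K x + gram_dev K' x.
Proof.
by rewrite /gram_dev /gram_form /quad gainmxD mulmxDr !mulmxDl dotDr mxtraceD; ring.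
Qed.

Lemma gram_devZ a K x : gram_dev (fun l => a *: K l) x = a * gram_dev K x.
Proof.
rewrite /gram_dev /gram_form /quad gainmxZ -scalemxAr -!scalemxAl dotZr mxtraceZ; ring.
Qed.

Lemma gram_dev_tr K x : gram_dev (fun l => (K l)^T) x = gram_dev K x.
Proof.
rewrite /gram_dev; have -> : gram_form (fun l => (K l)^T) = (gram_form K)^T.
  by rewrite /gram_form (trmx_mul (X^T *m _)) (trmx_mul X^T) trmxK gainmx_tr mulmxA.
by rewrite mxtrace_tr /quad dot_mulmx trmxK dotC.
Qed.

Lemma gram_dev_sqn h x : gram_dev (fun l => (hmat h l)^T *m hmat h l) x =
  sqn (designmx T A h *m tv x) - fro2 (designmx T A h).
Proof.
rewrite /gram_dev; have -> : gram_form (fun l => (hmat h l)^T *m hmat h l) = (designmx T A h)^T *m designmx T A h.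
  by rewrite /gram_form /designmx -gainmx_mul (trmx_mul (gainmx T _)) gainmx_tr !mulmxA.
by rewrite mxtrace_fro2 /quad -mulmxA dot_mulmx trmxK dotvv.
Qed.

Lemma gain_sum (phi : ('I_m -> 'M[R]_d) -> R) :
  (forall K K', phi (fun l => K l + K' l) = phi K + phi K') ->
  (forall a K, phi (fun l => a *: K l) = a * phi K) ->
  forall (J : finType) (a : J -> R) (K : J -> 'I_m -> 'M[R]_d),
  phi (fun l => \sum_j a j *: K j l) = \sum_j a j * phi (K j).
Proof.
move=> phiD phiZ J a K.
elim: (index_enum J) => [|j r IH].
  rewrite big_nil; have := phiZ 0 (fun=> 0); rewrite mul0r => <-.
  by congr phi; apply/funext => l; rewrite big_nil scale0r.
rewrite big_cons -IH -phiZ -phiD; congr phi; apply/funext => l.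
by rewrite big_cons.
Qed.

Definition noise_form_sum x := @gain_sum (fun K => noise_form K x) (fun K K' => noise_formD K K' x) (fun a K => noise_formZ a K x).
Definition gram_dev_sum x := @gain_sum (fun K => gram_dev K x) (fun K K' => gram_devD K K' x) (fun a K => gram_devZ a K x).

Lemma measurable_wn K : measurable_fun [set: N.-tuple R] (noise_form K).
Proof.
apply: measurable_dot => i; [exact: measurable_tv|exact: measurable_mulmx_tv].
Qed.

Lemma measurable_cen K : measurable_fun [set: N.-tuple R] (gram_dev K).
Proof. by apply: measurable_funB => //; exact: measurable_quad. Qed.

Let mle (f : N.-tuple R -> R) (c : R) : measurable_fun setT f -> measurable [set x | c < f x].
Proof. by move=> mf; apply: measurable_setb; exact: measurable_fun_ltr. Qed.

Lemma fro2_gram_form K : fro2 (gram_form K) <= (bet ^+ 2) ^+ 2 * (T%:R * \sum_l fro2 (K l)).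
Proof.
rewrite /gram_form -mulmxA; apply: le_trans (fro2_mulmx_op _ (@beta_ge0 R T d m A) (@norm2_tr_statemx R T d m A)) _.
rewrite [leRHS](_ : _ = bet ^+ 2 * (bet ^+ 2 * (T%:R * \sum_l fro2 (K l)))); last by ring.
rewrite ler_wpM2l ?sqr_ge0// -fro2_gainmx.
exact: fro2_mul_statemx.
Qed.

Lemma gram_dev_tail K tau E : 0 <= tau -> 0 <= E -> \sum_l fro2 (K l) <= E ^+ 2 ->
  (gaussian N [set x | (16 * tau * (bet ^+ 2 * Num.sqrt T%:R * E) < `|gram_dev K x|)%R]
   <= (4 * expR (- tau))%:E)%E.
Proof.
move=> tau0 E0 KE; apply: le_trans (gaussian_chaos_tail (gram_form K) tau).
apply: le_measure; rewrite ?inE; [apply: mle|apply: mle|].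
- by apply: measurableT_comp => //; exact: measurable_cen.
- by apply: measurableT_comp => //; exact: measurable_cen.
move=> x /=; apply: le_lt_trans; rewrite ler_wpM2l ?mulr_ge0//.
have e0 : 0 <= bet ^+ 2 * Num.sqrt T%:R * E.
  exact: (mulr_ge0 (mulr_ge0 (sqr_ge0 _) (sqrtr_ge0 _)) E0).
rewrite -[leRHS]ger0_norm// -sqrtr_sqr ler_wsqrtr//; apply: le_trans (fro2_gram_form _) _.
rewrite !exprMn sqr_sqrtr ?ler0n// -!mulrA.
by rewrite !ler_wpM2l ?beta_ge0.
Qed.

Lemma gram_dev_family_event (J : finType) (K : J -> 'I_m -> 'M[R]_d) tau E :
  0 <= tau -> 0 <= E -> (forall j, \sum_l fro2 (K j l) <= E ^+ 2) ->
  exists Bad : set (N.-tuple R), [/\ measurable Bad,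
    (gaussian N Bad <= (#|J|%:R * (4 * expR (- tau)))%:E)%E &
    forall x, ~ Bad x -> forall j, `|gram_dev (K j) x| <= 16 * tau * (bet ^+ 2 * Num.sqrt T%:R * E)].
Proof.
move=> tau0 E0 KE; set c := 16 * tau * _.
exists [set x | exists j, c < `|gram_dev (K j) x|].
have [mU PU] := @union_bound _ _ _ (gaussian N) J (fun j => [set x | c < `|gram_dev (K j) x|])
  (fun=> 4 * expR (- tau))
  (fun j => mle c (measurableT_comp (@normr_measurable _ _) (measurable_cen (K j))))
  (fun j => gram_dev_tail tau0 E0 (KE j)).
split=> //; first by rewrite -sum_cst_card.
by move=> x nB j; rewrite leNgt; apply/negP => h; apply: nB; exists j.
Qed.

Lemma noise_form_tail K tau rho : 0 <= tau -> 0 <= rho ->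
  (gaussian N [set x | (tau * rho < noise_form K x)%R && (sqn (gainmx T K *m X *m tv x) <= rho ^+ 2)%R]
   <= (expR (- (tau ^+ 2 / 2)))%:E)%E.
Proof.
move=> tau0 rho0.
have := @gaussian_selfnorm_tail R N (noisemx K) rho tau (late_design_triangular A K) rho0 tau0.
rewrite (_ : [set x | _ && (sqn (noisemx K *m tv x) <= _)] =
  [set x | (tau * rho < noise_form K x)%R && (sqn (gainmx T K *m X *m tv x) <= rho ^+ 2)%R])//.
by apply/funext => x /=; rewrite sqn_noisemx.
Qed.

Let mwn K tau rho : measurable
  [set x | (tau * rho < noise_form K x)%R && (sqn (gainmx T K *m X *m tv x) <= rho ^+ 2)%R].
Proof.
apply: measurable_setb; apply: measurable_and.
  by apply: measurable_fun_ltr => //; exact: measurable_wn.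
apply: measurable_fun_ler => //; apply: measurable_sqn => i; exact: measurable_mulmx_tv.
Qed.

Lemma noise_form_family_event (J : finType) (K : J -> 'I_m -> 'M[R]_d) tau1 tau E :
  0 <= tau -> 0 <= tau1 -> (forall j, fro2 (gainmx T (K j) *m X) <= E) ->
  exists Bad : set (N.-tuple R), [/\ measurable Bad,
    (gaussian N Bad <= (#|J|%:R * (2 * expR (- tau1) + 2 * expR (- (tau ^+ 2 / 2))))%:E)%E &
    forall x, ~ Bad x -> forall j, `|noise_form (K j) x| <= tau * Num.sqrt (4 * E * tau1)].
Proof.
move=> tau0 t1 KE; set rho := Num.sqrt _; have rho0 : 0 <= rho by exact: sqrtr_ge0.
(* For each gain, [None] is the event of large energy and [Some b] the martingale tail for the gain
   multiplied by (-1)^b, which makes the bound two-sided. *)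
pose F (jb : J * option bool) : set (N.-tuple R) :=
  if jb.2 is Some b then let K' := fun l => (-1) ^+ b *: K jb.1 l in
    [set x | (tau * rho < noise_form K' x)%R && (sqn (gainmx T K' *m X *m tv x) <= rho ^+ 2)%R]
  else [set x | 4 * fro2 (gainmx T (K jb.1) *m X) * tau1 < sqn (gainmx T (K jb.1) *m X *m tv x)].
pose c (jb : J * option bool) :=
  if jb.2 is Some _ then expR (- (tau ^+ 2 / 2)) else 2 * expR (- tau1).
have mF jb : measurable (F jb).
  case: jb => j [b|]; first exact: mwn.
  by apply: mle; apply: measurable_sqn => i; exact: measurable_mulmx_tv.
have PF jb : (gaussian N (F jb) <= (c jb)%:E)%E.
  by case: jb => j [b|]; [exact: noise_form_tail|exact: gaussian_psd_tail].
have [mU PU] := union_bound mF PF.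
exists [set x | exists jb, F jb x]; split => //.
  rewrite -sum_cst_card; apply: le_trans PU _; rewrite lee_fin.
  rewrite -(pair_bigA _ (fun j i => c (j, i)))/=; apply: ler_sum => j _.
  by rewrite big_option /= big_bool /c /=; lra.
move=> x nB j.
have e : 4 * E * tau1 = rho ^+ 2.
  rewrite sqr_sqrtr// !mulr_ge0//; apply: le_trans (KE j); exact: fro2_ge0.
have s1 : sqn (gainmx T (K j) *m X *m tv x) <= rho ^+ 2.
  rewrite -e leNgt; apply/negP => h; apply: nB; exists (j, None); rewrite /F /=.
  apply: le_lt_trans h; by rewrite ler_wpM2r// ler_wpM2l.
have s2 (b : bool) : ~~ (tau * rho < (-1) ^+ b * noise_form (K j) x).
  apply/negP => h; apply: nB; exists (j, Some b); rewrite /F /= noise_formZ h /=.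
  by rewrite gainmxZ -!scalemxAl sqnZ sqrr_sign mul1r.
have := s2 true; have := s2 false; rewrite expr0 expr1 mul1r mulN1r -!leNgt => h1 h2.
by rewrite ler_norml h1 andbT; move: h2; lra.
Qed.

Definition cst_gain (G : 'M[R]_d) : 'I_m -> 'M[R]_d := fun=> G.

Definition mat_of (z : 'cV[R]_(d * d)) : 'M[R]_d := \matrix_(i, j) z (mxtens_index (j, i)) 0.

Lemma fro2_mat_of z : fro2 (mat_of z) = sqn z.
Proof.
rewrite /fro2 exchange_big /sqn sum_mxtens_index; apply: eq_bigr => i _.
by apply: eq_bigr => j _; rewrite mxE.
Qed.

Lemma mat_ofK (G : 'M[R]_d) : mat_of (vec G) = G.
Proof. by apply/matrixP => i j; rewrite !mxE mxtens_indexK. Qed.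

Lemma norm2_cst_gain G y : norm2 (gainmx T (cst_gain G) *m y) <= Num.sqrt (fro2 G) * norm2 y.
Proof.
apply: norm2_blkdiag_le => [|l {}y]; first exact: sqrtr_ge0.
apply: norm2_blkdiag_le => [|t {}y]; first exact: sqrtr_ge0.
exact: norm2_mulmx_fro.
Qed.

(* The energy of the states is controlled once for the whole net: only the martingale
   tail pays the logarithm of its cardinality. *)
Lemma noise_form_cst_event tau1 tau : 0 <= tau1 -> 0 <= tau ->
  exists Bad : set (N.-tuple R), [/\ measurable Bad,
    (gaussian N Bad <= (2 * expR (- tau1) + 64 ^+ (d * d) * expR (- (tau ^+ 2 / 2)))%:E)%E &
    forall x, ~ Bad x -> forall G, noise_form (cst_gain G) x <=
      4 / 3 * (tau * Num.sqrt (4 * fro2 X * tau1)) * Num.sqrt (fro2 G)].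
Proof.
move=> t1 tau0; set rho := Num.sqrt _; have rho0 : 0 <= rho by exact: sqrtr_ge0.
have [I [z [cI z1 netz]]] := @ball_net R (d * d).
pose F (o : option I) : set (N.-tuple R) := if o is Some i then
  [set x | (tau * rho < noise_form (cst_gain (mat_of (z i))) x)%R &&
    (sqn (gainmx T (cst_gain (mat_of (z i))) *m X *m tv x) <= rho ^+ 2)%R]
  else [set x | 4 * fro2 X * tau1 < sqn (X *m tv x)].
pose c (o : option I) := if o is Some i then expR (- (tau ^+ 2 / 2)) else 2 * expR (- tau1).
have mF o : measurable (F o).
  case: o => [i|]; first exact: mwn.
  by apply: mle; apply: measurable_sqn => i; exact: measurable_mulmx_tv.
have PF o : (gaussian N (F o) <= (c o)%:E)%E.
  by case: o => [i|]; [exact: noise_form_tail|exact: gaussian_psd_tail].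
have [mU PU] := union_bound mF PF.
exists [set x | exists o, F o x]; split => //.
  apply: le_trans PU _; rewrite lee_fin big_option /= lerD2l sum_cst_card.
  by rewrite ler_wpM2r ?expR_ge0.
move=> x nB G.
have e : 4 * fro2 X * tau1 = rho ^+ 2 by rewrite sqr_sqrtr// !mulr_ge0// fro2_ge0.
have s1 : sqn (X *m tv x) <= rho ^+ 2.
  by rewrite -e leNgt; apply/negP => h; apply: nB; exists None.
(* By linearity the pairing is the inner product of the gain with a random vector v, whose norm the
   net controls. *)
pose v : 'cV[R]_(d * d) := \col_k noise_form (cst_gain (mat_of (delta_mx k 0))) x.
have vE w : dot v w = noise_form (cst_gain (mat_of w)) x.
  have -> : cst_gain (mat_of w) = fun l => \sum_k w k 0 *: cst_gain (mat_of (delta_mx k 0)) l.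
    apply/funext => l; apply/matrixP => i j; rewrite summxE mxE (bigD1 (mxtens_index (j, i)))//=.
    rewrite !mxE !eqxx mulr1 big1 ?addr0// => k kn.
    by rewrite !mxE eq_sym (negbTE kn) mulr0.
  by rewrite noise_form_sum; apply: eq_bigr => k _; rewrite mxE mulrC.
have vz i : dot v (z i) <= tau * rho.
  rewrite vE leNgt; apply/negP => h; apply: nB; exists (Some i); apply/andP; split => //.
  apply: le_trans s1; rewrite -mulmxA -!norm2_sqr ler_sqr ?nnegrE ?norm2_ge0//.
  apply: le_trans (norm2_cst_gain _ _) _; rewrite fro2_mat_of -[leRHS]mul1r.
  by rewrite ler_wpM2r ?norm2_ge0//; exact: z1.
have := net_linear netz (mulr_ge0 tau0 rho0) vz => vn.
rewrite -{1}(mat_ofK G) -vE; apply: le_trans (ler_norm _) _; apply: le_trans (dot_le _ _) _.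
have -> : Num.sqrt (fro2 G) = norm2 (vec G) by rewrite fro2_vec.
by rewrite ler_wpM2r ?norm2_ge0.
Qed.

(** G^T G is the sum of the rank one matrices of the rows of G, so by linearity only the quadratic
    form of a d x d matrix has to be bounded. The net then lives in dimension d rather than d^2, as
    the factor d + v of the second condition demands. *)
Lemma gram_dev_cst_event tau : 0 <= tau ->
  exists Bad : set (N.-tuple R), [/\ measurable Bad,
    (gaussian N Bad <= (64 ^+ d * (4 * expR (- tau)))%:E)%E &
    forall x, ~ Bad x -> forall G : 'M[R]_d, `|gram_dev (cst_gain (G^T *m G)) x| <=
      2 * (16 * tau * (bet ^+ 2 * Num.sqrt T%:R * Num.sqrt m%:R)) * fro2 G].
Proof.
move=> tau0.
have [I [z [cI z1 netz]]] := @ball_net R d.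
have zE i : \sum_(l < m) fro2 (cst_gain (z i *m (z i)^T) l) <= Num.sqrt m%:R ^+ 2.
  rewrite sqr_sqrtr// -[X in X%:R]card_ord -sum1_card natr_sum; apply: ler_sum => l _.
  have -> : fro2 (cst_gain (z i *m (z i)^T) l) = sqn (z i) ^+ 2.
    rewrite expr2 mulr_suml; apply: eq_bigr => a _; rewrite mulr_sumr.
    by apply: eq_bigr => b _; rewrite /cst_gain mxE big_ord1 mxE exprMn.
  by rewrite -norm2_sqr -exprM exprn_ile1 ?norm2_ge0.
have [Bad [mB PB HB]] := @gram_dev_family_event I (fun i => cst_gain (z i *m (z i)^T)) tau _ tau0 (sqrtr_ge0 _) zE.
exists Bad; split => //.
  apply: le_trans PB _; rewrite lee_fin ler_wpM2r// mulr_ge0// expR_ge0.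
move=> x /HB {}HB G; set c := 16 * tau * _ in HB *.
pose M : 'M[R]_d := \matrix_(a, b) gram_dev (cst_gain (delta_mx a b)) x.
have MT : M^T = M.
  by apply/matrixP => a b; rewrite !mxE -gram_dev_tr /cst_gain trmx_delta.
have ME w : dot w (M *m w) = gram_dev (cst_gain (w *m w^T)) x.
  have -> : cst_gain (w *m w^T) = fun l => \sum_(ab : 'I_d * 'I_d) (w ab.1 0 * w ab.2 0) *:
      cst_gain (delta_mx ab.1 ab.2) l.
    apply/funext => l; rewrite /cst_gain -(pair_bigA _ (fun a b => (w a 0 * w b 0) *: delta_mx a b))/=.
    rewrite [LHS]matrix_sum_delta; apply: eq_bigr => a _; apply: eq_bigr => b _.
    by rewrite !mxE big_ord1 !mxE.
  rewrite gram_dev_sum -(pair_bigA _ (fun a b => w a 0 * w b 0 * gram_dev (cst_gain (delta_mx a b)) x))/=.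
  rewrite /dot; apply: eq_bigr => a _; rewrite mxE mulr_sumr; apply: eq_bigr => b _.
  by rewrite mxE; ring.
have q := net_quadratic z1 netz MT (fun i => _ : `|dot (z i) (M *m z i)| <= c).
have {}q w : `|dot w (M *m w)| <= 2 * c * sqn w by apply: q => i; rewrite ME.
have -> : cst_gain (G^T *m G) = fun l => \sum_(r < d) 1 *: cst_gain ((row r G)^T *m row r G) l.
  apply/funext => l; apply/matrixP => i j; rewrite summxE !mxE; apply: eq_bigr => r _.
  by rewrite /cst_gain scale1r !mxE big_ord1 !mxE.
rewrite gram_dev_sum sqn_row mulr_sumr; apply: le_trans (ler_norm_sum _ _ _) _.
apply: ler_sum => r _; rewrite mul1r; have := q (row r G)^T; rewrite ME trmxK; exact.
Qed.

End Functionals.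

(** * The incidence matrix and the basic inequality *)

Section Incidence.
Context {R : realType} {m : nat}.
Variables (g : rel 'I_m) (D : 'M[R]_(#|edges g|, m)).
Hypotheses (gc : connected_graph g) (Dinc : incidence_matrix D) (m0 : (0 < m)%N).

Lemma edge_rows p (Q : 'M[R]_(m, p)) u v : D *m Q = 0 -> g u v -> row u Q = row v Q.
Proof.
move=> DQ guv.
have uvE : [set u; v]%SET \in edges g.
  by apply/imsetP; exists (u, v); rewrite ?inE.
pose k := enum_rank_in uvE [set u; v]%SET.
have kE : enum_val k = [set u; v]%SET by rewrite enum_rankK_in.
have [u' [v' [uv' kE' Dk]]] := Dinc k.
have DkQ : row u' Q = row v' Q.
  apply/rowP => j; rewrite !mxE; have /matrixP/(_ k j) := DQ; rewrite !mxE.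
  rewrite (eq_bigr (fun i => (i == u')%:R * Q i j - (i == v')%:R * Q i j)); last first.
    by move=> i _; rewrite Dk mulrBl.
  rewrite sumrB (bigD1 u')//= (bigD1 v' (P := xpredT))//= !eqxx !mul1r !big1.
  - by rewrite !addr0 => /eqP; rewrite subr_eq0 => /eqP.
  - by move=> i /negbTE ->; rewrite mul0r.
  - by move=> i /negbTE ->; rewrite mul0r.
have /finset.setP E : [set u; v]%SET = [set u'; v']%SET by rewrite -kE kE'.
have := E u; have := E v; rewrite !inE !eqxx orbT /= => /esym/orP[]/eqP -> /esym/orP[]/eqP -> //.
Qed.

Lemma kernel_const p (Q : 'M[R]_(m, p)) u v : D *m Q = 0 -> row u Q = row v Q.
Proof.
move=> DQ; have [_ _ /(_ u v)] := gc; move=> /connectP[s].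
elim: s u => [|w s IH] u /=; first by move=> _ ->.
by move=> /andP[/(edge_rows DQ) -> ps] ve; exact: IH.
Qed.

(** I - D^+ D has columns in the kernel of D, so connectedness makes all its rows equal. Being
    symmetric it is a constant matrix, and since it fixes the constant vector its entries are
    1/m. *)
Lemma pseudoinv_incidence : pseudoinv D *m D = 1%:M - const_mx m%:R^-1.
Proof.
have [BD1 BD2 _ BDs] := pseudoinvP D; set B := pseudoinv D in BD1 BD2 BDs *.
pose Q := 1%:M - B *m D.
have DQ : D *m Q = 0 by rewrite mulmxBr mulmx1 mulmxA BD1 subrr.
have QT : Q^T = Q by rewrite /Q linearB /= BDs trmx1.
have Qc i j i' : Q i j = Q i' j.
  by have /rowP/(_ j) := kernel_const i i' DQ; rewrite !mxE.
have Qs i j : Q i j = Q j i by rewrite -{1}QT mxE.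
have D1 : D *m (const_mx 1 : 'cV_m) = 0.
  apply/colP => k; rewrite !mxE; have [u [v [uv _ Dk]]] := Dinc k.
  rewrite (eq_bigr (fun i => (i == u)%:R - (i == v)%:R)); last first.
    by move=> i _; rewrite Dk !mxE mulr1.
  rewrite sumrB (bigD1 u)//= (bigD1 v (P := xpredT))//= !eqxx !big1 ?addr0 ?subrr//.
    by move=> i /negbTE ->.
  by move=> i /negbTE ->.
have Q1 : Q *m (const_mx 1 : 'cV_m) = const_mx 1.
  by rewrite mulmxBl mul1mx -mulmxA D1 mulmx0 subr0.
suff -> : const_mx m%:R^-1 = Q by rewrite /Q subKr.
clearbody Q.
apply/matrixP => i j; rewrite mxE.
have /colP/(_ i) := Q1; rewrite !mxE (eq_bigr (fun=> Q i j)); last first.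
  by move=> k _; rewrite ?mxE mulr1 (Qs i k) (Qc k i j) (Qs j i).
rewrite sumr_const card_ord => h.
have mn0 : m%:R != 0 :> R by rewrite pnatr_eq0 -lt0n.
by apply: (mulIf mn0); rewrite mulVf// [RHS]mulr_natr h.
Qed.

End Incidence.

Section Decomposition.
Context {R : realType}.
Variables (m e d : nat) (D : 'M[R]_(e, m)).

Definition Dpinv : 'M[R]_(m * (d * d), e * (d * d)) := pseudoinv D *t 1%:M.

Definition meanvec (h : 'cV[R]_(m * (d * d))) : 'cV[R]_(d * d) := m%:R^-1 *: \sum_l blk h l.
Definition meanpart (h : 'cV[R]_(m * (d * d))) := stack (fun _ : 'I_m => meanvec h).

Lemma hmat_meanpart h : hmat (meanpart h) = cst_gain (mat_of (meanvec h)) :> ('I_m -> 'M[R]_d).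
Proof. by apply/funext => l; apply/matrixP => i j; rewrite !mxE mxtens_indexK. Qed.

Lemma blkB p q (x y : 'cV[R]_(p * q)) l : blk (x - y) l = blk x l - blk y l.
Proof. by apply/colP => i; rewrite !mxE. Qed.

Lemma blk_tens1 p q r (B : 'M[R]_(p, q)) (u : 'cV[R]_(q * r)) l :
  blk ((B *t (1%:M : 'M[R]_r)) *m u) l = \sum_k B l k *: blk u k.
Proof.
apply/colP => i; rewrite mxE mxE sum_mxtens_index summxE; apply: eq_bigr => k _.
rewrite (bigD1 i)//= [X in _ + X]big1 ?addr0; last first.
  by move=> j ji; rewrite tensmxE [_%:M _ _]mxE eq_sym (negbTE ji) mulr0 mul0r.
by rewrite tensmxE !mxE eqxx mulr1.
Qed.

Hypothesis DD : pseudoinv D *m D = 1%:M - const_mx m%:R^-1.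

Lemma Dpinv_Dtilde h : Dpinv *m (Dtilde d D *m h) = h - meanpart h.
Proof.
rewrite mulmxA /Dpinv /Dtilde tensmx_mul mul1mx DD; apply: blkP => l.
rewrite blk_tens1 blkB blk_stack.
rewrite (eq_bigr (fun k => (l == k)%:R *: blk h k - m%:R^-1 *: blk h k)); last first.
  by move=> k _; rewrite !mxE scalerBl.
rewrite sumrB -scaler_sumr; congr (_ - _).
rewrite (bigD1 l)//= eqxx scale1r big1 ?addr0// => k kl.
by rewrite eq_sym (negbTE kl) scale0r.
Qed.

Lemma sqn_meanpart h : sqn (meanpart h) = m%:R * sqn (meanvec h).
Proof.
rewrite sqn_blk (eq_bigr (fun=> sqn (meanvec h))) ?sumr_const ?card_ord ?mulr_natl// => l _.
by rewrite blk_stack.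
Qed.

Lemma sqn_decomposition h : (0 < m)%N ->
  sqn h = sqn (meanpart h) + sqn (h - meanpart h).
Proof.
move=> m0; rewrite sqnB.
suff -> : dot h (meanpart h) = sqn (meanpart h) by ring.
rewrite dot_blk sqn_meanpart (eq_bigr (fun l => dot (blk h l) (meanvec h))); last first.
  by move=> l _; rewrite blk_stack.
have -> : \sum_l dot (blk h l) (meanvec h) = dot (\sum_l blk h l) (meanvec h).
  rewrite /dot exchange_big; apply: eq_bigr => i _.
  by rewrite summxE mulr_suml.
by rewrite -dotvv {2}/meanvec dotZl mulrA mulfV ?mul1r// pnatr_eq0 -lt0n.
Qed.

Lemma norm2_meanpart_le h : (0 < m)%N -> norm2 (meanpart h) <= norm2 h.
Proof. by move=> /sqn_decomposition => H; apply: ler_wsqrtr; rewrite -/(sqn h) H lerDl sqn_ge0. Qed.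

Lemma norm2_centered_le h : (0 < m)%N -> norm2 (h - meanpart h) <= norm2 h.
Proof. by move=> /sqn_decomposition => H; apply: ler_wsqrtr; rewrite -/(sqn h) H lerDr sqn_ge0. Qed.

Lemma mat_of_delta (i j : 'I_d) : mat_of (delta_mx (mxtens_index (j, i)) 0) = delta_mx i j :> 'M[R]_d.
Proof.
apply/matrixP => a b; rewrite !mxE (can_eq (@mxtens_indexK _ _)) xpair_eqE andbT.
by rewrite andbC.
Qed.

(** The directions generating D^+ u: by [hmat_Dpinv] the entries of u are the coefficients, so a
    uniform bound on these gains yields one proportional to |u|_1. Their size is governed by a
    column of the pseudoinverse, hence by [mu]. *)
Definition edge_gain (k : 'I_e) (G : 'M[R]_d) : 'I_m -> 'M[R]_d := fun l => pseudoinv D l k *: G.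

Lemma hmat_Dpinv u : hmat (Dpinv *m u) = fun l =>
  \sum_(p : 'I_e * 'I_(d * d)) u (mxtens_index (p.1, p.2)) 0 *: edge_gain p.1 (mat_of (delta_mx p.2 0)) l.
Proof.
apply/funext => l; apply/matrixP => i j; rewrite summxE mxE.
rewrite -(pair_bigA _ (fun k q => (u (mxtens_index (k, q)) 0 *: edge_gain k (mat_of (delta_mx q 0)) l) i j))/=.
rewrite -[LHS](_ : blk (Dpinv *m u) l (mxtens_index (j, i)) 0 = _); last by rewrite mxE.
rewrite blk_tens1 summxE; apply: eq_bigr => k _.
rewrite (bigD1 (mxtens_index (j, i)))//= big1 ?addr0; last first.
  by move=> q /negbTE qn; rewrite !mxE eq_sym qn !mulr0.
by rewrite !mxE !eqxx mulr1 mulrC.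
Qed.

Lemma sum_fro2_edge_gain k G : \sum_l fro2 (edge_gain k G l) <= mu D ^+ 2 * fro2 G.
Proof.
have -> : \sum_l fro2 (edge_gain k G l) = sqn (col k (pseudoinv D)) * fro2 G.
  rewrite /sqn mulr_suml; apply: eq_bigr => l _; rewrite /fro2.
  rewrite mulr_sumr; apply: eq_bigr => i _; rewrite mulr_sumr; apply: eq_bigr => j _.
  by rewrite !mxE exprMn.
rewrite ler_wpM2r ?fro2_ge0// -norm2_sqr ler_sqr ?nnegrE ?norm2_ge0//.
  exact: (le_bigmax _ (fun j => norm2 (col j (pseudoinv D)))).
by apply: le_trans (norm2_ge0 _) (le_bigmax _ (fun j => norm2 (col j (pseudoinv D))) k).
Qed.

Lemma fro2_hmat_Dpinv u l : fro2 (hmat (Dpinv *m u) l) <= (mu' D * norm2 u) ^+ 2.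
Proof.
have -> : fro2 (hmat (Dpinv *m u) l) = sqn (blk (Dpinv *m u) l).
  rewrite /sqn sum_mxtens_index /fro2 exchange_big; apply: eq_bigr => i _.
  by apply: eq_bigr => j _; rewrite !mxE.
rewrite blk_tens1.
have -> : sqn (\sum_k pseudoinv D l k *: blk u k) =
    \sum_i (dot (row l (pseudoinv D))^T (\col_k blk u k i 0)) ^+ 2.
  apply: eq_bigr => i _; congr (_ ^+ 2); rewrite summxE /dot; apply: eq_bigr => k _.
  by rewrite !mxE.
apply: (@le_trans _ _ (\sum_i (mu' D ^+ 2 * sqn (\col_k blk u k i 0)))).
  apply: ler_sum => i _; apply: le_trans (dot_sqr_le _ _) _.
  rewrite ler_wpM2r ?sqn_ge0// -norm2_sqr ler_sqr ?nnegrE ?norm2_ge0//.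
    exact: (le_bigmax _ (fun i => norm2 (row i (pseudoinv D))^T)).
  by apply: le_trans (norm2_ge0 _) (le_bigmax _ (fun i => norm2 (row i (pseudoinv D))^T) l).
rewrite -mulr_sumr exprMn norm2_sqr sqn_blk ler_wpM2l ?sqr_ge0// /sqn exchange_big.
by apply: ler_sum => k _; apply: ler_sum => i _; rewrite mxE.
Qed.

Lemma mu'_ge0 : 0 <= mu' D.
Proof. by rewrite /mu' /max_row_norm; elim/big_ind: _ => [//|x y x0 y0|l _]; [rewrite le_max x0|exact: norm2_ge0]. Qed.

Lemma mu_ge0 : 0 <= mu D.
Proof. by rewrite /mu /max_col_norm; elim/big_ind: _ => [//|x y x0 y0|l _]; [rewrite le_max x0|exact: norm2_ge0]. Qed.

End Decomposition.

Section Compatibility.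
Context {R : realType}.

Lemma norm1_on_split n (S : {set 'I_n}) (x : 'cV[R]_n) :
  norm1 x = norm1_on S x + norm1_on (~: S)%SET x.
Proof.
rewrite /norm1 /norm1_on (bigID [in S])/=; congr (_ + _).
by apply: eq_bigl => i; rewrite finset.in_setC.
Qed.

Lemma norm1_on_ge0 n (S : {set 'I_n}) (x : 'cV[R]_n) : 0 <= norm1_on S x.
Proof. by apply: sumr_ge0. Qed.

Lemma norm1_on_le n (S : {set 'I_n}) (x : 'cV[R]_n) :
  norm1_on S x <= Num.sqrt #|S|%:R * norm2 x.
Proof.
have := dot_le (\col_i (i \in S)%:R) (\col_i `|x i 0|).
have -> : dot (\col_i (i \in S)%:R) (\col_i `|x i 0|) = norm1_on S x.
  rewrite /norm1_on big_mkcond; apply: eq_bigr => i _; rewrite !mxE.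
  by case: (i \in S); rewrite ?mul1r ?mul0r.
have -> : norm2 (\col_i `|x i 0|) = norm2 x.
  by congr Num.sqrt; apply: eq_bigr => i _; rewrite mxE real_normK// num_real.
have -> : norm2 (\col_i (i \in S)%:R : 'cV[R]_n) = Num.sqrt #|S|%:R.
  congr Num.sqrt; rewrite -sum1_card natr_sum [RHS]big_mkcond; apply: eq_bigr => i _.
  by rewrite mxE; case: (i \in S); rewrite ?expr1n ?expr0n.
by apply: le_trans; exact: ler_norm.
Qed.

(** Dividing by [kappa] is legitimate: for nonempty S every ratio is at least 1 / |B|_F, so the
    infimum is positive as soon as the left side is nonzero. *)
Lemma compatibility p q (B : 'M[R]_(p, q)) (S : {set 'I_p}) h :
  norm1_on S (B *m h) <= Num.sqrt #|S|%:R / kappa B S * norm2 h.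
Proof.
rewrite /kappa; case: ifPn => [/eqP/cards0_eq ->|S0].
  by rewrite /norm1_on big_set0 mulr_ge0 ?norm2_ge0// divr_ge0// sqrtr_ge0.
set E := [set _ | _ in _]; have sS : 0 < Num.sqrt #|S|%:R :> R.
  by rewrite sqrtr_gt0 ltr0n lt0n.
have Elb : lbound E (Num.sqrt (fro2 B))^-1.
  move=> _ [t /= t0 <-]; have tp : 0 < norm1_on S (B *m t) by rewrite lt_def t0 norm1_on_ge0.
  have nt := le_trans (norm1_on_le S (B *m t)) (ler_wpM2l (ltW sS) (norm2_mulmx_fro B t)).
  have [f0|f0] := eqVneq (Num.sqrt (fro2 B)) 0.
    by move: nt; rewrite f0 mul0r mulr0 leNgt tp.
  have fp : 0 < Num.sqrt (fro2 B) by rewrite lt_def f0 sqrtr_ge0.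
  by rewrite ler_pdivlMr// mulrC ler_pdivrMr// -mulrA [norm2 t * _]mulrC.
have [h0|h0] := eqVneq (norm1_on S (B *m h)) 0.
  rewrite h0 mulr_ge0 ?norm2_ge0// divr_ge0 ?(ltW sS)//.
  have [->|/set0P] := eqVneq E set0; first by rewrite inf0.
  move=> E0; apply: lb_le_inf => // y /Elb; apply: le_trans.
  by rewrite invr_ge0 sqrtr_ge0.
have hp : 0 < norm1_on S (B *m h) by rewrite lt_def h0 norm1_on_ge0.
have Eh : E (Num.sqrt #|S|%:R * norm2 h / norm1_on S (B *m h)) by exists h.
have ile : inf E <= Num.sqrt #|S|%:R * norm2 h / norm1_on S (B *m h).
  by apply: inf_lbound => //; exists (Num.sqrt (fro2 B))^-1.
have fp : 0 < Num.sqrt (fro2 B).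
  rewrite lt_def sqrtr_ge0 andbT; apply/eqP => f0; move: hp; rewrite ltNge => /negP; apply.
  apply: le_trans (norm1_on_le _ _) _; apply: le_trans (ler_wpM2l (ltW sS) (norm2_mulmx_fro _ _)) _.
  by rewrite f0 mul0r mulr0.
have ip : 0 < inf E.
  apply: (@lt_le_trans _ _ (Num.sqrt (fro2 B))^-1); first by rewrite invr_gt0.
  by apply: lb_le_inf => //; eexists; exact: Eh.
by rewrite mulrAC ler_pdivlMr// mulrC -ler_pdivlMr.
Qed.

End Compatibility.

Section BasicInequality.
Context {R : realType}.

Lemma l1_shrink n (S : {set 'I_n}) (a b : 'cV[R]_n) :
  norm1 a - norm1 (a + b) <= norm1_on S b - norm1_on (~: S)%SET b + 2 * norm1_on (~: S)%SET a.
Proof.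
rewrite !(norm1_on_split S).
have h1 : norm1_on S a - norm1_on S (a + b) <= norm1_on S b.
  rewrite /norm1_on -sumrB; apply: ler_sum => i _; rewrite mxE.
  have := lerB_dist (a i 0) (- b i 0); rewrite opprK normrN; lra.
have h2 : norm1_on (~: S)%SET b - norm1_on (~: S)%SET (a + b) <= norm1_on (~: S)%SET a.
  rewrite /norm1_on -sumrB; apply: ler_sum => i _; rewrite mxE.
  have := lerB_dist (b i 0) (- a i 0); rewrite opprK normrN (addrC (b i 0)); lra.
lra.
Qed.

Lemma quadratic_root_le (x B C : R) : 0 <= x -> 0 <= B -> 0 <= C ->
  x ^+ 2 <= B * x + C -> x <= B + Num.sqrt C.
Proof.
move=> x0 B0 C0 h; rewrite leNgt; apply/negP => lt.
have s0 := sqrtr_ge0 C; have s2 := sqr_sqrtr C0.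
have : Num.sqrt C ^+ 2 < (x - B) * x.
  rewrite expr2; apply: (@le_lt_trans _ _ (Num.sqrt C * x)).
    by rewrite ler_wpM2l//; lra.
  by rewrite ltr_pM2r; lra.
rewrite s2; move: h; rewrite expr2; lra.
Qed.

Variables (m d T e : nat) (D : 'M[R]_(e, m)) (S : {set 'I_(e * (d * d))}).
Variables (a0 : 'cV[R]_(m * (d * d))) (p : nat) (Q : 'M[R]_(p, m * (d * d))) (eta : 'cV[R]_p).
Hypotheses (m0 : (0 < m)%N) (T0 : (0 < T)%N).

Let Dt := Dtilde d D.
Let compat := Num.sqrt #|S|%:R / kappa Dt S.
Let off := norm1_on (~: S)%SET (Dt *m a0).

Lemma compat_ge0 : 0 <= compat.
Proof.
rewrite divr_ge0 ?sqrtr_ge0// /kappa; case: ifP => // _.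
set E := [set _ | _ in _].
have [->|/set0P E0] := eqVneq E set0; first by rewrite inf0.
apply: lb_le_inf => // _ [t _ <-].
by rewrite divr_ge0 ?mulr_ge0 ?sqrtr_ge0 ?norm2_ge0 ?norm1_on_ge0.
Qed.

(** The deterministic part. The slope m lambda / 2 allowed to the noise leaves half of the penalty
    off S to force the error into the cone. *)
Lemma estimator_error (lambda r : R) (a : 'cV[R]_(m * (d * d))) : 0 < lambda -> 0 < r ->
  (2 * m%:R)^-1 * norm2 (Q *m a0 + eta - Q *m a) ^+ 2 + lambda * norm1 (Dt *m a) <=
  (2 * m%:R)^-1 * norm2 (Q *m a0 + eta - Q *m a0) ^+ 2 + lambda * norm1 (Dt *m a0) ->
  (forall h, dot eta (Q *m h) <= m%:R * lambda / 2 * (norm2 h + norm1 (Dt *m h))) ->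
  (forall h, norm1 (Dt *m h) <= (4 * compat + 4 / r * off + 1) * norm2 h ->
    T%:R / 2 * sqn h <= sqn (Q *m h)) ->
  norm2 (a - a0) <= 2 * m%:R * lambda / T%:R * (1 + 3 * compat)
    + Num.sqrt (8 * (lambda * m%:R / T%:R * off)) + r.
Proof.
move=> l0 r0 obj noise re; set h := a - a0.
have mR : 0 < m%:R :> R by rewrite ltr0n.
have TR : 0 < T%:R :> R by rewrite ltr0n.
have c0 := compat_ge0; have off0 : 0 <= off by exact: norm1_on_ge0.
have B0 : 0 <= 2 * m%:R * lambda / T%:R * (1 + 3 * compat).
  apply: mulr_ge0; last by rewrite addr_ge0// mulr_ge0.
  by rewrite !mulr_ge0 ?invr_ge0 ?(ltW mR) ?(ltW l0) ?(ltW TR).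
have C0 : 0 <= 8 * (lambda * m%:R / T%:R * off) by rewrite !mulr_ge0 ?invr_ge0 ?(ltW mR) ?(ltW l0) ?(ltW TR).
have [hr|hr] := leP (norm2 h) r.
  by apply: le_trans hr _; rewrite lerDr addr_ge0 ?sqrtr_ge0.
suff : norm2 h <= 2 * m%:R * lambda / T%:R * (1 + 3 * compat) + Num.sqrt (8 * (lambda * m%:R / T%:R * off)).
  by move=> k; apply: le_trans k _; rewrite lerDl ltW.
set P := norm1_on S (Dt *m h); set Pc := norm1_on (~: S)%SET (Dt *m h).
have nE : norm1 (Dt *m h) = P + Pc by exact: norm1_on_split.
have PC : P <= compat * norm2 h by exact: compatibility.
have ae : a = a0 + h by rewrite addrC subrK.
have key : sqn (Q *m h) <= m%:R * lambda * (norm2 h + 3 * P - Pc + 4 * off).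
  have e1 : Q *m a0 + eta - Q *m a = eta - Q *m h.
    by rewrite ae mulmxDr opprD addrACA subrr add0r.
  have e2 : Q *m a0 + eta - Q *m a0 = eta by rewrite addrAC subrr add0r.
  move: obj; rewrite e1 e2 !norm2_sqr sqnB => obj.
  have sh : norm1 (Dt *m a0) - norm1 (Dt *m a) <= P - Pc + 2 * off.
    by rewrite ae mulmxDr; exact: l1_shrink.
  have lsh := ler_wpM2l (ltW l0) sh.
  have := noise h; rewrite nE => nh.
  have obj2 : (2 * m%:R)^-1 * (sqn (Q *m h) - 2 * dot eta (Q *m h)) <= lambda * (P - Pc + 2 * off).
    by move: obj lsh; rewrite !mulrBr !mulrDr; lra.
  move: obj2; rewrite mulrC ler_pdivrMr ?mulr_gt0// => obj2.
  by move: obj2 nh; clear -R; lra.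
have cone : norm1 (Dt *m h) <= (4 * compat + 4 / r * off + 1) * norm2 h.
  have : 0 <= m%:R * lambda * (norm2 h + 3 * P - Pc + 4 * off) by apply: le_trans key; exact: sqn_ge0.
  rewrite pmulr_rge0 ?mulr_gt0// => k.
  (* The role of r: errors of norm at most r are within the claim already, and above r the constant
     term becomes proportional to |h|, which makes the cone homogeneous. *)
  have off1 : off <= off / r * norm2 h.
    by rewrite -mulrA ler_peMr// mulrC ler_pdivlMr// mul1r ltW.
  by rewrite nE; move: off1 k PC; clear -R; lra.
have := le_trans (re h cone) key => fin.
have Pc0 : 0 <= Pc by exact: norm1_on_ge0.
apply: quadratic_root_le; rewrite ?norm2_ge0// norm2_sqr.
have fin2 : T%:R / 2 * sqn h <= m%:R * lambda * ((1 + 3 * compat) * norm2 h + 4 * off).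
  by apply: le_trans fin _; rewrite ler_pM2l ?mulr_gt0//; move: PC; clear -Pc0; lra.
have -> : 2 * m%:R * lambda / T%:R * (1 + 3 * compat) * norm2 h + 8 * (lambda * m%:R / T%:R * off)
  = m%:R * lambda * ((1 + 3 * compat) * norm2 h + 4 * off) / (T%:R / 2) by field; rewrite gt_eqF.
by rewrite ler_pdivlMr ?divr_gt0// mulrC.
Qed.

End BasicInequality.

(** * The good event *)

Section RestrictedEigenvalue.
Context {R : realType}.
Variables (T d m e : nat) (A : 'I_m -> 'M[R]_d) (D : 'M[R]_(e, m)).
Hypotheses (m0 : (0 < m)%N) (DD : pseudoinv D *m D = 1%:M - const_mx m%:R^-1).
Variable x : (T.+1 * (m * d)).-tuple R.
Local Notation Dp := (Dpinv d D).
Local Notation Dt := (Dtilde d D).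

Lemma hmat_split (h : 'cV[R]_(m * (d * d))) l :
  hmat h l = cst_gain (mat_of (meanvec h)) l + hmat (Dp *m (Dt *m h)) l.
Proof.
rewrite Dpinv_Dtilde// -hmat_meanpart; apply/matrixP => i j.
by rewrite !mxE addrC subrK.
Qed.

Lemma norm2_meanpart (h : 'cV[R]_(m * (d * d))) : norm2 (meanpart h) = Num.sqrt m%:R * Num.sqrt (fro2 (mat_of (meanvec h))).
Proof. by rewrite -sqrtrM// /norm2 -/(sqn _) sqn_meanpart fro2_mat_of. Qed.

Lemma norm1_pair (u : 'cV[R]_(e * (d * d))) :
  norm1 u = \sum_(p : 'I_e * 'I_(d * d)) `|u (mxtens_index (p.1, p.2)) 0|.
Proof.
by rewrite /norm1 sum_mxtens_index -(pair_bigA _ (fun k q => `|u (mxtens_index (k, q)) 0|)).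
Qed.

Lemma noise_bound (f1 f2 : R) :
  (forall G, noise_form A (cst_gain G) x <= Num.sqrt m%:R * f1 * Num.sqrt (fro2 G)) ->
  (forall k q, `|noise_form A (edge_gain D k (mat_of (delta_mx q 0))) x| <= f2) ->
  forall h, dot (latemx T d m *m tv x) (designmx T A h *m tv x)
    <= f1 * norm2 (meanpart h) + f2 * norm1 (Dt *m h).
Proof.
move=> H1 H2 h; rewrite noise_form_hmat.
have -> : hmat h = fun l => cst_gain (mat_of (meanvec h)) l + hmat (Dp *m (Dt *m h)) l.
  by apply/funext => l; exact: hmat_split.
rewrite noise_formD; apply: lerD.
  by apply: le_trans (H1 _) _; rewrite norm2_meanpart mulrCA mulrA.
rewrite hmat_Dpinv noise_form_sum norm1_pair mulr_sumr; apply: ler_sum => p _.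
apply: le_trans (ler_norm _) _; rewrite normrM mulrC.
by rewrite ler_wpM2r.
Qed.

(** Expanding both factors into entries costs |u|_1 on one side and the l1 norm of a row of G on the
    other, whence sqrt d. *)
Lemma cross_bound (W : R) (G : 'M[R]_d) u : 0 <= W ->
  (forall k a b, `|gram_dev A (edge_gain D k (delta_mx a b)) x| <= W) ->
  `|gram_dev A (fun l => G^T *m hmat (Dp *m u) l) x|
    <= norm1 u * (Num.sqrt d%:R * Num.sqrt (fro2 G) * W).
Proof.
move=> W0 HW.
have -> : (fun l => G^T *m hmat (Dp *m u) l) = fun l =>
  \sum_(p : 'I_e * 'I_(d * d)) u (mxtens_index (p.1, p.2)) 0 *:
     (fun l => G^T *m edge_gain D p.1 (mat_of (delta_mx p.2 0)) l) l.
  apply/funext => l; rewrite hmat_Dpinv mulmx_sumr; apply: eq_bigr => p _.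
  by rewrite scalemxAr.
rewrite gram_dev_sum norm1_pair mulr_suml; apply: le_trans (ler_norm_sum _ _ _) _.
apply: ler_sum => -[k q] _ /=; rewrite normrM ler_wpM2l//.
case: (mxtens_indexP q) => j i; rewrite mat_of_delta.
have -> : (fun l => G^T *m edge_gain D k (delta_mx i j) l) = fun l =>
    \sum_a G i a *: edge_gain D k (delta_mx a j) l.
  apply/funext => l; apply/matrixP => a b; rewrite summxE !mxE (bigD1 i)//= big1 ?addr0; last first.
    by move=> i' /negbTE i'n; rewrite !mxE i'n mulr0 mulr0.
  rewrite (bigD1 a)//= big1 ?addr0; last by move=> a' /negbTE an; rewrite !mxE eq_sym an !mulr0.
  by rewrite !mxE !eqxx.
rewrite gram_dev_sum; apply: le_trans (ler_norm_sum _ _ _) _.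
apply: (@le_trans _ _ (\sum_a `|G i a| * W)).
  by apply: ler_sum => a _; rewrite normrM ler_wpM2l.
rewrite -mulr_suml ler_wpM2r//.
have := norm1_le_norm2 (row i G)^T; rewrite /norm1.
rewrite (eq_bigr (fun a => `|G i a|)); last by move=> a _; rewrite !mxE.
move=> h; apply: le_trans h _; rewrite ler_wpM2l ?sqrtr_ge0// ler_wsqrtr//.
rewrite -/(sqn _) sqn_row [leRHS](bigD1 i)//= lerDl; apply: sumr_ge0 => *; exact: sqn_ge0.
Qed.

(** The expected energy is at least T |h|^2. The deviations of the average part, of the doubled
    cross term and of the centred part may take T/8, T/4 and T/8 of |h|^2, which leaves T/2. *)
Lemma restricted_eigenvalue (W Psi : R) : 0 <= W -> 0 < Psi ->
  (forall G : 'M[R]_d, `|gram_dev A (cst_gain (G^T *m G)) x| <= m%:R * T%:R / 8 * fro2 G) ->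
  (forall k a b, `|gram_dev A (edge_gain D k (delta_mx a b)) x| <= W) ->
  8 * (Psi * Num.sqrt d%:R * W) <= T%:R * Num.sqrt m%:R ->
  (forall u, norm1 u <= Psi -> norm2 (Dp *m u) <= 1 ->
    `|sqn (designmx T A (Dp *m u) *m tv x) - fro2 (designmx T A (Dp *m u))| <= T%:R / 8) ->
  forall h, norm1 (Dt *m h) <= Psi * norm2 h ->
    T%:R / 2 * sqn h <= sqn (designmx T A h *m tv x).
Proof.
move=> W0 P0 Ha HW WT Hc h hPsi.
have [h0|h0] := eqVneq (norm2 h) 0.
  by rewrite (norm2_eq0 h0) sqn0 mulr0 sqn_ge0.
have hp : 0 < norm2 h by rewrite lt_def h0 norm2_ge0.
set G := mat_of (meanvec h); set u := Dt *m h in hPsi *.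
pose k l := hmat (Dp *m u) l.
have gm : Num.sqrt m%:R * Num.sqrt (fro2 G) <= norm2 h.
  by rewrite -norm2_meanpart; exact: norm2_meanpart_le.
have sm : 0 < Num.sqrt m%:R :> R by rewrite sqrtr_gt0 ltr0n.
have ge := fro2_designmx_ge T A h.
have E : sqn (designmx T A h *m tv x) - fro2 (designmx T A h) =
   gram_dev A (cst_gain (G^T *m G)) x + 2 * gram_dev A (fun l => G^T *m k l) x
   + gram_dev A (fun l => (k l)^T *m k l) x.
  rewrite -gram_dev_sqn.
  have -> : (fun l => (hmat h l)^T *m hmat h l) = fun l =>
    (cst_gain (G^T *m G) l + G^T *m k l) + ((G^T *m k l)^T + (k l)^T *m k l).
    have tD (a b : 'M[R]_d) : (a + b)^T = a^T + b^T by rewrite linearD.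
    apply/funext => l; rewrite hmat_split -/(k l) /cst_gain -/G tD mulmxDl !mulmxDr.
    by rewrite trmx_mul trmxK.
  rewrite (gram_devD _ (fun l => cst_gain (G^T *m G) l + G^T *m k l)) gram_devD gram_devD.
  by rewrite (gram_dev_tr _ (fun l => G^T *m k l)); ring.
have ha : `|gram_dev A (cst_gain (G^T *m G)) x| <= T%:R / 8 * sqn h.
  apply: le_trans (Ha G) _.
  have -> : m%:R * T%:R / 8 * fro2 G = T%:R / 8 * (m%:R * fro2 G) by ring.
  rewrite ler_wpM2l ?divr_ge0// -norm2_sqr.
  have : (Num.sqrt m%:R * Num.sqrt (fro2 G)) ^+ 2 <= norm2 h ^+ 2.
    by rewrite ler_sqr ?nnegrE ?mulr_ge0 ?sqrtr_ge0 ?norm2_ge0.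
  by rewrite exprMn (sqr_sqrtr (ler0n R m)) (sqr_sqrtr (fro2_ge0 G)).
have hb : 2 * `|gram_dev A (fun l => G^T *m k l) x| <= T%:R / 4 * sqn h.
  have := cross_bound G u W0 HW => cb.
  have c2 : norm1 u * (Num.sqrt d%:R * Num.sqrt (fro2 G) * W) <=
      Psi * norm2 h * (Num.sqrt d%:R * (norm2 h / Num.sqrt m%:R) * W).
    apply: ler_pM => //.
    - by apply: sumr_ge0.
    - by rewrite !mulr_ge0 ?sqrtr_ge0.
    - by rewrite ler_wpM2r// ler_wpM2l ?sqrtr_ge0// ler_pdivlMr// mulrC.
  apply: (@le_trans _ _ (2 * (Psi * norm2 h * (Num.sqrt d%:R * (norm2 h / Num.sqrt m%:R) * W)))).
    by rewrite ler_pM2l//; exact: le_trans cb c2.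
  have -> : 2 * (Psi * norm2 h * (Num.sqrt d%:R * (norm2 h / Num.sqrt m%:R) * W)) =
     8 * (Psi * Num.sqrt d%:R * W) / Num.sqrt m%:R / 4 * norm2 h ^+ 2.
    by field; rewrite gt_eqF.
  rewrite norm2_sqr ler_wpM2r ?sqn_ge0// ler_wpM2r ?invr_ge0//.
  by rewrite ler_pdivrMr.
have hc : `|gram_dev A (fun l => (k l)^T *m k l) x| <= T%:R / 8 * sqn h.
  rewrite gram_dev_sqn.
  pose u1 := (norm2 h)^-1 *: u.
  have uE : Dp *m u = norm2 h *: (Dp *m u1).
    by rewrite /u1 -!scalemxAr scalerA mulfV// scale1r.
  have H := Hc u1; rewrite uE designmxZ -scalemxAl sqnZ.
  have -> : fro2 (norm2 h *: designmx T A (Dp *m u1)) = norm2 h ^+ 2 * fro2 (designmx T A (Dp *m u1)).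
    by rewrite /fro2 mulr_sumr; apply: eq_bigr => i _; rewrite mulr_sumr; apply: eq_bigr => j _; rewrite mxE exprMn.
  rewrite -mulrBr normrM (ger0_norm (sqr_ge0 _)) norm2_sqr [leRHS]mulrC.
  rewrite ler_wpM2l ?sqn_ge0//; apply: H.
    have -> : norm1 u1 = norm1 u / norm2 h.
      by rewrite /norm1 mulr_suml; apply: eq_bigr => i _; rewrite mxE normrM ger0_norm ?invr_ge0 ?norm2_ge0// mulrC.
    by rewrite ler_pdivrMr.
  rewrite /u1 -scalemxAr norm2Z ger0_norm ?invr_ge0 ?norm2_ge0// ler_pdivrMl// mulr1.
  by rewrite /u Dpinv_Dtilde// norm2_centered_le.
move: ha hb hc ge E; rewrite !ler_norml => /andP[ha _] hb /andP[hc _] ge E.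
have := ler_norm (- gram_dev A (fun l => G^T *m k l) x); rewrite normrN => hb2.
by lra.
Qed.

End RestrictedEigenvalue.

Lemma ln2_ge_half (R : realType) : 2^-1 <= ln 2 :> R.
Proof.
rewrite -ler_expR lnK ?posrE//.
have h : expR (2^-1 : R) ^+ 2 <= 2 ^+ 2.
  rewrite -expRM_natl -mulr_natl mulfV//.
  by have := @expR1_le4 R; rewrite expr2; lra.
by rewrite ler_sqr ?nnegrE ?expR_ge0 in h.
Qed.

(** Restates the bound for a positive dimension, since the dimension e d^2 of the application is not
    written as a successor. *)
Lemma chaos_sup_ball_pos (R : realType) (N q n p : nat) (A : 'cV[R]_n -> 'M[R]_(q, N))
    (B : 'M[R]_(p, n)) (b beta V Psi s t : R) :
  (0 < n)%N -> 0 <= b -> 0 <= beta -> 0 <= V ->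
  (forall u v, A (u + v) = A u + A v) -> (forall a u, A (a *: u) = a *: A u) ->
  (forall u y, norm2 ((A u)^T *m y) <= b * norm2 u * norm2 y) ->
  (forall u y, norm2 ((A u)^T *m y) <= beta * norm2 (B *m u) * norm2 y) ->
  (forall u, fro2 (A u) <= V * sqn (B *m u)) ->
  0 < Psi -> 1 <= s -> 0 < t -> t <= 4 * V ->
  10 * (1080 * b * (2 * Psi) * Num.sqrt (ln n%:R + s) * Num.sqrt (4 * V)) <= t ->
  16 * (16 * (2 * beta * Num.sqrt (4 * V))) <= t ->
  exists Bad : set (N.-tuple R),
  [/\ measurable Bad, (gaussian N Bad <= (expR (- s) / 2)%:E)%E &
    forall x, ~ Bad x -> forall u, norm1 u <= Psi -> norm2 (B *m u) <= 1 ->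
      `|sqn (A u *m tv x) - fro2 (A u)| <= 2 * t].
Proof.
case: n A B => // n A B _ b0 beta0 V0 AD AZ Ab Abeta AV P0 s1 t0 tV kt bt.
exact: (chaos_sup_ball b0 beta0 V0 AD AZ Ab Abeta AV P0 s1 t0 tV kt bt).
Qed.

Lemma four_expR_le (R : realType) (s : R) : 1 <= s -> 4 * expR (- (2 * s)) <= 2 * expR (- s).
Proof.
move=> s1; have -> : - (2 * s) = - s - s by ring.
rewrite expRD mulrA ler_pM2r ?expR_gt0// expRN ler_pdivrMr ?expR_gt0//.
by have := expR_ge1Dx s; lra.
Qed.

Section CenteredChaos.
Context {R : realType}.
Variables (T d m e : nat) (A : 'I_m -> 'M[R]_d) (D : 'M[R]_(e, m)).
Hypotheses (T0 : (0 < T)%N) (d0 : (0 < d)%N) (m0 : (0 < m)%N) (e0 : (0 < e)%N).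
Local Notation N := (T.+1 * (m * d))%N.
Local Notation Dp := (Dpinv d D).
Local Notation bet := (beta T A).
Local Notation n := (e * (d * d))%N.

Lemma norm2_tr_design_Dpinv u y :
  norm2 ((designmx T A (Dp *m u))^T *m y) <= bet * mu' D * norm2 u * norm2 y.
Proof.
rewrite -(mulrA bet); apply: norm2_tr_designmx => [|l]; last exact: fro2_hmat_Dpinv.
by rewrite mulr_ge0 ?norm2_ge0 ?mu'_ge0.
Qed.

Lemma norm2_tr_design h y :
  norm2 ((designmx T A h)^T *m y) <= bet * norm2 h * norm2 y.
Proof.
apply: norm2_tr_designmx => [|l]; first exact: norm2_ge0.
rewrite norm2_sqr sqn_hmat (bigD1 l)//= lerDl; apply: sumr_ge0 => *; exact: fro2_ge0.
Qed.

Variables (v Psi : R).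
Hypotheses (v1 : 1 <= v) (P0 : 0 < Psi).
Hypothesis HP : 10 * 1000 * 1000 *
  (bet ^+ 2 * mu' D * Num.sqrt T%:R * Psi * Num.sqrt (ln n%:R) * Num.sqrt v) <= T%:R.
Hypothesis Hv : 10 * 1000 * 1000 * (bet ^+ 2 * Num.sqrt T%:R * Num.sqrt v) <= T%:R.

Let TR : 0 < T%:R :> R. Proof. by rewrite ltr0n. Qed.
Let b1 : 1 <= bet. Proof. exact: beta_ge1. Qed.
Let sv1 : 1 <= Num.sqrt v.
Proof. by rewrite -[leLHS]sqrtr1 ler_wsqrtr. Qed.

Let svv : Num.sqrt v <= v.
Proof. by rewrite -[leRHS]sqr_sqrtr ?(le_trans ler01)// expr2 ler_peMr// sqrtr_ge0. Qed.

(** For n >= 2, ln n >= 1/2 turns sqrt(ln n + v) into 2 sqrt(ln n) sqrt v, the product controlled by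
    [F3] times sqrt v. The threshold T/16 is doubled in passing to the whole ball. *)
Lemma chaos_event_multi : (1 < n)%N ->
  exists Bad : set (N.-tuple R), [/\ measurable Bad,
    (gaussian N Bad <= (2 * expR (- Num.sqrt v))%:E)%E &
    forall x, ~ Bad x -> forall u, norm1 u <= Psi -> norm2 (Dp *m u) <= 1 ->
      `|sqn (designmx T A (Dp *m u) *m tv x) - fro2 (designmx T A (Dp *m u))| <= T%:R / 8].
Proof.
move=> n1.
have sV : Num.sqrt (4 * (bet ^+ 2 * T%:R)) = 2 * bet * Num.sqrt T%:R.
  have -> : 4 * (bet ^+ 2 * T%:R) = (2 * bet) ^+ 2 * T%:R by ring.
  by rewrite sqrtrM ?sqr_ge0// sqrtr_sqr ger0_norm// mulr_ge0// (le_trans ler01).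
have L0 : 2^-1 <= ln n%:R :> R.
  by apply: le_trans (ln2_ge_half R) _; rewrite ler_ln ?posrE ?ltr0n ?(ltnW n1)// ler_nat.
have sL : Num.sqrt (ln n%:R + v) <= 2 * (Num.sqrt (ln n%:R) * Num.sqrt v).
  have L1 : 0 <= ln n%:R :> R by apply: le_trans L0.
  have v0 : 0 <= v by apply: le_trans v1.
  rewrite -ler_sqr ?nnegrE ?mulr_ge0 ?sqrtr_ge0// sqr_sqrtr ?addr_ge0// !exprMn !sqr_sqrtr//.
  have p1 : 0 <= (ln n%:R - 2^-1) * v by rewrite mulr_ge0 ?subr_ge0.
  have p2 : 0 <= ln n%:R * (v - 1) by rewrite mulr_ge0 ?subr_ge0.
  by move: (ln _) p1 p2 L1 => L; rewrite expr2; lra.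
have [|||||||||||||||Bad [mB PB HB]] := @chaos_sup_ball_pos R N _ n _ (fun u => designmx T A (Dp *m u))
  Dp (bet * mu' D) bet (bet ^+ 2 * T%:R) Psi v (T%:R / 16).
- exact: ltnW.
- by rewrite mulr_ge0 ?beta_ge0 ?mu'_ge0.
- exact: beta_ge0.
- by rewrite mulr_ge0 ?sqr_ge0.
- by move=> u w; rewrite mulmxDr designmxD.
- by move=> a u; rewrite -scalemxAr designmxZ.
- exact: norm2_tr_design_Dpinv.
- by move=> u y; exact: norm2_tr_design.
- by move=> u; rewrite -mulrA; exact: fro2_designmx_le.
- exact: P0.
- exact: v1.
- by rewrite divr_gt0.
- have : 1 <= bet ^+ 2 by rewrite exprn_ege1.
  move=> bb; have : T%:R <= bet ^+ 2 * T%:R by rewrite ler_peMl// ltW.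
  by move: (bet ^+ 2 * T%:R) TR; move=> *; lra.
- rewrite sV.
  pose p := bet * mu' D * Psi * (bet * Num.sqrt T%:R).
  have p0 : 0 <= p by rewrite !mulr_ge0 ?beta_ge0 ?mu'_ge0 ?sqrtr_ge0// ltW.
  have E1 : bet ^+ 2 * mu' D * Num.sqrt T%:R * Psi * Num.sqrt (ln n%:R) * Num.sqrt v =
     p * (Num.sqrt (ln n%:R) * Num.sqrt v) by rewrite /p; ring.
  have E2 : 10 * (1080 * (bet * mu' D) * (2 * Psi) * Num.sqrt (ln n%:R + v) * (2 * bet * Num.sqrt T%:R)) =
     40 * 1080 * (p * Num.sqrt (ln n%:R + v)) by rewrite /p; ring.
  have h1 := ler_wpM2l p0 sL; have h2 := HP; rewrite E1 in h2; rewrite E2.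
  rewrite (mulrCA p) in h1.
  have h3 : 0 <= p * (Num.sqrt (ln n%:R) * Num.sqrt v).
    by rewrite mulr_ge0// mulr_ge0 ?sqrtr_ge0.
  move: (p * (Num.sqrt (ln n%:R) * Num.sqrt v)) (p * Num.sqrt (ln n%:R + v)) h1 h2 h3 => a b h1 h2 h3.
  by move: T%:R h2 => c h2; lra.
- rewrite sV; pose p := bet ^+ 2 * Num.sqrt T%:R.
  have p0 : 0 <= p by rewrite mulr_ge0 ?sqr_ge0 ?sqrtr_ge0.
  have h1 : p <= p * Num.sqrt v by rewrite ler_peMr.
  have -> : 16 * (16 * (2 * bet * (2 * bet * Num.sqrt T%:R))) = 1024 * p by rewrite /p; ring.
  have h2 := Hv; rewrite -/p in h2; move: (p * Num.sqrt v) h1 h2 => q h1 h2.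
  by move: T%:R h2 => c h2; lra.
exists Bad; split => //.
  apply: le_trans PB _; rewrite lee_fin.
  have : expR (- v) <= expR (- Num.sqrt v) by rewrite ler_expR lerN2.
  by have := expR_ge0 (- v); lra.
move=> x nB u u1 u2; apply: le_trans (HB x nB u u1 u2) _; lra.
Qed.

(* Chaining loses a factor [sqrt (ln n + v)], which [F3] does not control when [n = 1]. *)
Lemma chaos_event_single : n = 1%N ->
  exists Bad : set (N.-tuple R), [/\ measurable Bad,
    (gaussian N Bad <= (2 * expR (- Num.sqrt v))%:E)%E &
    forall x, ~ Bad x -> forall u, norm2 (Dp *m u) <= 1 ->
      `|sqn (designmx T A (Dp *m u) *m tv x) - fro2 (designmx T A (Dp *m u))| <= T%:R / 8].
Proof.
(* The image of the pseudoinverse is spanned by w, so the supremum reduces to the chaos of one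
   vector. *)
move=> n1; pose h1 := Dp *m (const_mx 1 : 'cV[R]_n); pose w := (norm2 h1)^-1 *: h1.
have w1 : norm2 w <= 1.
  rewrite norm2Z ger0_norm ?invr_ge0 ?norm2_ge0//.
  by have [->|h0] := eqVneq (norm2 h1) 0; rewrite ?mulr0// mulVf.
have uE (u : 'cV[R]_n) : exists2 a, Dp *m u = a *: w & `|a| = norm2 (Dp *m u).
  have -> : u = u (cast_ord (esym n1) 0) 0 *: const_mx 1.
    apply/colP => i; rewrite !mxE mulr1; congr (u _ 0); apply: val_inj => /=.
    by have := ltn_ord i; rewrite [X in (_ < X)%N]n1; case: (nat_of_ord i).
  move: (u _ _) => c; exists (c * norm2 h1); rewrite -scalemxAr -/h1; last first.
    by rewrite norm2Z normrM (ger0_norm (norm2_ge0 _)).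
  have [h0|h0] := eqVneq (norm2 h1) 0; first by rewrite h0 mulr0 scale0r (norm2_eq0 h0) scaler0.
  by rewrite /w scalerA mulfK.
have b0 := @beta_ge0 R T d m A.
have sV : Num.sqrt (bet ^+ 2 * T%:R) = bet * Num.sqrt T%:R.
  by rewrite sqrtrM ?sqr_ge0// sqrtr_sqr ger0_norm.
have fin : 16 * (2 * Num.sqrt v) * (bet * Num.sqrt (bet ^+ 2 * T%:R)) <= T%:R / 8.
  have -> : 16 * (2 * Num.sqrt v) * (bet * Num.sqrt (bet ^+ 2 * T%:R)) =
    32 * (bet ^+ 2 * Num.sqrt T%:R * Num.sqrt v) by rewrite sV; ring.
  have h0 : 0 <= bet ^+ 2 * Num.sqrt T%:R * Num.sqrt v by rewrite !mulr_ge0 ?sqr_ge0 ?sqrtr_ge0.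
  have h2 := Hv; move: (bet ^+ 2 * Num.sqrt T%:R * Num.sqrt v) h0 h2 => q h0 h2.
  by move: T%:R h2 => c h2; lra.
have tl := @chaosZ_tail R N _ 'I_1 (fun=> designmx T A w) bet (bet ^+ 2 * T%:R) b0 _ _ ord0 (2 * Num.sqrt v).
exists [set x | 16 * (2 * Num.sqrt v) * (bet * Num.sqrt (bet ^+ 2 * T%:R)) <
  `|sqn (designmx T A w *m tv x) - fro2 (designmx T A w)|].
split.
- apply: measurable_setb; apply: measurable_fun_ltr => //.
  apply: measurableT_comp => //; apply: measurable_funB => //.
  by apply: measurable_sqn => j; exact: measurable_mulmx_tv.
- apply: le_trans (tl _ _ _) _.
  + move=> _ y; apply: le_trans (norm2_tr_design _ _) _; rewrite ler_wpM2r ?norm2_ge0//.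
    by rewrite -[leRHS]mulr1 ler_wpM2l.
  + move=> _; apply: le_trans (fro2_designmx_le _ _ _) _; rewrite mulrA ler_piMr ?mulr_ge0 ?sqr_ge0//.
    by rewrite -norm2_sqr exprn_ile1 ?norm2_ge0.
  + by rewrite mulr_ge0 ?sqrtr_ge0.
  rewrite lee_fin. exact: four_expR_le.
move=> x /negP; rewrite -leNgt => H u u1.
have [a uaE aE] := uE u; rewrite -aE in u1; rewrite uaE.
rewrite designmxZ -scalemxAl sqnZ.
have -> : fro2 (a *: designmx T A w) = a ^+ 2 * fro2 (designmx T A w).
  by rewrite /fro2 mulr_sumr; apply: eq_bigr => i _; rewrite mulr_sumr; apply: eq_bigr => j _; rewrite mxE exprMn.
rewrite -mulrBr normrM normrX.
apply: le_trans (_ : _ <= 1 * `|sqn (designmx T A w *m tv x) - fro2 (designmx T A w)|) _.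
  by rewrite ler_wpM2r// exprn_ile1.
by rewrite mul1r; exact: le_trans H fin.
Qed.

Lemma centered_chaos_event :
  exists Bad : set (N.-tuple R), [/\ measurable Bad,
    (gaussian N Bad <= (2 * expR (- Num.sqrt v))%:E)%E &
    forall x, ~ Bad x -> forall u, norm1 u <= Psi -> norm2 (Dp *m u) <= 1 ->
      `|sqn (designmx T A (Dp *m u) *m tv x) - fro2 (designmx T A (Dp *m u))| <= T%:R / 8].
Proof.
have : (0 < n)%N by rewrite !muln_gt0 e0 d0.
rewrite leq_eqVlt => /orP[/eqP/esym n1|]; last exact: chaos_event_multi.
have [Bad [mB PB HB]] := chaos_event_single n1.
by exists Bad; split => // x nB u _; exact: HB.
Qed.

End CenteredChaos.

(** * The individual events and their numerical constants *)

Section NumericEvents.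
Context {R : realType}.
Variables (T d m e : nat) (A : 'I_m -> 'M[R]_d) (D : 'M[R]_(e, m)).
Hypotheses (T0 : (0 < T)%N) (d0 : (0 < d)%N) (m0 : (0 < m)%N) (e0 : (0 < e)%N).
Local Notation N := (T.+1 * (m * d))%N.
Local Notation bet := (beta T A).
Variable delta : R.
Hypotheses (dl0 : 0 < delta) (dl1 : delta < 16^-1).

Let dR : 1 <= d%:R :> R. Proof. by rewrite ler1n. Qed.
Let eR : 1 <= e%:R :> R. Proof. by rewrite ler1n. Qed.
Let mR : 0 < m%:R :> R. Proof. by rewrite ltr0n. Qed.

Lemma ln_inv_ge1 : 1 <= ln (1 / delta).
Proof.
rewrite -ler_expR lnK ?posrE ?divr_gt0// ler_pdivlMr//.
have := @expR1_le4 R; have := @expR_ge0 R 1.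
by move: dl1 dl0 (expR 1) => h1 h2 x; nra.
Qed.

Lemma expRN_ln_div (x : R) : 0 < x -> expR (- ln (x / delta)) = delta / x.
Proof. by move=> x0; rewrite expRN lnK ?posrE ?divr_gt0// invf_div. Qed.

Lemma sqr_delta_le : delta ^+ 2 <= delta / 16.
Proof. by rewrite expr2 ler_pM2l// ltW. Qed.

Lemma mxtrace_Gamma_ge1 t (B : 'M[R]_d) : 1 <= \tr (Gamma t B).
Proof.
have := mxtrace_gain_Gamma B t 1%:M; rewrite mul1mx trmx1 mulmx1 => ->.
rewrite big_ord_recl expr0 mulmx1 -[leLHS]addr0; apply: lerD; last first.
  by apply: sumr_ge0 => k _; exact: fro2_ge0.
rewrite /fro2 (bigD1 (Ordinal d0))//= (bigD1 (Ordinal d0))//= !mxE eqxx expr1n -addrA lerDl.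
apply: addr_ge0; first by apply: sumr_ge0 => *; exact: sqr_ge0.
by apply: sumr_ge0 => *; apply: sumr_ge0 => *; exact: sqr_ge0.
Qed.

Lemma fro2_statemx_ge : m%:R <= fro2 (statemx T A).
Proof.
rewrite fro2_statemx -[X in X%:R]card_ord -sum1_card natr_sum; apply: ler_sum => l _.
rewrite (bigD1 (Ordinal T0))//= -[leLHS]addr0; apply: lerD; first exact: mxtrace_Gamma_ge1.
by apply: sumr_ge0 => t _; apply: le_trans (mxtrace_Gamma_ge1 _ _).
Qed.

(** With p = d^2 and l = ln(1/delta), tau^2 = 2 (6 p + 2 l) beats the net, as 64^p <= exp(6 p).
    Since the states have energy at least m, K1 = 64 gives Z >= 64 and ln Z >= 3, so that p/2 ln Z
    dominates the cost of the net. *)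
Lemma noise_cst_event : exists Bad : set (N.-tuple R), [/\ measurable Bad,
  (gaussian N Bad <= (delta / 4)%:E)%E &
  forall x, ~ Bad x -> forall G : 'M[R]_d,
    noise_form A (cst_gain G) x <= Num.sqrt m%:R * F1 T A 64 delta * Num.sqrt (fro2 G)].
Proof.
have l1 := ln_inv_ge1; set l := ln (1 / delta) in l1.
pose p : R := (d * d)%:R; have p0 : 0 <= p by [].
have q0 : 0 <= 2 * (6 * p + 2 * l) by lra.
have l0 : 0 <= 2 * l by lra.
have [Bad [mB PB HB]] := @noise_form_cst_event R T d m A (2 * l) (Num.sqrt (2 * (6 * p + 2 * l))) l0 (sqrtr_ge0 _).
exists Bad; split => //.
  apply: le_trans PB _; rewrite lee_fin sqr_sqrtr//.
  have el : expR (- l) = delta by rewrite expRN_ln_div// divr1.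
  have -> : - (2 * l) = - l - l by ring.
  have -> : - (2 * (6 * p + 2 * l) / 2) = - (6 * p) + (- l - l) by field.
  rewrite !expRD el expRN.
  have h64 : 64 ^+ (d * d) <= expR (6 * p) :> R.
    have -> : 64 = 2 ^+ 6 :> R by ring.
    by rewrite -exprM /p -natrM; exact: expR_nat_ge.
  have h1 : 64 ^+ (d * d) / expR (6 * p) <= 1 by rewrite ler_pdivrMr ?expR_gt0// mul1r.
  have d2 := sqr_delta_le; rewrite expr2 in d2.
  have h2 : 64 ^+ (d * d) * ((expR (6 * p))^-1 * (delta * delta)) <= 1 * (delta * delta).
    by rewrite mulrA ler_wpM2r// mulr_ge0// ltW.
  move: ((64 : R) ^+ (d * d) * ((expR (6 * p))^-1 * (delta * delta))) (delta * delta) h2 d2 => y z; move: dl0; lra.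
move=> x /HB H G; apply: le_trans (H G) _; rewrite ler_wpM2r ?sqrtr_ge0//.
set S := fro2 (statemx T A); have S1 : m%:R <= S by exact: fro2_statemx_ge.
have zE : zeta1 T A 64 delta = 64 * S * l by rewrite /zeta1 -fro2_statemx.
rewrite /F1 zE -/l; set Z := 64 * S * l / m%:R + 1.
have S0 : 0 <= S by exact: fro2_ge0.
have Sl : 0 <= S * l by rewrite mulr_ge0//; lra.
have mZ : 64 * (S * l) <= m%:R * Z.
  have -> : m%:R * Z = 64 * (S * l) + m%:R by rewrite /Z; field; rewrite gt_eqF.
  by rewrite lerDl ltW.
have Z64 : 64 <= Z.
  rewrite /Z -[leLHS]addr0; apply: lerD => //; rewrite ler_pdivlMr// -mulrA ler_pM2l//.
  by apply: le_trans S1 _; rewrite ler_peMr.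
have Z0 : 0 <= Z by lra.
have lnZ : 3 <= ln Z.
  apply: (@le_trans _ _ (ln (2 ^+ 6))).
    rewrite lnXn// -mulr_natl; have := ln2_ge_half R; lra.
  have -> : 2 ^+ 6 = 64 :> R by ring.
  by rewrite ler_ln ?posrE//; lra.
have pE : (d ^ 2)%:R = p by rewrite /p mulnn.
rewrite pE.
have w0 : 0 <= l + p / 2 * ln Z.
  apply: addr_ge0; first by lra.
  by rewrite mulr_ge0//; [rewrite divr_ge0|lra].
have X0 : 0 <= 2 * (6 * p + 2 * l) * (4 * S * (2 * l)).
  exact: (mulr_ge0 q0 (mulr_ge0 (mulr_ge0 (ler0n R 4) S0) l0)).
have Y0 : 0 <= 2 * Z * (l + p / 2 * ln Z) by exact: (mulr_ge0 (mulr_ge0 (ler0n R 2) Z0) w0).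
have -> : Num.sqrt 2 * Num.sqrt Z * Num.sqrt (l + p / 2 * ln Z) = Num.sqrt (2 * Z * (l + p / 2 * ln Z)).
  by rewrite (sqrtrM _ (mulr_ge0 (ler0n R 2) Z0)) (sqrtrM _ (ler0n R 2)).
have -> : Num.sqrt (2 * (6 * p + 2 * l)) * Num.sqrt (4 * S * (2 * l)) =
   Num.sqrt (2 * (6 * p + 2 * l) * (4 * S * (2 * l))) by rewrite (sqrtrM _ q0).
rewrite -(sqrtrM _ (ler0n R m)) -ler_sqr ?nnegrE ?mulr_ge0 ?sqrtr_ge0// exprMn.
rewrite (sqr_sqrtr X0) (sqr_sqrtr (mulr_ge0 (ler0n R m) Y0)).
apply: (@le_trans _ _ (2 * (64 * (S * l)) * (l + p / 2 * 3))); last first.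
  have -> : m%:R * (2 * Z * (l + p / 2 * ln Z)) = 2 * (m%:R * Z) * (l + p / 2 * ln Z) by ring.
  apply: ler_pM.
  - exact: (mulr_ge0 (ler0n R 2) (mulr_ge0 (ler0n R 64) Sl)).
  - by lra.
  - by rewrite ler_pM2l.
  - by rewrite lerD2l ler_wpM2l// divr_ge0.
have -> : (4 / 3) ^+ 2 * (2 * (6 * p + 2 * l) * (4 * S * (2 * l))) =
  (S * l) * (256 / 9 * (6 * p + 2 * l)) by field.
have -> : 2 * (64 * (S * l)) * (l + p / 2 * 3) = (S * l) * (128 * (l + p / 2 * 3)) by ring.
rewrite ler_wpM2l//; lra.
Qed.

Lemma mu_max_diagG k q :
  fro2 (gainmx T (edge_gain D k (mat_of (delta_mx q 0 : 'cV[R]_(d * d)))) *m statemx T A)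
  <= mu D ^+ 2 * max_diagG T A.
Proof.
case: (mxtens_indexP q) => j i; rewrite mat_of_delta fro2_gain_statemx.
have G0 : 0 <= max_diagG T A.
  rewrite /max_diagG; elim/big_ind: _ => [//|x y x0 y0|l _]; first by rewrite le_max x0.
  elim/big_ind: _ => [//|x y x0 y0|a _]; first by rewrite le_max x0.
  rewrite GsumE summxE; apply: sumr_ge0 => t _; rewrite summxE; apply: sumr_ge0 => s _.
  by rewrite mxE; apply: sumr_ge0 => b _; rewrite !mxE -expr2 sqr_ge0.
have Gle l : Gsum T (A l) j j <= max_diagG T A.
  apply: le_trans (le_bigmax _ (fun l => \big[Num.max/0]_(i < d) Gsum T (A l) i i) l).
  exact: (le_bigmax _ (fun i => Gsum T (A l) i i)).
have trE (G : 'M[R]_d) : \tr (delta_mx i j *m G *m delta_mx j i) = G j j.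
  rewrite mxtrace_mulC mulmxA mul_delta_mx /mxtrace (bigD1 j)//= big1 ?addr0.
    by rewrite mxE (bigD1 j)//= big1 ?addr0 => [|a /negbTE an]; rewrite !mxE ?eqxx ?an ?mul1r ?andbF ?mul0r.
  by move=> a /negbTE an; rewrite mxE big1// => b _; rewrite mxE an mul0r.
apply: (@le_trans _ _ (\sum_l pseudoinv D l k ^+ 2 * max_diagG T A)).
  apply: ler_sum => l _; rewrite /edge_gain linearZ /= trmx_delta -!scalemxAl -scalemxAr.
  by rewrite !mxtraceZ trE mulrA -expr2 ler_wpM2l ?sqr_ge0.
rewrite -mulr_suml ler_wpM2r//.
have -> : \sum_i pseudoinv D i k ^+ 2 = sqn (col k (pseudoinv D)).
  by apply: eq_bigr => i' _; rewrite mxE.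
rewrite -norm2_sqr ler_sqr ?nnegrE ?norm2_ge0 ?mu_ge0//.
exact: (le_bigmax _ (fun j => norm2 (col j (pseudoinv D)))).
Qed.

Lemma ln_div_ge1 (n : nat) : (0 < n)%N -> 1 <= ln (n%:R / delta).
Proof.
move=> n0; apply: le_trans ln_inv_ge1 _.
rewrite ler_ln ?posrE ?divr_gt0 ?ltr0n//.
by rewrite ler_pM2r ?invr_gt0// ler1n.
Qed.

Lemma noise_edge_event : exists Bad : set (N.-tuple R), [/\ measurable Bad,
  (gaussian N Bad <= (delta / 4)%:E)%E &
  forall x, ~ Bad x -> forall k q,
    `|noise_form A (edge_gain D k (mat_of (delta_mx q 0))) x| <= F2 T A D 1 6 delta].
Proof.
have n0 : (0 < d ^ 2 * e)%N by rewrite muln_gt0 expn_gt0 d0 e0.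
have L1 := ln_div_ge1 n0; set L := ln _ in L1.
have l0 : 0 <= 2 * L by lra.
(* Both exponents are 2 L, which squares delta / (d^2 e) and so beats the union. The resulting bound
   sqrt(32 E) L, with E = mu^2 times the largest diagonal entry, explains K3 = 6. *)
have [Bad [mB PB HB]] := @noise_form_family_event R T d m A ('I_e * 'I_(d * d))%type
  (fun kq => edge_gain D kq.1 (mat_of (delta_mx kq.2 0))) (2 * L) (Num.sqrt (4 * L))
  (mu D ^+ 2 * max_diagG T A) (sqrtr_ge0 _) l0 (fun kq => mu_max_diagG kq.1 kq.2).
exists Bad; split => //.
  apply: le_trans PB _; rewrite lee_fin sqr_sqrtr; last by lra.
  have -> : - (4 * L / 2) = - L - L by field.
  have -> : - (2 * L) = - L - L by ring.
  rewrite card_prod !card_ord expRD /L expRN_ln_div ?ltr0n//.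
  have -> : (e * (d * d))%N = (d ^ 2 * e)%N by rewrite -mulnn mulnC.
  set n : R := (d ^ 2 * e)%:R; have n1 : 1 <= n by rewrite ler1n.
  clearbody n.
  have -> : n * (2 * (delta / n * (delta / n)) + 2 * (delta / n * (delta / n))) =
    4 * delta ^+ 2 / n by field; rewrite gt_eqF //; exact: (lt_le_trans ltr01 n1).
  rewrite ler_pdivrMr; last by lra.
  have d2 := sqr_delta_le.
  have : delta / 4 * 1 <= delta / 4 * n by rewrite ler_wpM2l// divr_ge0// ltW.
  by move: (delta ^+ 2) d2 (delta / 4 * n) dl0 => z d2 y; lra.
move=> x /HB H k q; apply: le_trans (H (k, q)) _.
rewrite /F2 /zeta2 -/L mul1r; set E := mu D ^+ 2 * max_diagG T A.
have E0 : 0 <= E by apply: le_trans (mu_max_diagG (Ordinal e0) q); exact: fro2_ge0.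
have -> : 6 * Num.sqrt (E * L ^+ 2) = Num.sqrt (36 * (E * L ^+ 2)).
  rewrite (sqrtrM _ (ler0n R 36)); congr (_ * _).
  have -> : 36 = 6 ^+ 2 :> R by ring.
  by rewrite sqrtr_sqr ger0_norm.
have l4 : 0 <= 4 * L by lra.
rewrite -(sqrtrM _ l4); apply: ler_wsqrtr.
have -> : 4 * L * (4 * E * (2 * L)) = 32 * (E * L ^+ 2) by ring.
by apply: ler_wpM2r; [exact: (mulr_ge0 E0 (sqr_ge0 L))|rewrite ler_nat].
Qed.

Variable c : R.
Hypothesis c_small : c * (10 * 1000 * 1000) <= 1.

Lemma gram_cst_event (v : R) : 1 <= v ->
  bet ^+ 2 / m%:R * (Num.sqrt (m * T)%:R + d%:R) * (d%:R + v) <= c * T%:R ->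
  exists Bad : set (N.-tuple R), [/\ measurable Bad,
  (gaussian N Bad <= (expR (- v))%:E)%E &
  forall x, ~ Bad x -> forall G : 'M[R]_d,
    `|gram_dev A (cst_gain (G^T *m G)) x| <= m%:R * T%:R / 8 * fro2 G].
Proof.
move=> v1 Hc; have t0 : 0 <= 8 * (d%:R + v) by move: dR; lra.
(* The 8 d in the exponent pays for the net and the factor 4, since 4 * 64^d <= 2^(8d). *)
have [Bad [mB PB HB]] := @gram_dev_cst_event R T d m A (8 * (d%:R + v)) t0.
exists Bad; split => //.
  apply: le_trans PB _; rewrite lee_fin.
  have h1 : 64 ^+ d * 4 <= expR (8 * d%:R) :> R.
    apply: le_trans (_ : 2 ^+ (6 * d + 2 * d) <= _); last first.
      by rewrite -mulnDl -natrM; exact: expR_nat_ge.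
    rewrite exprD; apply: ler_pM; [exact: exprn_ge0|exact: ler0n| |].
      by rewrite exprM; have -> : 64 = 2 ^+ 6 :> R by ring.
    have -> : 4 = 2 ^+ 2 :> R by ring.
    by rewrite ler_eXn2l ?ltr1n// leq_pmulr.
  have -> : - (8 * (d%:R + v)) = - (8 * d%:R) + - (8 * v) by ring.
  rewrite mulrA expRD mulrA; apply: (@le_trans _ _ (1 * expR (- (8 * v)))); last first.
    by rewrite mul1r ler_expR lerN2; lra.
  rewrite ler_wpM2r ?expR_ge0// expRN ler_pdivrMr ?expR_gt0// mul1r.
  exact: h1.
move=> x /HB H G; apply: le_trans (H G) _; rewrite ler_wpM2r ?fro2_ge0//.
set Y := bet ^+ 2 * Num.sqrt T%:R * Num.sqrt m%:R.
have Y0 : 0 <= Y by exact: (mulr_ge0 (mulr_ge0 (sqr_ge0 _) (sqrtr_ge0 _)) (sqrtr_ge0 _)).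
have dv0 : 0 <= d%:R + v by move: dR; lra.
have h : Y / m%:R * (d%:R + v) <= c * T%:R.
  apply: le_trans Hc; rewrite ler_wpM2r//.
  have -> : Y / m%:R = bet ^+ 2 / m%:R * Num.sqrt (m * T)%:R.
    by rewrite natrM (sqrtrM _ (ler0n R m)) /Y; ring.
  by rewrite ler_wpM2l ?divr_ge0 ?sqr_ge0// lerDl.
have {}h : Y * (d%:R + v) <= c * (m%:R * T%:R).
  have := ler_wpM2l (ltW mR) h.
  have -> : m%:R * (Y / m%:R * (d%:R + v)) = Y * (d%:R + v) by field; rewrite gt_eqF.
  by rewrite mulrCA.
have cT : c * (10 * 1000 * 1000) * (m%:R * T%:R) <= 1 * (m%:R * T%:R).
  by rewrite ler_wpM2r ?mulr_ge0.
have -> : 2 * (16 * (8 * (d%:R + v)) * Y) = 256 * (Y * (d%:R + v)) by ring.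
have YY : 0 <= Y * (d%:R + v) by rewrite mulr_ge0.
move: (m%:R * T%:R) (Y * (d%:R + v)) h YY cT => M Z h YY cT.
lra.
Qed.

Lemma gram_edge_event (compat off r : R) : 0 <= compat -> 0 <= off -> 0 < r ->
  mu D / Num.sqrt m%:R * (1 + compat + 1 / r * off)
    * (d%:R * DeltaG T A + bet ^+ 2 * d%:R * Num.sqrt T%:R * ln ((e * d)%:R / delta))
    <= c * T%:R ->
  exists (Bad : set (N.-tuple R)) W, [/\ measurable Bad,
  (gaussian N Bad <= (delta / 4)%:E)%E, 0 <= W,
  8 * ((4 * compat + 4 / r * off + 1) * Num.sqrt d%:R * W) <= T%:R * Num.sqrt m%:R &
  forall x, ~ Bad x -> forall k a b, `|gram_dev A (edge_gain D k (delta_mx a b)) x| <= W].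
Proof.
move=> c0 o0 r0 Hc.
have n0 : (0 < e * d)%N by rewrite muln_gt0 e0 d0.
have L1 := ln_div_ge1 n0; set L := ln _ in L1 Hc.
have l0 : 0 <= 3 * L by lra.
have fd (a b : 'I_d) : fro2 (delta_mx a b : 'M[R]_d) = 1.
  rewrite /fro2 (bigD1 a)//= (bigD1 b)//= big1 ?addr0; last first.
    by move=> j /negbTE jn; rewrite mxE jn andbF expr0n.
  rewrite big1 ?addr0; first by rewrite mxE !eqxx expr1n.
  by move=> i /negbTE ain; rewrite big1// => j _; rewrite mxE ain expr0n.
have Ek (k : 'I_e * 'I_d * 'I_d) : \sum_l fro2 (edge_gain D k.1.1 (delta_mx k.1.2 k.2) l) <= mu D ^+ 2.
  by apply: le_trans (sum_fro2_edge_gain _ _ _) _; rewrite fd mulr1.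
(* exp(-3 L) is the cube of delta / (e d), which outweighs the e d^2 members of the family. *)
have [Bad [mB PB HB]] := @gram_dev_family_event R T d m A _ _ _ _ l0 (mu_ge0 D) Ek.
have W0' : 0 <= bet ^+ 2 * Num.sqrt T%:R * mu D.
  exact: (mulr_ge0 (mulr_ge0 (sqr_ge0 _) (sqrtr_ge0 _)) (mu_ge0 D)).
set W := 16 * _ * _ in HB; have W0 : 0 <= W by exact: (mulr_ge0 (mulr_ge0 (ler0n R 16) l0) W0').
exists Bad, W; split => //; last by move=> x /HB H k a b; exact: (H (k, a, b)).
  apply: le_trans PB _; rewrite lee_fin !card_prod !card_ord.
  have -> : - (3 * L) = - L + (- L - L) by ring.
  rewrite !expRD /L expRN_ln_div ?ltr0n//.
  have d1 := dR; have e1 := eR; have d2 := sqr_delta_le.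
  rewrite !natrM.
  have -> : e%:R * d%:R * d%:R * (4 * (delta / (e%:R * d%:R) * (delta / (e%:R * d%:R) * (delta / (e%:R * d%:R))))) =
    4 * delta ^+ 2 * (delta / (e%:R ^+ 2 * d%:R)) by field; rewrite !gt_eqF//; lra.
  apply: (@le_trans _ _ (4 * (delta / 16) * 1)); last by lra.
  apply: ler_pM; first by rewrite mulr_ge0// sqr_ge0.
  - by rewrite divr_ge0 ?mulr_ge0 ?sqr_ge0// ltW.
  - by rewrite ler_pM2l.
  have ed : 1 <= e%:R ^+ 2 * d%:R :> R by rewrite mulr_ege1// exprn_ege1.
  by rewrite ler_pdivrMr; [move: dl1; lra|lra].
pose q := mu D / Num.sqrt m%:R * (1 + compat + 1 / r * off) * (bet ^+ 2 * d%:R * Num.sqrt T%:R * L).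
have sm : 0 < Num.sqrt m%:R :> R by rewrite sqrtr_gt0.
have or0 : 0 <= 1 / r * off by rewrite mulr_ge0// divr_ge0// ltW.
have f0 : 0 <= mu D / Num.sqrt m%:R * (1 + compat + 1 / r * off).
  by rewrite mulr_ge0 ?divr_ge0 ?mu_ge0 ?sqrtr_ge0//; lra.
have qc : q <= c * T%:R.
  apply: le_trans Hc; rewrite ler_wpM2l// lerDr mulr_ge0//.
  rewrite /DeltaG; elim/big_ind: _ => [//|x y x0 y0|l _]; first by rewrite le_max x0.
  by elim/big_ind: _ => [//|x y x0 y0|a _]; [rewrite le_max x0|exact: sqrtr_ge0].
have q0 : 0 <= q.
  exact: (mulr_ge0 f0 (mulr_ge0 (mulr_ge0 (mulr_ge0 (sqr_ge0 _) (ler0n R d)) (sqrtr_ge0 _)) (le_trans ler01 L1))).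
have sd : Num.sqrt d%:R <= d%:R :> R.
  rewrite -[leRHS]sqr_sqrtr// expr2 ler_peMr ?sqrtr_ge0//.
  by rewrite -[leLHS]sqrtr1 ler_wsqrtr.
have P1 : 4 * compat + 4 / r * off + 1 <= 4 * (1 + compat + 1 / r * off).
  have -> : 4 / r * off = 4 * (1 / r * off) by field; rewrite gt_eqF.
  lra.
have P2 : 0 <= 4 * compat + 4 / r * off + 1.
  by rewrite addr_ge0// addr_ge0// mulr_ge0// divr_ge0// ltW.
apply: (@le_trans _ _ (8 * (4 * (1 + compat + 1 / r * off) * d%:R * W))).
  rewrite ler_pM2l//; rewrite ler_wpM2r//; apply: ler_pM => //; exact: sqrtr_ge0.
have -> : 8 * (4 * (1 + compat + 1 / r * off) * d%:R * W) = 1536 * q * Num.sqrt m%:R.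
  by rewrite /W /q; field; rewrite !gt_eqF.
rewrite ler_pM2r//.
have TR : 0 <= T%:R :> R by [].
have cT : c * (10 * 1000 * 1000) * T%:R <= 1 * T%:R by rewrite ler_wpM2r.
by move: q q0 qc => z h1 h2; move: T%:R TR cT h2 => t *; lra.
Qed.

End NumericEvents.

Lemma edges_gt0 m (g : rel 'I_m) : (1 < m)%N -> connected_graph g -> (0 < #|edges g|)%N.
Proof.
case: m g => [|[|m]] g // _ [_ _ /(_ ord0 ord_max)] /connectP[[|w p] /= pth].
  by move=> /(congr1 val).
move=> _; have /andP[gw _] := pth; apply/card_gt0P; exists [set ord0; w]%SET.
by apply/imsetP; exists (ord0, w).
Qed.

Lemma mutually_independent_reindex disp (Omega : measurableType disp) (R : realType)
    (P : probability Omega R) (I J : finType) (f : J -> I) (X : I -> {RV P >-> R}) :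
  injective f -> mutually_independent X -> mutually_independent (fun j => X (f j)).
Proof.
move=> fI Xi K B mB.
(* The sets are transported to the larger index set, with the trivial constraint off the image of
   f. *)
pose B' i := if [pick j | f j == i] is Some j then B j else setT.
have B'f j : B' (f j) = B j.
  rewrite /B'; case: pickP => [j' /eqP/fI ->//|/(_ j)]; by rewrite eqxx.
have mB' i : measurable (B' i) by rewrite /B'; case: pickP => // j _; exact: mB.
have := Xi (f @: K)%SET B' mB'.
have -> : \bigcap_(i in [set i | i \in (f @: K)%SET]) (X i @^-1` B' i) =
          \bigcap_(j in [set j | j \in K]) (X (f j) @^-1` B j).
  apply/seteqP; split => w /= h.
    by move=> j jK /=; rewrite -B'f; apply: h; exact: imset_f.
  by move=> _ /imsetP[j jK ->] /=; rewrite B'f; exact: h.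
move=> ->; rewrite big_imset /=; last by move=> ? ? _ _; exact: fI.
by apply: eq_bigr => j _; rewrite B'f.
Qed.

Lemma prob_setU_le disp (Omega : measurableType disp) (R : realType)
    (P : probability Omega R) (F G : set Omega) (a b : R) :
  measurable F -> measurable G -> (P F <= a%:E)%E -> (P G <= b%:E)%E ->
  (P (F `|` G) <= (a + b)%:E)%E.
Proof.
move=> mF mG Fa Gb; apply: le_trans (measureU2 _ mF mG) _.
by rewrite EFinD; exact: leeD.
Qed.

Section TrajectoryNoise.
Context {disp : measure_display} {Omega : measurableType disp} {R : realType}.
Variables (P : probability Omega R) (T d m : nat) (A : 'I_m -> 'M[R]_d).
Variable eta : 'I_m -> nat -> 'I_d -> {RV P >-> R}.
Local Notation N := (T.+1 * (m * d))%N.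

Definition noise_rv (k : 'I_N) : {RV P >-> R} :=
  let li := mxtens_unindex (mxtens_unindex k).2 in
  eta li.1 (mxtens_unindex k).1.+1 li.2.

Lemma noise_rv_gaussian Bad : iid_standard_gaussian T eta -> measurable Bad ->
  P (rvtuple noise_rv @^-1` Bad) = gaussian N Bad.
Proof.
move=> [indep norm] mBad; apply: rvtuple_gaussian => //; last first.
  by move=> k; exact: norm.
pose f (k : 'I_N) : 'I_m * 'I_T.+1 * 'I_d :=
  let li := mxtens_unindex (mxtens_unindex k).2 in (li.1, (mxtens_unindex k).1, li.2).
apply: (mutually_independent_reindex (f := f) _ indep).
move=> k k'; case: (mxtens_indexP k) => t q; case: (mxtens_indexP k') => t' q'.
case: (mxtens_indexP q) => l i; case: (mxtens_indexP q') => l' i'.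
by rewrite /f !mxtens_indexK /= => -[-> -> ->].
Qed.

Lemma noise_rvE w l t : (0 < t <= T.+1)%N ->
  noise (rvtuple noise_rv w) l t = \col_i eta l t i w.
Proof.
case: t => // t tT; apply/colP => i; rewrite !mxE tnth_mktuple /noise_rv /noise_index.
by rewrite !mxtens_indexK /= inordK.
Qed.

Lemma trajectory_state w l t : (t <= T.+1)%N ->
  trajectory A eta w l t = state (A l) (noise (rvtuple noise_rv w) l) t.
Proof.
move=> tT; rewrite /trajectory !stateE; apply: eq_bigr => s _.
by rewrite noise_rvE//= (leq_trans (ltn_ord s)).
Qed.

Lemma response_latemx w : response T (trajectory A eta w) =
  design T (trajectory A eta w) *m astar A + latemx T d m *m tv (rvtuple noise_rv w).
Proof.
have := @vectorized_model R m d T A (fun l t => \col_i eta l t i w).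
rewrite -/(trajectory A eta w) /= => ->; congr (_ + _).
apply: blkP => l; apply: blkP => t; rewrite blk_latemx noise_rvE ?ltnS//; last first.
  by have := ltn_ord t; lia.
by apply/colP => i; rewrite !(mxE, mxtens_indexK) /= add1n.
Qed.

End TrajectoryNoise.

(** Forces lambda > 0, by which the basic inequality is divided to obtain the cone. *)
Lemma F1_gt0 (R : realType) (T d m : nat) (A : 'I_m -> 'M[R]_d) (delta : R) :
  (0 < T)%N -> (0 < d)%N -> (0 < m)%N -> 0 < delta -> delta < 16^-1 -> 0 < F1 T A 64 delta.
Proof.
move=> T0 d0 m0 dl0 dl1; have l1 := ln_inv_ge1 dl0 dl1.
have z0 : 0 <= zeta1 T A 64 delta / m%:R.
  rewrite /zeta1 -fro2_statemx divr_ge0// mulr_ge0//; last by lra.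
  by rewrite mulr_ge0// fro2_ge0.
have Z1 : 1 <= zeta1 T A 64 delta / m%:R + 1 by lra.
rewrite /F1 mulr_gt0//; first by rewrite mulr_gt0// sqrtr_gt0//; lra.
rewrite sqrtr_gt0; apply: ltr_pwDl; first by lra.
by rewrite mulr_ge0 ?divr_ge0// ln_ge0.
Qed.

Lemma failure_sum_le (R : realType) (delta a b : R) : 0 < delta -> 0 <= b -> a <= b ->
  delta / 4 + delta / 4 + (a + delta / 4) + 2 * b <= 4 * b + delta.
Proof. by move=> ? ? ?; lra. Qed.

Section GoodEvent.
Context {R : realType}.
Variables (T d m e : nat) (A : 'I_m -> 'M[R]_d) (D : 'M[R]_(e, m)).
Hypotheses (T0 : (0 < T)%N) (d0 : (0 < d)%N) (m0 : (0 < m)%N) (e0 : (0 < e)%N).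
Hypothesis DD : pseudoinv D *m D = 1%:M - const_mx m%:R^-1.
Local Notation N := (T.+1 * (m * d))%N.
Local Notation bet := (beta T A).
Local Notation Dt := (Dtilde d D).

(** The failure budget: delta/4 for each of the two noise events and for the cross terms, exp(-v)
    for the average part and 2 exp(-sqrt v) for the centred part. *)
Lemma good_event (c delta v r compat off : R) :
  0 < delta -> delta < 16^-1 -> 1 <= v -> 0 < r -> 0 <= compat -> 0 <= off ->
  c * (10 * 1000 * 1000) <= 1 ->
  let Psi := 4 * compat + 4 / r * off + 1 in
  bet ^+ 2 * (mu' D * Num.sqrt T%:R * Psi * Num.sqrt (ln (d ^ 2 * e)%:R)) * Num.sqrt v <= c * T%:R ->
  bet ^+ 2 * Num.sqrt T%:R * Num.sqrt v <= c * T%:R ->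
  bet ^+ 2 / m%:R * (Num.sqrt (m * T)%:R + d%:R) * (d%:R + v) <= c * T%:R ->
  mu D / Num.sqrt m%:R * (1 + compat + 1 / r * off)
    * (d%:R * DeltaG T A + bet ^+ 2 * d%:R * Num.sqrt T%:R * ln ((e * d)%:R / delta))
    <= c * T%:R ->
  exists Bad : set (N.-tuple R), [/\ measurable Bad,
    (gaussian N Bad <= (4 * expR (- Num.sqrt v) + delta)%:E)%E &
    forall x, ~ Bad x ->
      (forall h, dot (latemx T d m *m tv x) (designmx T A h *m tv x)
        <= F1 T A 64 delta * norm2 (meanpart h) + F2 T A D 1 6 delta * norm1 (Dt *m h)) /\
      (forall h, norm1 (Dt *m h) <= Psi * norm2 h ->
        T%:R / 2 * sqn h <= sqn (designmx T A h *m tv x))].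
Proof.
move=> dl0 dl1 v1 r0 c0 o0 cs Psi HP Hv H2 H3.
have P0 : 0 < Psi.
  by rewrite ltr_wpDl// addr_ge0// mulr_ge0// divr_ge0// ltW.
have big (y : R) : y <= c * T%:R -> 10 * 1000 * 1000 * y <= T%:R.
  have cT : c * (10 * 1000 * 1000) * T%:R <= 1 * T%:R by rewrite ler_wpM2r.
  by move: T%:R cT => t cT h; lra.
have HP' : 10 * 1000 * 1000 * (bet ^+ 2 * mu' D * Num.sqrt T%:R * Psi
    * Num.sqrt (ln (e * (d * d))%:R) * Num.sqrt v) <= T%:R.
  rewrite -(mulrA (bet ^+ 2)) -!(mulrA (bet ^+ 2)); apply: big; apply: le_trans HP.
  by rewrite (_ : (e * (d * d))%N = (d ^ 2 * e)%N) ?mulrA// -mulnn mulnC.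
have [B1 [mB1 PB1 HB1]] := noise_cst_event A T0 d0 m0 dl0 dl1.
have [B2 [mB2 PB2 HB2]] := noise_edge_event T A D d0 e0 dl0 dl1.
have [B3 [mB3 PB3 HB3]] := gram_cst_event d0 m0 cs v1 H2.
have [B4 [W [mB4 PB4 W0 WT HB4]]] := gram_edge_event d0 m0 e0 dl0 dl1 cs c0 o0 r0 H3.
have [B5 [mB5 PB5 HB5]] := centered_chaos_event T0 d0 m0 e0 v1 P0 HP' (big _ Hv).
have U12 := prob_setU_le mB1 mB2 PB1 PB2.
have U34 := prob_setU_le mB3 mB4 PB3 PB4.
have mU12 := measurableU _ _ mB1 mB2; have mU34 := measurableU _ _ mB3 mB4.
have U := prob_setU_le mU12 mU34 U12 U34; have mU := measurableU _ _ mU12 mU34.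
have UU := prob_setU_le mU mB5 U PB5.
exists ((B1 `|` B2) `|` (B3 `|` B4) `|` B5); split.
- exact: measurableU.
- apply: le_trans UU _; rewrite lee_fin.
  have sv : Num.sqrt v <= v.
    have v0 : 0 <= v by exact: le_trans ler01 v1.
    rewrite -[leRHS]sqr_sqrtr// expr2 ler_peMr ?sqrtr_ge0//.
    by rewrite -[leLHS]sqrtr1 ler_wsqrtr.
  have : expR (- v) <= expR (- Num.sqrt v) by rewrite ler_expR lerN2.
  by move=> h; apply: failure_sum_le => //; exact: expR_ge0.
move=> x /not_orP[/not_orP[/not_orP[n1 n2] /not_orP[n3 n4]] n5]; split.
  by apply: noise_bound => //; [exact: HB1|exact: HB2].
by apply: restricted_eigenvalue W0 P0 _ _ WT _ => //; [exact: HB3|exact: HB4|exact: HB5].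
Qed.

End GoodEvent.

(** The most demanding use of c is the chaining condition in [chaos_event_multi], which needs about
    16 * 40 * 1080 * 2, that is 1.4 million; ten million leaves room. *)
Lemma small_constant (R : realType) :
  exists c : R, 0 < c < 1 / 6 /\ c * (10 * 1000 * 1000) <= 1.
Proof.
have h : 6 < 10 * 1000 * 1000 :> R by lra.
move: (10 * 1000 * 1000) h => K h; have K0 : 0 < K by lra.
exists K^-1; rewrite invr_gt0 K0 mulVf ?gt_eqF//; split => //.
by rewrite div1r ltf_pV2 ?posrE//; lra.
Qed.

Theorem theorem1 (R : realType) :
  exists c c' c1 K1 K2 K3 K4 : R,
    [/\ 0 < c < 1 / 6, 0 < c' & 0 < c1 < 1] /\
    [/\ 0 < K1, 0 < K2, 0 < K3 & 0 < K4] /\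
    forall (d T m : nat) (g : rel 'I_m) (D : 'M[R]_(#|edges g|, m))
      (A : 'I_m -> 'M[R]_d)
      (disp : measure_display) (Omega : measurableType disp)
      (P : probability Omega R)
      (eta : 'I_m -> nat -> 'I_d -> {RV P >-> R})
      (delta v r lambda : R) (S : {set 'I_(#|edges g| * (d * d))})
      (ahat : Omega -> 'cV[R]_(m * (d * d))),
    (1 <= d)%N -> (1 <= T)%N -> (2 <= m)%N ->
    connected_graph g ->
    incidence_matrix D ->
    iid_standard_gaussian T eta ->
    0 < delta < c1 -> 1 <= v -> 0 < r -> 0 <= lambda ->
    (forall w, estimator T D (trajectory A eta w) lambda (ahat w)) ->
    2 / m%:R * Num.max (F1 T A K1 delta) (F2 T A D K2 K3 delta) <= lambda ->
    F3 T A D S K4 r * Num.sqrt v <= c * T%:R ->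
    beta T A ^+ 2 / m%:R * (Num.sqrt (m * T)%:R + d%:R) * (d%:R + v)
      <= c * T%:R ->
    mu D / Num.sqrt m%:R
      * (1 + compat_ratio D S + 1 / r * off_support A D S)
      * (d%:R * DeltaG T A
         + beta T A ^+ 2 * d%:R * Num.sqrt T%:R
           * ln ((#|edges g| * d)%:R / delta))
      <= c * T%:R ->
    exists E : set Omega,
      [/\ measurable E,
          ((1 - 4 * expR (- (c' * Num.sqrt v)) - delta)%:E <= P E)%E &
          forall w, E w ->
            norm2 (ahat w - astar A)
            <= 2 * m%:R * lambda / T%:R * (1 + 3 * compat_ratio D S)
               + Num.sqrt (8 * (lambda * m%:R / T%:R * off_support A D S))
               + r].
Proof.
have [c [c06 cs]] := small_constant R.
(* c1 = 1/16 gives delta^2 <= delta / 16 in the union bounds; 64 and 6 come from [noise_cst_event]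
   and [noise_edge_event]. *)
exists c, 1, 16^-1, 64, 1, 6, 1; split; [split|split; [split|]] => //.
  by rewrite invr_gt0/= invf_lt1//; lra.
move=> d T m g D A disp Omega P eta delta v r lambda S ahat d1 T1 m2 gc Dinc iid
  /andP[dl0 dl1] v1 r0 l0 hest hl h1 h2 h3.
have m0 : (0 < m)%N by exact: ltnW.
have e0 := edges_gt0 m2 gc.
have DD := pseudoinv_incidence gc Dinc m0.
have compat0 : 0 <= compat_ratio D S by exact: compat_ge0.
have off0 : 0 <= off_support A D S by exact: norm1_on_ge0.
have Psi0 : 0 <= Psi A D S r.
  by rewrite /Psi addr_ge0// addr_ge0// mulr_ge0// divr_ge0// ltW.
have bet0 : 0 <= beta T A ^+ 2 by exact: sqr_ge0.
have t1 : 0 <= mu' D ^+ 2 * Psi A D S r ^+ 2 * ln (d ^ 2 * #|edges g|)%:R.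
  apply: mulr_ge0; first exact: (mulr_ge0 (sqr_ge0 _) (sqr_ge0 _)).
  by apply: ln_ge0; rewrite ler1n muln_gt0 expn_gt0 d1 e0.
have t2 : 0 <= mu' D * Num.sqrt T%:R * Psi A D S r * Num.sqrt (ln (d ^ 2 * #|edges g|)%:R).
  exact: (mulr_ge0 (mulr_ge0 (mulr_ge0 (mu'_ge0 D) (sqrtr_ge0 _)) Psi0) (sqrtr_ge0 _)).
have t3 := sqrtr_ge0 (T%:R : R).
have hP : beta T A ^+ 2 * (mu' D * Num.sqrt T%:R * Psi A D S r * Num.sqrt (ln (d ^ 2 * #|edges g|)%:R))
    * Num.sqrt v <= c * T%:R.
  apply: le_trans h1; rewrite ler_wpM2r ?sqrtr_ge0// /F3 mul1r ler_wpM2l//.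
  by move: t1 t2 t3; lra.
have hv : beta T A ^+ 2 * Num.sqrt T%:R * Num.sqrt v <= c * T%:R.
  apply: le_trans h1; rewrite ler_wpM2r ?sqrtr_ge0// /F3 mul1r ler_wpM2l//.
  by move: t1 t2 t3; lra.
have [Bad [mB PB HB]] := good_event T1 d1 m0 e0 DD dl0 dl1 v1 r0 compat0 off0 cs hP hv h2 h3.
have mR : 0 < m%:R :> R by rewrite ltr0n.
have F1p := F1_gt0 A T1 d1 m0 dl0 dl1.
have hmax : Num.max (F1 T A 64 delta) (F2 T A D 1 6 delta) <= m%:R * lambda / 2.
  have := ler_wpM2l (ltW mR) hl.
  have -> : m%:R * (2 / m%:R * Num.max (F1 T A 64 delta) (F2 T A D 1 6 delta)) =
    2 * Num.max (F1 T A 64 delta) (F2 T A D 1 6 delta) by field; rewrite gt_eqF.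
  by rewrite ler_pdivlMr// mulrC.
move: hmax; rewrite ge_max => /andP[F1l F2l].
have lp : 0 < lambda.
  have : 0 < m%:R * lambda / 2 by exact: lt_le_trans F1l.
  by rewrite pmulr_lgt0 ?invr_gt0// pmulr_rgt0.
pose X := noise_rv (T := T) eta.
exists (rvtuple X @^-1` (~` Bad)); split.
- rewrite -[X in measurable X]setTI; apply: measurable_rvtuple => //; exact: measurableC.
- rewrite (noise_rv_gaussian iid); last exact: measurableC.
  rewrite probability_setC// mul1r.
  move: PB; rewrite -(fineK (fin_num_measure (gaussian _) _ mB)) -EFinB !lee_fin; lra.
move=> w /= nB; have [HN HR] := HB _ nB.
set x := rvtuple X w in nB HN HR.
have xE h : design T (trajectory A eta w) *m h = designmx T A h *m tv x.
  by apply: design_designmx => l t /andP[_ tT]; apply: trajectory_state; exact: leqW.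
apply: (estimator_error (eta := latemx T d m *m tv x) m0 T1 lp r0).
- by have := hest w (astar A); rewrite /objective (@response_latemx _ _ _ P T d m A eta w); exact.
- move=> h; rewrite xE; apply: le_trans (HN h) _; rewrite mulrDr; apply: lerD.
    by apply: (ler_pM (ltW F1p) (norm2_ge0 _) F1l); exact: norm2_meanpart_le.
  by rewrite ler_wpM2r//; apply: sumr_ge0.
- by move=> h hP'; rewrite xE; exact: HR.
Qed.
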